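(* Let $f$ and $\sigma$ satisfy the granular-media conditions listed in the context (in particular $\sigma$ is a constant matrix), with exponent $q$, and let the step size $h=T/M$ satisfy $h\in(0,\min\{1,1/\zeta\})$. For $i\in\{1,\dots,N\}$ let $X^{i,N}$ be the solution of the interacting particle system and $\hat X^{i,N}$ the continuous-time extension of the split-step method (SSM), both as defined in the context, with i.i.d. initial conditions $X^i_0\in L^m_0(\mathbb R^d)$. Let $m\ge\max\{8q,\,4q+4\}>\max\{2(q+1),4\}$. Then there exists a constant $C>0$ independent of $h,N,M$ (but depending on $T$ and $m$) such that $$\sup_{i\in\{1,\dots,N\}}\ \sup_{0\le t\le T}\ \mathbb E\big[|X^{i,N}_t-\hat X^{i,N}_t|^2\big]\le Ch^2.$$
   Context: Fix integers $d,l\ge1$ and $T\in(0,\infty)$, and a complete filtered probability space $(\Omega,\mathcal F,(\mathcal F_t)_{t\ge0},\mathbb P)$ carrying independent $\mathbb R^l$-valued Brownian motions $W^1,W^2,\dots$, independent of a sufficiently rich $\sigma$-algebra $\mathcal F_0$. $L^m_0(\mathbb R^d)$ is the space of $\mathcal F_0$-measurable $\mathbb R^d$-valued random variables with finite $m$-th absolute moment. $|\cdot|$ is the Euclidean norm for vectors and the Frobenius norm for matrices; $\delta_x$ is the Dirac measure at $x$. The initial conditions $X^1_0,X^2_0,\dots$ are independent and identically distributed. Granular-media conditions: $\sigma\in\mathbb R^{d\times l}$ is a constant matrix; $f:\mathbb R^d\to\mathbb R^d$ is continuously differentiable; $q\in\mathbb N$, $q>1$; and there are constants $L_f\in\mathbb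 R$, $L_{\hat f},L_{f'},L_{f''}>0$ such that for all $x,x'\in\mathbb R^d$: - $\langle x-x',f(x)-f(x')\rangle\le L_f|x-x'|^2$; $|f(x)-f(x')|\le L_{\hat f}(1+|x|^{q}+|x'|^{q})|x-x'|$; $f(x)=-f(-x)$; $f(\mathbf 0)=\mathbf 0$; - $|\nabla f(x)|\le L_{f'}(1+|x|^q)$ and $|\nabla f(x)-\nabla f(x')|\le L_{f''}(1+|x|^{q-1}+|x'|^{q-1})|x-x'|$. Set $v(x,\mu)=\int_{\mathbb R^d}f(x-y)\,\mu(\mathrm dy)$. Interacting particle system: for $N\ge1$, $i\in\{1,\dots,N\}$, $X^{i,N}$ is the unique solution of $$\mathrm dX^{i,N}_t=v(X^{i,N}_t,\mu^{X,N}_t)\,\mathrm dt+\sigma\,\mathrm dW^i_t,\quad X^{i,N}_0=X^i_0,\quad \mu^{X,N}_t=\frac1N\sum_{j=1}^N\delta_{X^{j,N}_t}.$$ SSM: for $M\ge1$ let $h=T/M$, $t_n=nh$, $n\in\{0,\dots,M\}$. Set $\hat X^{i,N}_0=X^i_0$ and, for $n\in\{0,\dots,M-1\}$, let $(Y^{1,\star,N}_n,\dots,Y^{N,\star,N}_n)\in\mathbb R^{Nd}$ be the unique solution of the coupled implicit system $$Y^{i,\star,N}_n=\hat X^{i,N}_n+h\,v(Y^{i,\star,N}_n,\hat\mu^{Y,N}_n),\qquad \hat\mu^{Y,N}_n=\frac1N\sum_{j=1}^N\delta_{Y^{j,\star,N}_n},\qquad i=1,\dots,N,$$ and set $\hat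 X^{i,N}_{n+1}=Y^{i,\star,N}_n+\sigma(W^i_{t_{n+1}}-W^i_{t_n})$. The step size is constrained through $$\zeta=\max\{2L_f,\ 4L_f^++1,\ 0\},\qquad L_f^+=\max\{0,L_f\};$$ under $h<\min\{1,1/\zeta\}$ the implicit system has a unique solution. Continuous extension: $\hat X^{i,N}_0=X^i_0$ and for $t\in[0,T]$ $$\mathrm d\hat X^{i,N}_t=v(Y^{i,\star,N}_{\kappa(t)},\hat\mu^{Y,N}_{\kappa(t)})\,\mathrm dt+\sigma\,\mathrm dW^i_t,$$ with $\kappa(t)=\sup\{t_n:t_n\le t,\ n\in\{0,\dots,M-1\}\}$ and $Y^{i,\star,N}_{t_n}:=Y^{i,\star,N}_n$, $\hat\mu^{Y,N}_{t_n}:=\hat\mu^{Y,N}_n$. Constants $C$ may depend on the fixed problem data (dimensions, $f$, $\sigma$ and their constants, $T$, $m$, the law of the initial condition) but not on $h,N,M$. *)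

(* Defs.v *)
From HB Require Import structures.
From mathcomp Require Import all_boot all_order all_algebra.
From mathcomp Require Import all_classical all_reals all_analysis.

Set Implicit Arguments.
Unset Strict Implicit.
Unset Printing Implicit Defensive.

Import Order.TTheory GRing.Theory Num.Theory numFieldNormedType.Exports.
Local Open Scope classical_set_scope.
Local Open Scope ring_scope.

(* R^d is the space of row vectors, so a matrix A acts on x as x *m A^T. The
   norm `|.| that MathComp-Analysis puts on matrices is the sup norm; it only
   serves for the topology, and estimates use the norm below. *)

(* Frobenius norm; on row vectors this is the Euclidean norm. *)
Definition frob (R : realType) (m n : nat) (A : 'M[R]_(m, n)) : R :=
  Num.sqrt (\sum_i \sum_j A i j ^+ 2).

Definition dotp (R : realType) (d : nat) (x y : 'rV[R]_d) : R :=
  \sum_i x 0 i * y 0 i.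

Definition borelRV (R : realType) (d : nat) :=
  g_sigma_algebraType (@open 'rV[R]_d).

Definition rVintegral (R : realType) (d : nat) (disp : measure_display)
    (E : measurableType disp) (mu : {measure set E -> \bar R})
    (D : set E) (g : E -> 'rV[R]_d) : 'rV[R]_d :=
  \row_k (\int[mu]_(y in D) g y 0 k)%R.

Section empirical_measure.
Context (R : realType) (d N : nat) (x : 'I_N -> borelRV R d).
Local Open Scope ereal_scope.

Definition empirical (A : set (borelRV R d)) : \bar R :=
  (N%:R^-1)%:E * \sum_(j < N) \d_(x j) A.

Let empirical0 : empirical set0 = 0.
Proof. by rewrite /empirical big1 ?mule0 // => j _; rewrite measure0. Qed.

Let empirical_ge0 A : 0 <= empirical A.
Proof.
by rewrite /empirical mule_ge0 ?lee_fin ?invr_ge0 //; apply: sume_ge0.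
Qed.

Let empirical_sigma_additive : semi_sigma_additive empirical.
Proof.
move=> A mA tA mUA.
have c0 : (0 <= N%:R^-1 :> R)%R by rewrite invr_ge0.
pose c : {nonneg R} := NngNum c0.
pose m (k : nat) : {measure set (borelRV R d) -> \bar R} :=
  if insub k is Some j then dirac (x j) else mzero.
have -> : empirical = mscale c (msum m N).
  apply/funext => B; rewrite /empirical /mscale /msum /=; congr (_ * _).
  by apply: eq_bigr => j _; rewrite /m valK.
exact: measure_semi_sigma_additive.
Qed.

HB.instance Definition _ := isMeasure.Build _ _ _ empirical
  empirical0 empirical_ge0 empirical_sigma_additive.

End empirical_measure.

(* The Jacobian 'J f x of MathComp-Analysis acts on row vectors from the right,
   hence is the transpose of the usual one; frob does not see the difference. *)
Record granular_media (R : realType) (d q : nat) (f : 'rV[R]_d -> 'rV[R]_d)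
    (Lf Lhf Lf1 Lf2 : R) : Prop := GranularMedia {
  gm_q : (1 < q)%N ;
  gm_Lhf : 0 < Lhf ;
  gm_Lf1 : 0 < Lf1 ;
  gm_Lf2 : 0 < Lf2 ;
  gm_diff : forall x, differentiable f x ;
  gm_C1 : continuous (fun x => 'J f x) ;
  gm_onesided : forall x x',
    dotp (x - x') (f x - f x') <= Lf * frob (x - x') ^+ 2 ;
  gm_lip : forall x x',
    frob (f x - f x') <=
    Lhf * (1 + frob x ^+ q + frob x' ^+ q) * frob (x - x') ;
  gm_odd : forall x, f x = - f (- x) ;
  gm_0 : f 0 = 0 ;
  gm_grad : forall x, frob ('J f x) <= Lf1 * (1 + frob x ^+ q) ;
  gm_gradlip : forall x x',
    frob ('J f x - 'J f x') <=
    Lf2 * (1 + frob x ^+ q.-1 + frob x' ^+ q.-1) * frob (x - x')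
}.

Definition drift (R : realType) (d : nat) (f : 'rV[R]_d -> 'rV[R]_d)
    (x : 'rV[R]_d) (mu : {measure set (borelRV R d) -> \bar R}) : 'rV[R]_d :=
  rVintegral mu setT (fun y => f (x - y)).

Definition zeta (R : realType) (Lf : R) : R :=
  Num.max (Num.max (2 * Lf) (4 * Num.max 0 Lf + 1)) 0.

Section probability.
Context (R : realType) (disp : measure_display) (Omega : measurableType disp).
Implicit Type P : probability Omega R.

(* Only the times t >= 0 matter. *)
Definition complete_filtration P (F : R -> set (set Omega)) : Prop :=
  [/\ forall t, 0 <= t -> sigma_algebra setT (F t),
      forall t, 0 <= t -> F t `<=` measurable,
      forall s t, 0 <= s -> s <= t -> F s `<=` F t &
      forall A, P.-negligible A -> F 0 A].

Definition sigma_rV (d : nat) (X : Omega -> 'rV[R]_d) : set (set Omega) :=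
  preimage_set_system setT X (@measurable _ (borelRV R d)).

Definition sigma_process (d : nat) (X : R -> Omega -> 'rV[R]_d) :
    set (set Omega) :=
  <<s \bigcup_(t in [set t : R | 0 <= t]) sigma_rV (X t) >>.

Definition mutually_independent P (I : choiceType)
    (G : I -> set (set Omega)) : Prop :=
  forall (J : seq I) (A : I -> set Omega), uniq J ->
    (forall i, i \in J -> G i (A i)) ->
    P (\bigcap_(i in [set` J]) A i) = (\prod_(i <- J) P (A i))%E.

(* Standard l-dimensional Brownian motion relative to the filtration F; the
   law N(0, (t - s) I_l) of the increments is given on rectangles. *)
Record brownian P (F : R -> set (set Omega)) (l : nat)
    (W : R -> Omega -> 'rV[R]_l) : Prop := Brownian {
  bm_adapted : forall t, 0 <= t -> sigma_rV (W t) `<=` F t ;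
  bm_0 : {ae P, forall w, W 0 w = 0} ;
  bm_continuous :
    {ae P, forall w, {within `[0, +oo[, continuous (fun t => W t w)}} ;
  bm_increment_indep : forall s t, 0 <= s -> s < t ->
    forall A B, F s A -> sigma_rV (fun w => W t w - W s w) B ->
    P (A `&` B) = (P A * P B)%E ;
  bm_increment_law : forall s t, 0 <= s -> s < t ->
    forall B : 'I_l -> set R, (forall k, measurable (B k)) ->
    P [set w | forall k, B k ((W t w - W s w) 0 k)] =
    (\prod_(k < l) normal_prob 0 (Num.sqrt (t - s)) (B k))%E
}.

Definition independent_brownians P (F : R -> set (set Omega)) (l : nat)
    (W : nat -> R -> Omega -> 'rV[R]_l) : Prop :=
  (forall i, brownian P F (W i)) /\
  mutually_independent P
    (fun o : option nat => if o is Some i then sigma_process (W i) else F 0).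

(* The common law is named because the constant in the error bound may depend
   on it. *)
Definition iid_initial P (F : R -> set (set Omega)) (d : nat) (m : R)
    (mu0 : probability (borelRV R d) R) (X0 : nat -> Omega -> 'rV[R]_d) : Prop :=
  [/\ forall i, sigma_rV (X0 i) `<=` F 0,
      forall i, ('E_P[fun w => (frob (X0 i w) `^ m)%R] < +oo)%E,
      forall i (B : set (borelRV R d)), measurable B ->
        P (X0 i @^-1` B) = mu0 B &
      mutually_independent P (fun i => sigma_rV (X0 i))].

Section particles.
Context (d l : nat) (f : 'rV[R]_d -> 'rV[R]_d) (sigma : 'M[R]_(d, l)) (T : R).
Context (X0 : nat -> Omega -> 'rV[R]_d) (W : nat -> R -> Omega -> 'rV[R]_l).

(* As sigma is constant, its Ito integral over [s, t] is this increment. *)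
Definition noise (i : nat) (s t : R) (w : Omega) : 'rV[R]_d :=
  (W i t w - W i s w) *m sigma^T.

Record ips_solution P (F : R -> set (set Omega)) (N : nat)
    (X : 'I_N -> R -> Omega -> 'rV[R]_d) : Prop := IpsSolution {
  ips_adapted : forall i t, 0 <= t <= T -> sigma_rV (X i t) `<=` F t ;
  ips_continuous : forall i,
    {ae P, forall w, {within `[0, T], continuous (fun t => X i t w)}} ;
  ips_equation : forall i, {ae P, forall w, forall t, 0 <= t <= T ->
    X i t w = X0 i w
      + rVintegral lebesgue_measure `[0, t]
          (fun s => drift f (X i s w) (empirical (fun j => X j s w)))
      + noise i 0 t w}
}.

Section split_step.
Context (N M : nat) (Y : nat -> 'I_N -> Omega -> 'rV[R]_d).

Definition step : R := T / M%:R.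

Definition grid (n : nat) : R := n%:R * step.

(* The value at t_n of the scheme with implicit stages Y. *)
Definition ssm (n : nat) (i : 'I_N) (w : Omega) : 'rV[R]_d :=
  if n is k.+1 then Y k i w + noise i (grid k) (grid n) w else X0 i w.

Definition ssm_implicit : Prop :=
  forall n, (n < M)%N -> forall i w,
    Y n i w =
    ssm n i w + step *: drift f (Y n i w) (empirical (fun j => Y n j w)).

Definition kappa (t : R) : R :=
  sup [set s | exists n, [/\ (n < M)%N, s = grid n & s <= t]].

(* Y viewed as a function of the grid time t_n; truncn (t_n / h) = n. *)
Definition stage_at (s : R) (i : 'I_N) (w : Omega) : 'rV[R]_d :=
  Y (Num.truncn (s / step)) i w.

Definition ssm_ext (i : 'I_N) (t : R) (w : Omega) : 'rV[R]_d :=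
  X0 i w
  + rVintegral lebesgue_measure `[0, t]
      (fun s => drift f (stage_at (kappa s) i w)
                        (empirical (fun j => stage_at (kappa s) j w)))
  + noise i 0 t w.

End split_step.
End particles.
End probability.

(* Main.v *)
Require Import Defs.
From HB Require Import structures.
From mathcomp Require Import all_boot all_order all_algebra.
From mathcomp Require Import all_classical all_reals all_analysis.
From mathcomp Require Import measurable_realfun zify ring lra.
Set Implicit Arguments.
Unset Strict Implicit.
Unset Printing Implicit Defensive.
Import Order.TTheory GRing.Theory Num.Theory numFieldNormedType.Exports.
Local Open Scope classical_set_scope.
Local Open Scope ring_scope.

(* The stages of the scheme follow an implicit Euler recursion
   Y_(n+1) = Y_n + h v(Y_(n+1)) + noise, and on a block [t_n, t_(n+1)] the exact
   solution follows the same recursion up to a local error M_n + Q_n with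
   Q_n = O(h^2) and M_n = O(h^(3/2)) of conditional mean zero given F_(t_n): expanding
   f(X^i - X^j) to first order about t_n, M_n collects the terms linear in the
   noise; sigma being constant, no stochastic integral enters. Hence E_n = X_(t_n) - Y_n satisfies
   E_(n+1) - h (v(X_(n+1)) - v(Y_(n+1))) = E_n + M_n + Q_n.
   By oddness of f the one-sided Lipschitz condition passes to the mean over all
   particles, which gives E (N^-1 sum_i |E_n^i|^2)^(3/2) <= C h^3. For a single
   particle, <E^i, v^i(X) - v^i(Y)> <= L |E^i|^2 + |E^i| B^i where B^i depends on
   the other particles only through the mean error, and a second recursion gives
   E |E_n^i|^2 <= C h^2, without exchangeability.
   Moments of order 8 q come from the same recursion for the pair differences
   X^i - X^j, whose drifts are monotone, and from the explicit mean of the system.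
   Stochastic calculus is avoided: the exact solution is compared with implicit
   Euler steps on a mesh refining the grid, on the event that all their defects
   are small, and Fatou's lemma removes the event as the mesh is refined. *)

(** * Euclidean norm and inner product *)

(** The obstacle is the size of [M_n]: over T/h blocks the triangle inequality adds h^(3/2) up to
    h^(1/2) only, whereas the squares add up to h^2. Every recursion is therefore written for a
    power of the error into which [M_n] enters at first order only through a product that integrates
    to zero. This shapes the truncation: the good events decrease, and the event of a step belongs
    to the filtration at that time, so its indicator may multiply the cross term without spoiling
    its mean. Conditional expectations never appear; a mean-zero summand is dropped from a pointwise
    bound instead. Two meshes are in play. The grid of step h carries the error recursion; each of
    its cells is cut into [k.+1] pieces, with bounds independent of [k], so that the limit in [k]
    costs nothing. For the same reason each moment estimate fixes its constant before the
    probability space, the number of particles and the meshes are introduced. *)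

Section euclidean.
Context {R : realType}.
Implicit Types (d m n : nat).

Lemma frob_ge0 m n (A : 'M[R]_(m, n)) : 0 <= frob A.
Proof. exact: sqrtr_ge0. Qed.

Lemma frob_sqr m n (A : 'M[R]_(m, n)) : frob A ^+ 2 = \sum_i \sum_j A i j ^+ 2.
Proof.
by rewrite sqr_sqrtr //; apply: sumr_ge0 => i _; apply: sumr_ge0 => j _; exact: sqr_ge0.
Qed.

Lemma dotpp d (x : 'rV[R]_d) : dotp x x = frob x ^+ 2.
Proof. by rewrite frob_sqr big_ord1; apply: eq_bigr => i _; rewrite expr2. Qed.

Lemma dotpC d (x y : 'rV[R]_d) : dotp x y = dotp y x.
Proof. by apply: eq_bigr => i _; rewrite mulrC. Qed.

Lemma dotpDr d (x y z : 'rV[R]_d) : dotp x (y + z) = dotp x y + dotp x z.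
Proof. by rewrite -big_split; apply: eq_bigr => i _; rewrite mxE mulrDr. Qed.

Lemma dotpZr d (a : R) (x y : 'rV[R]_d) : dotp x (a *: y) = a * dotp x y.
Proof. by rewrite mulr_sumr; apply: eq_bigr => i _; rewrite mxE mulrCA. Qed.

Lemma dotpNr d (x y : 'rV[R]_d) : dotp x (- y) = - dotp x y.
Proof. by rewrite -scaleN1r dotpZr mulN1r. Qed.

Lemma dotpBr d (x y z : 'rV[R]_d) : dotp x (y - z) = dotp x y - dotp x z.
Proof. by rewrite dotpDr dotpNr. Qed.

Lemma dotpDl d (x y z : 'rV[R]_d) : dotp (x + y) z = dotp x z + dotp y z.
Proof. by rewrite dotpC dotpDr !(dotpC z). Qed.

Lemma dotpZl d (a : R) (x y : 'rV[R]_d) : dotp (a *: x) y = a * dotp x y.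
Proof. by rewrite dotpC dotpZr dotpC. Qed.

Lemma dotpNl d (x y : 'rV[R]_d) : dotp (- x) y = - dotp x y.
Proof. by rewrite dotpC dotpNr dotpC. Qed.

Lemma dotpBl d (x y z : 'rV[R]_d) : dotp (x - y) z = dotp x z - dotp y z.
Proof. by rewrite dotpDl dotpNl. Qed.

Lemma dotp_sumr d (I : Type) (r : seq I) (x : 'rV[R]_d) (F : I -> 'rV[R]_d) :
  dotp x (\sum_(i <- r) F i) = \sum_(i <- r) dotp x (F i).
Proof.
elim/big_rec2: _ => [|i u v _ <-]; last by rewrite dotpDr.
by rewrite /dotp big1 // => i _; rewrite mxE mulr0.
Qed.

Lemma frobDsqr d (x y : 'rV[R]_d) :
  frob (x + y) ^+ 2 = frob x ^+ 2 + 2 * dotp x y + frob y ^+ 2.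
Proof. by rewrite -!dotpp dotpDl !dotpDr (dotpC y x); ring. Qed.

Lemma sum_sqr_cauchy_schwarz (I : finType) (x y : I -> R) :
  (\sum_i x i * y i) ^+ 2 <= (\sum_i x i ^+ 2) * (\sum_i y i ^+ 2).
Proof.
have x0 : 0 <= \sum_i x i ^+ 2 by apply: sumr_ge0 => i _; exact: sqr_ge0.
have y0 : 0 <= \sum_i y i ^+ 2 by apply: sumr_ge0 => i _; exact: sqr_ge0.
set a := \sum_i x i ^+ 2 in x0 *; set b := \sum_i y i ^+ 2 in y0 *.
set c := \sum_i x i * y i.
have key s t : 0 <= s ^+ 2 * a + 2 * (s * t * c) + t ^+ 2 * b.
  have -> : s ^+ 2 * a + 2 * (s * t * c) + t ^+ 2 * b =
      \sum_i (s * x i + t * y i) ^+ 2.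
    rewrite /a /b /c !mulr_sumr -!big_split /=.
    by apply: eq_bigr => i _; ring.
  by apply: sumr_ge0 => i _; exact: sqr_ge0.
have [a0|a0] := eqVneq a 0; last first.
  have ap : 0 < a by rewrite lt0r a0.
  by rewrite -subr_ge0 -(pmulr_rge0 _ ap); have := key (- c) a; lra.
(* Degenerate case [a = 0]: at this point the form equals [- (b + 2) * c ^+ 2], which forces
   [c = 0]. *)
have := key (- (b + 1)) c; rewrite a0 => h2.
have : 0 <= - (b + 2) * c ^+ 2 by lra.
by rewrite mul0r; have := sqr_ge0 c; nra.
Qed.

Lemma le_dotp_frob d (x y : 'rV[R]_d) : dotp x y <= frob x * frob y.
Proof.
apply: le_trans (ler_norm _) _.
rewrite -(@ler_pXn2r _ 2) ?nnegrE ?mulr_ge0 ?frob_ge0 // real_normK ?num_real //.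
rewrite exprMn !frob_sqr !big_ord1.
exact: sum_sqr_cauchy_schwarz.
Qed.

Lemma frobN m n (A : 'M[R]_(m, n)) : frob (- A) = frob A.
Proof.
congr Num.sqrt; apply: eq_bigr => i _; apply: eq_bigr => j _.
by rewrite mxE sqrrN.
Qed.

Lemma frob0 m n : frob (0 : 'M[R]_(m, n)) = 0.
Proof.
rewrite /frob big1 ?sqrtr0 // => i _; rewrite big1 // => j _.
by rewrite mxE expr0n.
Qed.

Lemma frobBC d (x y : 'rV[R]_d) : frob (x - y) = frob (y - x).
Proof. by rewrite -frobN opprB. Qed.

Lemma frobD d (x y : 'rV[R]_d) : frob (x + y) <= frob x + frob y.
Proof.
rewrite -(@ler_pXn2r _ 2) ?nnegrE ?addr_ge0 ?frob_ge0 // frobDsqr sqrrD.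
by have := le_dotp_frob x y; lra.
Qed.

Lemma frobB d (x y : 'rV[R]_d) : frob (x - y) <= frob x + frob y.
Proof. by rewrite -(frobN y) frobD. Qed.

Lemma frobZ m n a (A : 'M[R]_(m, n)) : frob (a *: A) = `|a| * frob A.
Proof.
rewrite -sqrtr_sqr /frob -sqrtrM ?sqr_ge0 //; congr Num.sqrt.
rewrite mulr_sumr; apply: eq_bigr => i _; rewrite mulr_sumr.
by apply: eq_bigr => j _; rewrite mxE exprMn.
Qed.

Lemma frob_sum d (I : Type) (r : seq I) (F : I -> 'rV[R]_d) :
  frob (\sum_(i <- r) F i) <= \sum_(i <- r) frob (F i).
Proof.
elim/big_rec2: _ => [|i u v _ h]; first by rewrite frob0.
by apply: le_trans (frobD _ _) _; rewrite lerD2l.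
Qed.

Lemma frob_mulmx m n (x : 'rV[R]_m) (A : 'M[R]_(m, n)) :
  frob (x *m A) <= frob x * frob A.
Proof.
rewrite -(@ler_pXn2r _ 2) ?nnegrE ?mulr_ge0 ?frob_ge0 // exprMn.
rewrite !frob_sqr !big_ord1 exchange_big mulr_sumr; apply: ler_sum => j _.
by rewrite mxE; apply: sum_sqr_cauchy_schwarz.
Qed.

Lemma frob_trmx m n (A : 'M[R]_(m, n)) : frob A^T = frob A.
Proof.
congr Num.sqrt; rewrite exchange_big; apply: eq_bigr => i _.
by apply: eq_bigr => j _; rewrite mxE.
Qed.

Lemma entry_le_frob m n (A : 'M[R]_(m, n)) i j : `|A i j| <= frob A.
Proof.
rewrite -(@ler_pXn2r _ 2) ?nnegrE ?frob_ge0 // real_normK ?num_real // frob_sqr.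
rewrite (bigD1 i) //= (bigD1 j) //= -addrA lerDl addr_ge0 //.
  by apply: sumr_ge0 => *; exact: sqr_ge0.
by apply: sumr_ge0 => *; apply: sumr_ge0 => *; exact: sqr_ge0.
Qed.

Lemma frob_le_sum d (x : 'rV[R]_d) : frob x <= \sum_k `|x 0 k|.
Proof.
rewrite -(@ler_pXn2r _ 2) ?nnegrE ?frob_ge0 ?sumr_ge0 // frob_sqr big_ord1.
suff [] : 0 <= \sum_k `|x 0 k| /\ \sum_k x 0 k ^+ 2 <= (\sum_k `|x 0 k|) ^+ 2 by [].
elim/big_rec2: _ => [|k u v _ [v0 h]]; first by rewrite expr0n.
split; first exact: addr_ge0.
rewrite sqrrD real_normK ?num_real // -addrA lerD2l.
by apply: le_trans h _; rewrite lerDr mulrn_wge0 // mulr_ge0.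
Qed.

End euclidean.

(** * Powers and averages *)

Section powers.
Context {R : realType}.
Implicit Types (x y a b h c : R) (p : nat).

(** A convex power lies above its tangents. Both [pow_convex] and [avg_pow_le] follow by taking the
    tangent at the mean, where the linear terms cancel. *)
Lemma pow_tangent p x y : 0 <= x -> 0 <= y ->
  y ^+ p.+1 + p.+1%:R * y ^+ p * (x - y) <= x ^+ p.+1.
Proof.
move=> x0 y0; elim: p => [|p ih]; first by rewrite !expr1 expr0 !mul1r addrCA subrr addr0.
rewrite [x ^+ _]exprS; apply: le_trans (ler_wpM2l x0 ih).
rewrite -subr_ge0.
have -> : x * (y ^+ p.+1 + p.+1%:R * y ^+ p * (x - y)) -
  (y ^+ p.+2 + p.+2%:R * y ^+ p.+1 * (x - y)) = p.+1%:R * y ^+ p * (x - y) ^+ 2.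
  by rewrite !exprS -[p.+2%:R]natr1 -[p.+1%:R]natr1; ring.
by rewrite mulr_ge0 ?sqr_ge0 ?mulr_ge0 ?exprn_ge0.
Qed.

Lemma pow_convex p (s t x y : R) : 0 <= s -> 0 <= t -> 0 < s + t -> 0 <= x -> 0 <= y ->
  (s * x + t * y) ^+ p.+1 <= (s + t) ^+ p * (s * x ^+ p.+1 + t * y ^+ p.+1).
Proof.
move=> s0 t0 st0 x0 y0; set m := (s * x + t * y) / (s + t).
have m0 : 0 <= m by rewrite divr_ge0 ?addr_ge0 ?mulr_ge0 // ltW.
have mE : s * x + t * y = (s + t) * m by rewrite /m [RHS]mulrC divfK // gt_eqF.
rewrite mE exprMn exprSr -mulrA; apply: ler_wpM2l; first by rewrite exprn_ge0 // ltW.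
have hx := ler_wpM2l s0 (pow_tangent p x0 m0).
have hy := ler_wpM2l t0 (pow_tangent p y0 m0).
apply: le_trans (lerD hx hy); rewrite le_eqVlt; apply/orP; left; apply/eqP.
have -> : s * (m ^+ p.+1 + p.+1%:R * m ^+ p * (x - m)) +
  t * (m ^+ p.+1 + p.+1%:R * m ^+ p * (y - m)) =
  (s + t) * m ^+ p.+1 + p.+1%:R * m ^+ p * ((s * x + t * y) - (s + t) * m) by ring.
by rewrite mE subrr mulr0 addr0.
Qed.

Lemma pow_add_le p x y : 0 <= x -> 0 <= y ->
  (x + y) ^+ p <= 2 ^+ p * (x ^+ p + y ^+ p).
Proof.
case: p => [|p] x0 y0; first by rewrite !expr0; lra.
have := @pow_convex p 1 1 x y ler01 ler01 (ltr0n _ 2) x0 y0; rewrite !mul1r => h.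
apply: le_trans h _; rewrite ler_wpM2r ?addr_ge0 ?exprn_ge0 //.
by rewrite exprS ler_peMl ?exprn_ge0 // ler1n.
Qed.

Lemma pow_mixed_le (i j : nat) x y : 0 <= x -> 0 <= y ->
  x ^+ i * y ^+ j <= x ^+ (i + j) + y ^+ (i + j).
Proof.
move=> x0 y0; rewrite !exprD; have [xy|yx] := leP x y.
  apply: (@le_trans _ _ (y ^+ i * y ^+ j)); last by rewrite lerDr mulr_ge0 ?exprn_ge0.
  by rewrite ler_wpM2r ?exprn_ge0 // lerXn2r.
apply: (@le_trans _ _ (x ^+ i * x ^+ j)); last by rewrite lerDl mulr_ge0 ?exprn_ge0.
by rewrite ler_wpM2l ?exprn_ge0 // lerXn2r // ?nnegrE // ltW.
Qed.

Lemma pow_le_pow1 (i j : nat) x : (i <= j)%N -> 0 <= x -> x ^+ i <= 1 + x ^+ j.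
Proof.
move=> ij x0; have [x1|x1] := leP x 1.
  by apply: (@le_trans _ _ 1); [exact: exprn_ile1|rewrite lerDl exprn_ge0].
by apply: (@le_trans _ _ (x ^+ j)); [rewrite ler_weXn2l // ltW|rewrite lerDr].
Qed.

Definition avg (N : nat) (F : 'I_N -> R) : R := N%:R^-1 * \sum_i F i.

Lemma avg_ge0 N (F : 'I_N -> R) : (forall i, 0 <= F i) -> 0 <= avg F.
Proof. by move=> F0; rewrite mulr_ge0 ?invr_ge0 ?sumr_ge0. Qed.

Lemma avg_le N (F G : 'I_N -> R) : (forall i, F i <= G i) -> avg F <= avg G.
Proof. by move=> FG; rewrite ler_wpM2l ?invr_ge0 // ler_sum. Qed.

Lemma avg_cst N c : (0 < N)%N -> avg (fun _ : 'I_N => c) = c.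
Proof.
move=> N0; rewrite /avg sumr_const card_ord -[c *+ N]mulr_natl mulKf //.
by rewrite pnatr_eq0 -lt0n.
Qed.

Lemma avgD N (F G : 'I_N -> R) : avg (fun i => F i + G i) = avg F + avg G.
Proof. by rewrite /avg big_split mulrDr. Qed.

Lemma avgZ N c (F : 'I_N -> R) : avg (fun i => c * F i) = c * avg F.
Proof. by rewrite /avg -mulr_sumr mulrCA. Qed.

Lemma avg_pow_le p N (F : 'I_N -> R) : (0 < N)%N -> (forall i, 0 <= F i) ->
  avg F ^+ p <= avg (fun i => F i ^+ p).
Proof.
case: p => [|p] N0 F0.
  rewrite expr0; under eq_fun do rewrite expr0.
  by rewrite avg_cst.
have m0 := avg_ge0 F0; set m := avg F in m0 *.
apply: le_trans (avg_le (fun i => pow_tangent p (F0 i) m0)).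
rewrite avgD avg_cst // avgZ.
have -> : avg (fun i => F i - m) = 0; last by rewrite mulr0 addr0.
by rewrite avgD avg_cst // subrr.
Qed.

Lemma avg_cauchy_schwarz N (F G : 'I_N -> R) : (0 < N)%N ->
  avg (fun i => F i * G i) ^+ 2 <= avg (fun i => F i ^+ 2) * avg (fun i => G i ^+ 2).
Proof.
move=> N0; rewrite /avg exprMn [leRHS]mulrACA -[_^-1 * _^-1]expr2 ler_wpM2l ?sqr_ge0 //.
exact: sum_sqr_cauchy_schwarz.
Qed.

Let pow_taylor_aux (K n u w v : R) : 0 <= K -> 0 <= n -> v <= 3 * u + 3 * w ->
  0 <= u -> 0 <= w -> n * u + K * v <= (n + 4 * K) * (u + w).
Proof.
move=> K0 n0 vle u0 w0.
have := mulr_ge0 K0 w0; have := mulr_ge0 K0 u0; have := mulr_ge0 n0 w0.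
by have := ler_wpM2l K0 vle; nra.
Qed.

(** The induction multiplies by [x + t], which the sign condition allows; the monomials that arise
    between the two extremes of the remainder are interpolated by [pow_mixed_le]. *)
Lemma pow_taylor p : exists2 K : R, 0 <= K & forall x t, 0 <= x -> 0 <= x + t ->
  (x + t) ^+ p.+2 <=
  x ^+ p.+2 + p.+2%:R * x ^+ p.+1 * t + K * (x ^+ p * t ^+ 2 + `|t| ^+ p.+2).
Proof.
elim: p => [|p [K K0 ih]].
  exists 1 => // x t x0 xt0; rewrite expr0 expr1 mul1r sqrrD.
  by have := exprn_ge0 2 (normr_ge0 t); nra.
have [n nE] : exists n : R, n = p.+2%:R by exists p.+2%:R.
have n0 : 0 <= n by rewrite nE.
exists (n + 4 * K) => [|x t x0 xt0]; first by rewrite addr_ge0 ?mulr_ge0.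
rewrite exprSr; apply: le_trans (ler_wpM2r xt0 (ih x t x0 xt0)) _.
have tE : t ^+ 2 = `|t| ^+ 2 by rewrite real_normK ?num_real.
set s : R := `|t| in tE *; have s0 : 0 <= s by exact: normr_ge0.
have ts : t <= s by exact: ler_norm.
have xp k : 0 <= x ^+ k by exact: exprn_ge0.
have sp k : 0 <= s ^+ k by exact: exprn_ge0.
have h1 : x ^+ p * s ^+ 3 <= x ^+ p.+1 * s ^+ 2 + s ^+ p.+3.
  rewrite [s ^+ 3]exprSr mulrA; have := pow_mixed_le p 1 x0 s0; rewrite !expr1 addn1 => h.
  have := ler_wpM2r (sp 2) h; rewrite mulrDl -exprD addn2 => h'.
  by apply: le_trans h'; rewrite mulrAC -!mulrA lexx.
have h2 : x * s ^+ p.+2 <= x ^+ p.+1 * s ^+ 2 + s ^+ p.+3.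
  have := pow_mixed_le 1 p x0 s0; rewrite !expr1 add1n => h.
  have := ler_wpM2r (sp 2) h; rewrite mulrDl -exprD addn2 -mulrA -exprD addn2.
  by move=> ?; apply: le_trans.
rewrite tE.
have -> : (x ^+ p.+2 + p.+2%:R * x ^+ p.+1 * t + K * (x ^+ p * s ^+ 2 + s ^+ p.+2)) * (x + t) =
  x ^+ p.+3 + p.+3%:R * x ^+ p.+2 * t + p.+2%:R * x ^+ p.+1 * t ^+ 2
  + K * (x ^+ p.+1 * s ^+ 2 + x * s ^+ p.+2 + (x ^+ p * s ^+ 2 + s ^+ p.+2) * t).
  by rewrite -[p.+3%:R]natr1 !exprS; ring.
have h3 : (x ^+ p * s ^+ 2 + s ^+ p.+2) * t <= x ^+ p * s ^+ 3 + s ^+ p.+3.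
  have e : x ^+ p * s ^+ 3 + s ^+ p.+3 = (x ^+ p * s ^+ 2 + s ^+ p.+2) * s by rewrite !exprS; ring.
  by rewrite e; apply: ler_wpM2l => //; rewrite addr_ge0 // mulr_ge0.
rewrite tE -!addrA lerD2l lerD2l.
have h4 : x ^+ p.+1 * s ^+ 2 + x * s ^+ p.+2 + (x ^+ p * s ^+ 2 + s ^+ p.+2) * t <=
   3 * (x ^+ p.+1 * s ^+ 2) + 3 * s ^+ p.+3 by lra.
have u0 : 0 <= x ^+ p.+1 * s ^+ 2 by rewrite mulr_ge0.
have := sp p.+3; move: h4 u0.
rewrite -[p.+2%:R * x ^+ p.+1 * s ^+ 2]mulrA.
rewrite -nE; move: (x ^+ p.+1 * s ^+ 2) (s ^+ p.+3) => u w.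
by rewrite addrA; move: (u + _ + _) => v vle u0 w0; exact: pow_taylor_aux.
Qed.

End powers.

(** * One-step inequalities and the empirical drift *)

Section recursion.
Context {R : realType}.

(** The first-order Taylor term [a ^+ p.+1 * (b - a)] is rewritten through 2 a (b - a) = b^2 - a^2 -
    (b - a)^2. The cross term [x] then comes with the weight [a ^+ p], known before the noise is
    added, and without division by [a]; all the rest is O(h). *)
Lemma one_step p (L : R) : 0 <= L -> exists2 K : R, 0 <= K &
  forall h a a' b x nu c : R, 0 < h -> h <= 1 -> h * L <= 2^-1 ->
  0 <= a -> 0 <= a' -> 0 <= b -> 0 <= nu -> 0 <= c ->
  b ^+ 2 <= a ^+ 2 + 2 * x + h * nu ^+ 2 -> `|b - a| <= Num.sqrt h * nu ->
  (1 - h * L) * a' <= b + h * c ->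
  a' ^+ p.+2 <= expR (K * h) *
    ((1 + K * h) * a ^+ p.+2 + p.+2%:R * a ^+ p * x
     + K * h * (nu ^+ p.+2 + c ^+ p.+2)).
Proof.
move=> L0; have [K1 K10 taylor] := @pow_taylor R p.
pose P : R := p.+2%:R; have P1 : 1 <= P by rewrite ler1n.
pose K2 := P + 2 * K1; have K20 : 1 <= K2 by rewrite /K2; lra.
exists (2 * L * P + P + K2) => [|h a a' b x nu c h0 h1 hL a0 a'0 b0 nu0 c0 b2 ba a'b].
  by have := mulr_ge0 L0 (ltW (lt_le_trans ltr01 P1)); lra.
have sh1 : Num.sqrt h <= 1 by rewrite -sqrtr1 ler_wsqrtr.
have sh0 : 0 <= Num.sqrt h by exact: sqrtr_ge0.
have shE : Num.sqrt h ^+ 2 = h by rewrite sqr_sqrtr // ltW.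
have tau2 : (b - a) ^+ 2 <= h * nu ^+ 2.
  by rewrite -shE -exprMn -real_normK ?num_real // lerXn2r // nnegrE mulr_ge0.
have tauP : `|b - a| ^+ p.+2 <= h * nu ^+ p.+2.
  apply: (@le_trans _ _ ((Num.sqrt h * nu) ^+ p.+2)).
    by rewrite lerXn2r // nnegrE mulr_ge0.
  rewrite exprMn ler_wpM2r ?exprn_ge0 // -addn2 exprD shE.
  by rewrite -[leRHS]mul1r ler_wpM2r ?(ltW h0) ?exprn_ile1.
have ap0 : 0 <= a ^+ p by exact: exprn_ge0.
have bP : b ^+ p.+2 <= a ^+ p.+2 + P * a ^+ p * x + K2 * h * (a ^+ p.+2 + nu ^+ p.+2).
  have := taylor a (b - a) a0; rewrite addrC subrK => /(_ b0) /le_trans; apply.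
  have mixed : a ^+ p * nu ^+ 2 <= a ^+ p.+2 + nu ^+ p.+2.
    by have := pow_mixed_le p 2 a0 nu0; rewrite addn2.
  have e1 : a ^+ p.+1 * (b - a) <= a ^+ p * x + h * (a ^+ p * nu ^+ 2) / 2.
    have -> : a ^+ p.+1 * (b - a) = a ^+ p * (a * (b - a)) by rewrite exprSr mulrA.
    have -> : a ^+ p * x + h * (a ^+ p * nu ^+ 2) / 2 = a ^+ p * (x + h * nu ^+ 2 / 2).
      by ring.
    by apply: ler_wpM2l => //; have := sqr_ge0 (b - a); nra.
  have e2 : a ^+ p * (b - a) ^+ 2 <= h * (a ^+ p * nu ^+ 2).
    by rewrite [leRHS]mulrCA; apply: ler_wpM2l.
  have e3 := ler_wpM2l (ltW h0) mixed.
  have n0 : 0 <= nu ^+ p.+2 by exact: exprn_ge0.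
  have a2 : 0 <= a ^+ p.+2 by exact: exprn_ge0.
  rewrite -/P -!addrA lerD2l /K2.
  have P0 : 0 <= P by lra.
  have f1 := ler_wpM2l P0 e1.
  have f2 := ler_wpM2l P0 e3.
  have f3 := ler_wpM2l K10 (lerD (le_trans e2 e3) tauP).
  have f4 := mulr_ge0 K10 (mulr_ge0 (ltW h0) a2).
  have f5 := mulr_ge0 P0 (mulr_ge0 (ltW h0) a2).
  have f6 := mulr_ge0 P0 (mulr_ge0 (ltW h0) n0).
  lra.
(* For 0 <= y <= 1/2 one has (1 + 2 y)(1 - y) >= 1. *)
have a'le : a' <= (1 + 2 * (h * L)) * (b + h * c).
  have y0 : 0 <= h * L by rewrite mulr_ge0 // ltW.
  have bc0 : 0 <= b + h * c by rewrite addr_ge0 // mulr_ge0 // ltW.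
  apply: (@le_trans _ _ ((1 + 2 * (h * L)) * ((1 - h * L) * a'))).
    have : 0 <= h * L * (1 - 2 * (h * L)) * a' by rewrite !mulr_ge0 //; lra.
    by nra.
  by apply: ler_wpM2l => //; lra.
(* Convexity with weights 1 and h multiplies [b] by 1 + O(h) only; [pow_add_le] would cost a factor
   [2 ^+ p.+2] at every step. *)
have hc : (b + h * c) ^+ p.+2 <= (1 + h) ^+ p.+1 * (b ^+ p.+2 + h * c ^+ p.+2).
  have := @pow_convex _ p.+1 1 h b c ler01 (ltW h0) _ b0 c0; rewrite !mul1r; apply.
  by lra.
have bcP0 : 0 <= b ^+ p.+2 + h * c ^+ p.+2.
  by apply: addr_ge0; [exact: exprn_ge0|apply: mulr_ge0; [exact: ltW|exact: exprn_ge0]].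
have G : (1 + 2 * (h * L)) ^+ p.+2 * (1 + h) ^+ p.+1 <= expR ((2 * L * P + P + K2) * h).
  apply: (@le_trans _ _ (expR (2 * (h * L)) ^+ p.+2 * expR h ^+ p.+1)).
    have expX y k : 0 <= y -> (1 + y) ^+ k <= expR y ^+ k.
      by move=> y0; rewrite lerXn2r ?nnegrE ?expR_ge0 ?expR_ge1Dx // addr_ge0.
    have y0 : 0 <= 2 * (h * L) by rewrite !mulr_ge0 // ltW.
    by apply: ler_pM; rewrite ?expX ?(ltW h0) ?exprn_ge0 ?addr_ge0 ?(ltW h0).
  rewrite -!expRM_natl -expRD ler_expR -/P -[p.+1%:R](addrK 1) natr1 -/P.
  by nra.
apply: (@le_trans _ _ (((1 + 2 * (h * L)) * (b + h * c)) ^+ p.+2)).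
  by rewrite lerXn2r // nnegrE (le_trans a'0 a'le).
rewrite exprMn.
apply: (@le_trans _ _ ((1 + 2 * (h * L)) ^+ p.+2 * ((1 + h) ^+ p.+1 * (b ^+ p.+2 + h * c ^+
    p.+2)))).
  by apply: ler_wpM2l => //; rewrite exprn_ge0 // addr_ge0 ?mulr_ge0 // ltW.
rewrite mulrA; apply: le_trans (ler_wpM2r bcP0 G) _.
apply: ler_wpM2l; first exact: expR_ge0.
apply: le_trans (lerD bP (lexx _)) _; rewrite -/P.
have n0 : 0 <= nu ^+ p.+2 by exact: exprn_ge0.
have a2 : 0 <= a ^+ p.+2 by exact: exprn_ge0.
have c2 : 0 <= c ^+ p.+2 by exact: exprn_ge0.
have LP : 0 <= 2 * L * P + P by rewrite addr_ge0 ?mulr_ge0 //; lra.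
have f1 := mulr_ge0 LP (mulr_ge0 (ltW h0) a2).
have f2 := mulr_ge0 LP (mulr_ge0 (ltW h0) n0).
have f3 := mulr_ge0 LP (mulr_ge0 (ltW h0) c2).
have f4 := ler_wpM2r (mulr_ge0 (ltW h0) c2) K20.
lra.
Qed.

Lemma discrete_gronwall (u : nat -> R) (k g : R) (m : nat) : 0 <= k -> 0 <= g ->
  (forall n, (n < m)%N -> u n.+1 <= expR k * (u n + g)) ->
  forall n, (n <= m)%N -> u n <= expR (n%:R * k) * (u 0%N + n%:R * g).
Proof.
move=> k0 g0 hu; elim=> [_|n ih nm]; first by rewrite !mul0r expR0 mul1r addr0.
apply: le_trans (hu n nm) _.
rewrite -natr1 [(_ + 1) * k]mulrDl mul1r expRD [expR _ * expR k]mulrC -mulrA.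
apply: ler_wpM2l; first exact: expR_ge0.
apply: le_trans (lerD (ih (ltnW nm)) (lexx g)) _.
rewrite [(_ + 1) * g]mulrDl mul1r addrA [leRHS]mulrDr lerD2l.
by rewrite ler_peMl // -expR0 ler_expR mulr_ge0.
Qed.

End recursion.

Section vector_field.
Context {R : realType} (d : nat).
Implicit Types x y z : 'rV[R]_d.

(** The drift for the empirical measure of [x], see [drift_empirical]. The point [z] is kept apart
    from the particles because the estimate for one particle changes the measure and the point
    separately. *)
Definition vfield (f : 'rV[R]_d -> 'rV[R]_d) N (x : 'I_N -> 'rV[R]_d) z : 'rV[R]_d :=
  N%:R^-1 *: \sum_j f (z - x j).

Lemma dotp_vfield f N (x : 'I_N -> 'rV[R]_d) u z :
  dotp u (vfield f x z) = avg (fun j => dotp u (f (z - x j))).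
Proof. by rewrite dotpZr dotp_sumr. Qed.

Lemma frob_vfield_le f N (x : 'I_N -> 'rV[R]_d) z :
  frob (vfield f x z) <= avg (fun j => frob (f (z - x j))).
Proof. by rewrite frobZ ger0_norm ?invr_ge0 // ler_wpM2l ?invr_ge0 // frob_sum. Qed.

Context (q : nat) (f : 'rV[R]_d -> 'rV[R]_d) (Lf Lhf Lf1 Lf2 : R)
  (hf : granular_media q f Lf Lhf Lf1 Lf2).
Let Lp := Num.max 0 Lf.

Lemma onesided_pos x y : dotp (x - y) (f x - f y) <= Lp * frob (x - y) ^+ 2.
Proof.
apply: le_trans (gm_onesided hf x y) _.
by rewrite ler_wpM2r ?sqr_ge0 // le_max lexx orbT.
Qed.

Lemma onesided_vfield N (x : 'I_N -> 'rV[R]_d) z z' : (0 < N)%N ->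
  dotp (z - z') (vfield f x z - vfield f x z') <= Lp * frob (z - z') ^+ 2.
Proof.
move=> N0; rewrite dotpBr !dotp_vfield.
rewrite -[X in X <= _]addr0 -(subrr (avg (fun j => dotp (z - z') (f (z' - x j))))) addrA.
have -> : avg (fun j => dotp (z - z') (f (z - x j))) - avg (fun j => dotp (z - z') (f (z' - x j)))
  = avg (fun j => dotp (z - z') (f (z - x j) - f (z' - x j))).
  rewrite /avg -mulrBr -sumrB; congr (_ * _); apply: eq_bigr => j _.
  by rewrite dotpBr.
rewrite addrK -[leRHS](avg_cst _ N0); apply: avg_le => j.
by have := onesided_pos (z - x j) (z' - x j); rewrite opprB addrA subrK.
Qed.

Lemma f_oddB x y : f (x - y) = - f (y - x).
Proof. by rewrite (gm_odd hf) opprB. Qed.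

(** Exchanging the indices turns the double sum into its negative, so the interaction never moves
    the mean of the system. *)
Lemma sum_vfield N (x : 'I_N -> 'rV[R]_d) : \sum_i vfield f x (x i) = 0.
Proof.
rewrite -scaler_sumr; apply/eqP; rewrite scaler_eq0; apply/orP; right.
set s := \sum_i _; suff : s = - s.
  move=> ss; have : 2%:R *: s == 0 by rewrite scaler_nat mulr2n {1}ss addNr.
  by rewrite scaler_eq0 pnatr_eq0.
rewrite /s -sumrN exchange_big; apply: eq_bigr => i _; rewrite -sumrN.
by apply: eq_bigr => j _; rewrite f_oddB.
Qed.

(* Antisymmetry of [f] symmetrises the double sum, so that only pair
   differences are paired with [f]. *)
Lemma onesided_system N (x y : 'I_N -> 'rV[R]_d) : (0 < N)%N ->
  avg (fun i => dotp (x i - y i) (vfield f x (x i) - vfield f y (y i))) <=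
  Lp * avg (fun i => frob (x i - y i) ^+ 2).
Proof.
move=> N0; pose e i := x i - y i.
pose F i j := f (x i - x j) - f (y i - y j).
have FC i j : F j i = - F i j by rewrite /F (f_oddB (x j)) (f_oddB (y j)) opprB opprK addrC.
have eF i : dotp (x i - y i) (vfield f x (x i) - vfield f y (y i)) = avg (fun j => dotp (e i) (F
    i j)).
  by rewrite dotpBr !dotp_vfield /avg -mulrBr -sumrB; under eq_bigr do rewrite -dotpBr.
under eq_fun do rewrite eF.
set S := avg _; suff : S + S <= 2 * (Lp * avg (fun i => frob (x i - y i) ^+ 2)) by lra.
have -> : S + S = avg (fun i => avg (fun j => dotp (e i - e j) (F i j))).
  have {2}-> : S = avg (fun i => avg (fun j => - dotp (e j) (F i j))).
    rewrite /S /avg -!mulr_sumr exchange_big; congr (_ * (_ * _)).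
    by apply: eq_bigr => i _; apply: eq_bigr => j _; rewrite FC dotpNr.
  rewrite -avgD; congr (avg _); apply/funext => i; rewrite -avgD.
  by congr (avg _); apply/funext => j; rewrite dotpBl.
have Lp0 : 0 <= Lp by rewrite le_max lexx.
have -> : 2 * (Lp * avg (fun i => frob (x i - y i) ^+ 2)) =
  avg (fun i => avg (fun j => Lp * (frob (e i) ^+ 2 + frob (e j) ^+ 2))).
  transitivity (avg (fun i : 'I_N => Lp * (frob (e i) ^+ 2 + avg (fun j => frob (e j) ^+ 2)))).
    by rewrite avgZ avgD avg_cst // /e; ring.
  by congr avg; apply/funext => i; rewrite avgZ avgD avg_cst.
have key i j : dotp (e i - e j) (F i j) <= Lp * frob (e i - e j) ^+ 2.
  have := onesided_pos (x i - x j) (y i - y j).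
  have -> : x i - x j - (y i - y j) = e i - e j by rewrite /e; apply/rowP => k; rewrite !mxE; ring.
  by [].
(* The cross terms of |e_i - e_j|^2 average to the squared norm of the mean error. They enter with
   the factor [- 2 * Lp], so dropping them rests on [Lp] being nonnegative. *)
have mean0 : 0 <= avg (fun i => avg (fun j => dotp (e i) (e j))).
  have -> : avg (fun i => avg (fun j => dotp (e i) (e j))) = frob (N%:R^-1 *: \sum_j e j) ^+ 2.
    set v := _ *: _; rewrite -dotpp {1}/v dotpZl dotpC dotp_sumr.
    congr (_ * _); apply: eq_bigr => i _.
    by rewrite dotpC /v dotpZr dotp_sumr.
  exact: sqr_ge0.
have LpM := mulr_ge0 Lp0 mean0.
apply: (@le_trans _ _ (avg (fun i => avg (fun j =>
    Lp * (frob (e i) ^+ 2 + frob (e j) ^+ 2) + (- 2 * Lp) * dotp (e i) (e j))))).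
  apply: avg_le => i; apply: avg_le => j; apply: le_trans (key i j) _.
  by rewrite frobDsqr frobN dotpNr; lra.
set A := fun i j => Lp * (frob (e i) ^+ 2 + frob (e j) ^+ 2).
have -> : avg (fun i => avg (fun j => A i j + - 2 * Lp * dotp (e i) (e j))) =
    avg (fun i => avg (A i)) + - 2 * Lp * avg (fun i => avg (fun j => dotp (e i) (e j))).
  by rewrite -avgZ -avgD; congr avg; apply/funext => i; rewrite -avgZ -avgD.
by lra.
Qed.

End vector_field.

(** * Growth and first-order expansion of the interaction force *)

Section growth.
Context {R : realType} (d q : nat) (f : 'rV[R]_d -> 'rV[R]_d) (Lf Lhf Lf1 Lf2 : R)
  (hf : granular_media q f Lf Lhf Lf1 Lf2).
Implicit Types x z a s : 'rV[R]_d.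

(** A single [u >= 1] dominating all arguments turns the polynomial weight into one monomial, the
    form in which the moment estimates take it. *)
Lemma lip_growth u x z : 1 <= u -> frob x <= u -> frob z <= u ->
  frob (f x - f z) <= 3 * Lhf * u ^+ q * frob (x - z).
Proof.
move=> u1 xu zu; apply: le_trans (gm_lip hf x z) _.
rewrite ler_wpM2r ?frob_ge0 // [3 * _]mulrC -mulrA ler_wpM2l ?(ltW (gm_Lhf hf)) //.
have u0 : 0 <= u by exact: le_trans u1.
have : frob x ^+ q <= u ^+ q by rewrite lerXn2r ?nnegrE ?frob_ge0.
have : frob z ^+ q <= u ^+ q by rewrite lerXn2r ?nnegrE ?frob_ge0.
have : 1 <= u ^+ q by exact: exprn_ege1.
lra.
Qed.

Lemma f_growth u z : 1 <= u -> frob z <= u -> frob (f z) <= 3 * Lhf * u ^+ q.+1.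
Proof.
move=> u1 zu; rewrite -[f z]subr0 -(gm_0 hf).
have z0 : frob (0 : 'rV[R]_d) <= u by rewrite frob0 (le_trans ler01).
apply: le_trans (lip_growth u1 zu z0) _; rewrite subr0 exprSr mulrA.
apply: ler_wpM2l zu; apply: mulr_ge0; last by rewrite exprn_ge0 // (le_trans ler01).
by rewrite mulr_ge0 // ltW // (gm_Lhf hf).
Qed.

Lemma jacobian_growth u z : 1 <= u -> frob z <= u -> frob ('J f z) <= 2 * Lf1 * u ^+ q.
Proof.
move=> u1 zu; apply: le_trans (gm_grad hf z) _.
rewrite [2 * _]mulrC -mulrA ler_wpM2l ?(ltW (gm_Lf1 hf)) //.
have u0 : 0 <= u by exact: le_trans u1.
have : frob z ^+ q <= u ^+ q by rewrite lerXn2r ?nnegrE ?frob_ge0.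
have : 1 <= u ^+ q by exact: exprn_ege1.
lra.
Qed.

Lemma segment_is_derive a s (t : R) :
  is_derive t (1 : R) (fun t : R => f (a - t *: s)) (- (s *m 'J f (a - t *: s))).
Proof.
have df : differentiable f (a - t *: s) := gm_diff hf _.
have dg : is_diff t (fun t : R => a - t *: s) (fun t => - (t *: s)).
  have -> : (fun t => - (t *: s)) = (cst 0 : R -> 'rV[R]_d) - ( *:%R^~ s).
    by apply/funext => r /=; rewrite sub0r.
  by apply: is_diffB.
have dfg : is_diff t (fun t : R => f (a - t *: s)) ('d f (a - t *: s) \o (fun t => - (t *: s))).
  have dff : is_diff (a - t *: s) f ('d f (a - t *: s)) by exact: DiffDef.
  exact: (is_diff_comp dg dff).
apply: DeriveDef.
  by apply: diff_derivable; case: dfg.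
rewrite deriveE; last by case: dfg.
by rewrite diff_val /= scale1r linearN -deriveE // deriveEjacobian.
Qed.

(** The Jacobian is frozen at a point [z] unrelated to the segment: in the application the expansion
    is made at the end of a block, while the coefficient of the noise must be known at its start.
    Pairing with the error vector [e] itself reduces the claim to the scalar mean value theorem, and
    one factor [frob e] cancels. *)
Lemma f_taylor u a s z : 1 <= u -> frob z <= u -> frob a + frob s <= u ->
  frob (f (a - s) - f a + s *m 'J f z) <=
  3 * Lf2 * u ^+ q.-1 * (frob (a - z) + frob s) * frob s.
Proof.
move=> u1 zu asu; set e := _ + _ *m _.
have [e0|e0] := eqVneq (frob e) 0.
  rewrite e0 mulr_ge0 ?frob_ge0 // mulr_ge0 ?addr_ge0 ?frob_ge0 //.
  rewrite mulr_ge0 ?exprn_ge0 ?(le_trans ler01 u1) // mulr_ge0 //.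
  by rewrite ltW // (gm_Lf2 hf).
have ep : 0 < frob e by rewrite lt0r e0 frob_ge0.
rewrite -(ler_pM2l ep) -expr2 -dotpp.
pose g (t : R) := dotp e (f (a - t *: s)) + t * dotp e (s *m 'J f z).
have dg (t : R) : is_derive t (1 : R) g (dotp e (s *m ('J f z - 'J f (a - t *: s)))).
  have dk k : is_derive t (1 : R) (fun t : R => f (a - t *: s) 0 k) ((- (s *m 'J f (a - t *: s)))
      0 k).
    have [h1 h2] := segment_is_derive a s t.
    apply: DeriveDef; first exact: (derivable_mxP (fun t : R => f (a - t *: s)) t 1).1.
    have := derive_mx h1.
    by rewrite h2 => ->; rewrite mxE.
  have dsum : is_derive t (1 : R) (fun t : R => dotp e (f (a - t *: s)))
      (dotp e (- (s *m 'J f (a - t *: s)))).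
    have -> : (fun t : R => dotp e (f (a - t *: s))) =
        \sum_k (e 0 k \*: (fun t : R => f (a - t *: s) 0 k)).
      by apply/funext => r; rewrite fct_sumE.
    exact: is_derive_sum.
  have -> : g = (fun t : R => dotp e (f (a - t *: s))) + (dotp e (s *m 'J f z) \*: id).
    by apply/funext => r; rewrite /g fctE /=; congr (_ + _); rewrite mulrC.
  by apply: is_derive_eq; rewrite scaler1 mulmxBr dotpBr dotpNr addrC.
have [] := @MVT_segment _ g _ 0 1 ler01 (fun t _ => dg t).
  apply: continuous_subspaceT => t; apply: differentiable_continuous.
  by apply/derivable1_diffP; case: (dg t).
move=> c c01 gE.
have -> : dotp e e = g 1 - g 0.
  by rewrite /g !scale1r scale0r subr0 mul1r mul0r addr0 /e dotpDr dotpBr; ring.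
rewrite gE subr0 mulr1; apply: le_trans (le_dotp_frob _ _) _.
apply: ler_wpM2l; first exact: frob_ge0.
apply: le_trans (frob_mulmx _ _) _; rewrite [leRHS]mulrC; apply: ler_wpM2l; first exact: frob_ge0.
move: c01; rewrite in_itv /= => /andP[c0 c1].
rewrite -frobN opprB; apply: le_trans (gm_gradlip hf _ _) _.
have u0 : 0 <= u by exact: le_trans u1.
have cs : frob (c *: s) <= frob s by rewrite frobZ ger0_norm // ler_piMl ?frob_ge0.
have acu : frob (a - c *: s) <= u by apply: le_trans asu; apply: le_trans (frobB _ _) _; rewrite
    lerD2l.
apply: ler_pM; rewrite ?frob_ge0 //.
- rewrite mulr_ge0 ?(ltW (gm_Lf2 hf)) // !addr_ge0 ?exprn_ge0 ?frob_ge0 //.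
- rewrite [3 * _]mulrC -mulrA ler_wpM2l ?(ltW (gm_Lf2 hf)) //.
  have : frob z ^+ q.-1 <= u ^+ q.-1 by rewrite lerXn2r ?nnegrE ?frob_ge0.
  have : frob (a - c *: s) ^+ q.-1 <= u ^+ q.-1 by rewrite lerXn2r ?nnegrE ?frob_ge0.
  have : 1 <= u ^+ q.-1 by exact: exprn_ege1.
  lra.
rewrite addrAC; apply: le_trans (frobB _ _) _; rewrite lerD2l //.
Qed.

End growth.

(** * Gaussian moments *)

Section gaussian.
Context {R : realType}.
Local Notation mu := (@lebesgue_measure R).

Lemma ge0_integral_normal_prob (s : R) (g : measurableTypeR R -> \bar R) : s != 0 ->
  measurable_fun [set: measurableTypeR R] g -> (forall x, 0 <= g x)%E ->
  (\int[normal_prob 0 s]_x g x = \int[mu]_x (g x * (normal_pdf 0 s x)%:E))%E.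
Proof.
move=> s0 mg g0; have dom := @normal_prob_dominates R 0 s.
rewrite -(Radon_Nikodym_SigmaFinite.change_of_variables dom g0)//.
have fint := Radon_Nikodym_SigmaFinite.f_integrable dom.
have mf := measurable_int _ fint.
have mp : measurable_fun setT (EFin \o normal_pdf 0 s).
  by apply/measurable_EFinP; exact: measurable_normal_pdf.
apply: ae_eq_integral => //; [exact: emeasurable_funM|exact: emeasurable_funM|].
apply: ae_eqe_mul2l; apply: integral_ae_eq => // E _ mE.
by rewrite -(Radon_Nikodym_SigmaFinite.f_integral dom).
Qed.

Lemma normal_pdf_expand (s x : R) : s != 0 ->
  normal_pdf 0 s x = normal_peak s * expR (- x ^+ 2 / (s ^+ 2 *+ 2)).
Proof. by move=> s0; rewrite normal_pdfE // -[x in RHS]subr0. Qed.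

Lemma pow_le_expR p (y : R) : 0 <= y -> y ^+ p <= (4 * p%:R) ^+ p * expR (y / 4).
Proof.
case: p => [|p] y0; first by rewrite !expr0 mul1r -expR0 ler_expR divr_ge0.
have k0 : 0 < (4 * p.+1%:R : R) by rewrite mulr_gt0.
have -> : y / 4 = p.+1%:R * (y / (4 * p.+1%:R)).
  by rewrite [4 * _]mulrC invfM mulrCA mulVKf // pnatr_eq0.
rewrite expRM_natl -exprMn lerXn2r ?nnegrE ?mulr_ge0 ?expR_ge0 //.
rewrite mulrC -ler_pdivrMr //; by apply: le_trans (expR_ge1Dx _); rewrite lerDr.
Qed.

(** Half of the Gaussian exponent absorbs the power: with y = x^2 / s^2, y^p exp(- y / 2) <= (4 p)^p
    exp(- y / 4). Up to the factor sqrt 2 in the peak, the right side is the density of variance 2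
    s^2, whose integral is 1. *)
Lemma normal_even_moment p : exists2 C : R, 0 <= C & forall s : R, 0 < s ->
  (\int[normal_prob 0 s]_x (x ^+ (2 * p))%:E <= (C * s ^+ (2 * p))%:E)%E.
Proof.
pose C : R := Num.sqrt 2 * (4 * p%:R) ^+ p.
have C0 : 0 <= C by rewrite mulr_ge0 // exprn_ge0 // mulr_ge0.
exists C => // s s0; have sn0 : s != 0 by rewrite gt_eqF.
have q2 : 0 < Num.sqrt 2 :> R by rewrite sqrtr_gt0.
have s'0 : Num.sqrt 2 * s != 0 by rewrite mulf_neq0 ?gt_eqF.
rewrite ge0_integral_normal_prob ?gt_eqF //; last 2 first.
- by apply/measurable_EFinP; exact: exprn_measurable.
- by move=> x; rewrite lee_fin exprM exprn_ge0 // sqr_ge0.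
apply: (@le_trans _ _ (\int[mu]_x ((C * s ^+ (2 * p))%:E * (normal_pdf 0 (Num.sqrt 2 * s)
    x)%:E))%E).
  apply: ge0_le_integral => //.
  - by move=> x _; rewrite mule_ge0 ?lee_fin ?normal_pdf_ge0 // exprM exprn_ge0 // sqr_ge0.
  - apply: emeasurable_funM; apply/measurable_EFinP; first exact: exprn_measurable.
    exact: measurable_normal_pdf.
  - apply: emeasurable_funM => //; apply/measurable_EFinP.
    exact: measurable_normal_pdf.
  - move=> x _; rewrite -!EFinM lee_fin !normal_pdf_expand //.
    have -> : normal_peak (Num.sqrt 2 * s) = (Num.sqrt 2)^-1 * normal_peak s.
      rewrite /normal_peak -invfM -sqrtrM // exprMn sqr_sqrtr //.
      by congr (Num.sqrt _)^-1; ring.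
    rewrite exprMn sqr_sqrtr //.
    set y := x ^+ 2 / s ^+ 2.
    have y0 : 0 <= y by rewrite divr_ge0 ?sqr_ge0.
    have s20 : s ^+ 2 != 0 by rewrite expf_neq0 ?gt_eqF.
    have -> : - x ^+ 2 / (s ^+ 2 *+ 2) = - (y / 2).
      by rewrite /y -mulr_natr invfM mulNr mulrA.
    have -> : - x ^+ 2 / (2 * s ^+ 2 *+ 2) = - (y / 2) + y / 4.
      by rewrite /y; field.
    have -> : x ^+ (2 * p) = s ^+ (2 * p) * y ^+ p.
      by rewrite /y expr_div_n -!exprM mulrC divfK // exprM expf_neq0.
    rewrite expRD /C.
    have -> : Num.sqrt 2 * (4 * p%:R) ^+ p * s ^+ (2 * p) *
       ((Num.sqrt 2)^-1 * normal_peak s * (expR (- (y / 2)) * expR (y / 4))) =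
       s ^+ (2 * p) * ((4 * p%:R) ^+ p * expR (y / 4)) * (normal_peak s * expR (- (y / 2))).
      by field; rewrite gt_eqF.
    rewrite ler_wpM2r ?mulr_ge0 ?normal_peak_ge0 ?expR_ge0 // ler_wpM2l //.
      by rewrite exprn_ge0 // ltW.
    exact: pow_le_expR.
rewrite integralZl//; last exact: integrable_normal_pdf.
by rewrite integral_normal_pdf mule1.
Qed.

(** The zero mean in the form used by [mean0_indep]: an equality of two nonnegative integrals,
    obtained by reflection with no integrability to check. *)
Lemma normal_pos_neg (s : R) : 0 < s ->
  (\int[normal_prob 0 s]_x (Num.max x 0)%:E = \int[normal_prob 0 s]_x (Num.max (- x) 0)%:E)%E.
Proof.
move=> s0; have sn0 : s != 0 by rewrite gt_eqF.
have m1 : measurable_fun [set: R] (fun x : R => Num.max x 0) by exact: measurable_maxr.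
have m2 : measurable_fun [set: R] (fun x : R => Num.max (- x) 0).
  by apply: measurable_maxr => //; exact: oppr_measurable.
rewrite !ge0_integral_normal_prob //; last 4 first.
- exact/measurable_EFinP.
- by move=> x; rewrite lee_fin le_max lexx orbT.
- exact/measurable_EFinP.
- by move=> x; rewrite lee_fin le_max lexx orbT.
pose G x : R := Num.max (- x) 0 * normal_pdf 0 s x.
have cpdf : continuous (normal_pdf 0 s) by exact: continuous_normal_pdf.
have cG : continuous G.
  move=> x; apply: cvgM; last exact: cpdf.
  apply: (@continuous_max _ _ (fun x : R => - x) (cst 0)); last exact: cvg_cst.
  exact: opp_continuous.
have pdfN x : normal_pdf 0 s (- x) = normal_pdf 0 s x.
  by rewrite !normal_pdf_expand // sqrrN.
have := @ge0_integration_by_substitutionNy R G 0; rewrite oppr0 => /(_ _ _)H.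
transitivity (\int[mu]_(x in `[0%R, +oo[) ((G \o -%R) x)%:E)%E.
  rewrite [RHS]integral_mkcond; apply: eq_integral => x _; rewrite patchE.
  rewrite mem_setE in_itv /= andbT /G /= opprK pdfN -EFinM.
  by case: leP => // x0; rewrite mul0r.
rewrite -H; last 2 first.
- by apply: continuous_subspaceT.
- by move=> x _; rewrite /G mulr_ge0 ?normal_pdf_ge0 // le_max lexx orbT.
rewrite [LHS]integral_mkcond; apply: eq_integral => x _; rewrite patchE.
rewrite mem_setE in_itv /= /G -EFinM.
by case: leP => // x0; rewrite max_r ?mul0r // oppr_le0 ltW.
Qed.

End gaussian.

(** * Measurability of implicitly determined functions *)

Section cylinder.
Context {R : realType} d (T : measurableType d) (I : finType) (Z : I -> T -> R).
Hypothesis mZ : forall i, measurable_fun setT (Z i).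

(** The hypothesis is openness for the pseudometric max |Z i w - Z i w'|. As [I] is finite, such a
    set is the union of the countably many rational boxes that it contains. *)
Lemma measurable_cylinder (O : set T) :
  (forall w, O w -> exists2 e : R, 0 < e &
     forall w', (forall i, `|Z i w - Z i w'| < e) -> O w') -> measurable O.
Proof.
move=> hO.
pose box (cr : {ffun I -> rat} * rat) : set T :=
  \bigcap_(i in [set: I]) [set w | `|Z i w - ratr (cr.1 i)| < ratr cr.2].
pose A (cr : {ffun I -> rat} * rat) := if `[< box cr `<=` O >] then box cr else set0.
have -> : O = \bigcup_cr A cr.
  rewrite eqEsubset; split => [w Ow|w [cr _]]; last first.
    by rewrite /A; case: asboolP => // h /h.
  have [e e0 he] := hO _ Ow.
  have /rat_in_itvoo[r] : 0 < e / 2 by rewrite divr_gt0.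
  rewrite in_itv /= => /andP[r0 re].
  have hc i : {c : rat | `|Z i w - ratr c| < ratr r}.
    apply: cid; have /rat_in_itvoo[c] : Z i w - ratr r < Z i w + ratr r.
      by rewrite ltrD2l (lt_trans _ r0) // oppr_lt0.
    by rewrite in_itv /= => hc; exists c; rewrite distrC ltr_distl.
  pose c := [ffun i => sval (hc i)].
  have bw : box (c, r) w by move=> i _ /=; rewrite ffunE; exact: svalP (hc i).
  exists (c, r) => //; rewrite /A asboolT // => w' bw'.
  apply: he => i; apply: le_lt_trans (ler_distD (ratr (c i)) _ _) _.
  have := bw i Logic.I; have := bw' i Logic.I => /=; rewrite [in X in X -> _]distrC.
  by lra.
apply: countable_bigcupT_measurable => // cr; rewrite /A; case: asboolP => // _.
apply: fin_bigcap_measurable => // i _.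
have mZi : measurable_fun setT (fun w => `|Z i w - ratr (cr.1 i)|).
  by apply: measurableT_comp => //; exact: measurable_funB.
rewrite -[X in measurable X]setTI.
have := mZi measurableT `]-oo, (ratr cr.2)[%classic; apply.
exact: measurable_itv.
Qed.

(** Composition with a continuous function that need not be exhibited. It is made for the stages of
    the scheme, which depend continuously on the data of a step but are known only through an
    equation. *)
Lemma measurable_factor (g : T -> R) :
  (forall w (e : R), 0 < e -> exists2 r : R, 0 < r &
     forall w', (forall i, `|Z i w - Z i w'| < r) -> `|g w - g w'| < e) ->
  measurable_fun setT g.
Proof.
move=> hg; apply: (measurability _ (RGenInftyO.measurableE R)).
move=> _ [_ [a ->] <-]; rewrite setTI; apply: measurable_cylinder => w /=.
rewrite in_itv /= => ga; have [|r r0 hr] := hg w (a - g w); first by rewrite subr_gt0.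
exists r => // w' /hr; rewrite in_itv /=.
have := ler_norm (g w' - g w); rewrite distrC; lra.
Qed.

End cylinder.

(** * Bounds on expectations *)

Section bounded_expectation.
Context {R : realType} d (T : measurableType d) (P : probability T R).
Implicit Types (Z A : T -> R) (c : R).

(** Measurability and sign are bundled with the bound, so that nonnegative integrals are compared
    without side conditions and the bound alone gives integrability. *)
Definition mean_le Z c : Prop :=
  [/\ measurable_fun setT Z, forall w, 0 <= Z w & (\int[P]_w (Z w)%:E <= c%:E)%E].

Lemma mean_le_trans Z c c' : c <= c' -> mean_le Z c -> mean_le Z c'.
Proof. by move=> cc' [mZ Z0 Zc]; split => //; apply: le_trans Zc _; rewrite lee_fin. Qed.

Lemma mean_le_le Z A c : measurable_fun setT Z -> (forall w, 0 <= Z w) ->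
  (forall w, Z w <= A w) -> mean_le A c -> mean_le Z c.
Proof.
move=> mZ Z0 ZA [mA A0 Ac]; split => //; apply: le_trans Ac.
apply: ge0_le_integral => //.
- by move=> w _; rewrite lee_fin.
- exact/measurable_EFinP.
- exact/measurable_EFinP.
- by move=> w _; rewrite lee_fin.
Qed.

Lemma mean_le_le_ae Z A c : measurable_fun setT Z -> (forall w, 0 <= Z w) ->
  {ae P, forall w, Z w <= A w} -> mean_le A c -> mean_le Z c.
Proof.
move=> mZ Z0 ZA [mA A0 Ac]; split => //; apply: le_trans Ac.
apply: ae_ge0_le_integral => //.
- by move=> w _; rewrite lee_fin.
- exact/measurable_EFinP.
- by move=> w _; rewrite lee_fin.
- exact/measurable_EFinP.
- by apply: filterS ZA => w ZAw _; rewrite lee_fin.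
Qed.

Lemma mean_leD Z A c c' : mean_le Z c -> mean_le A c' -> mean_le (fun w => Z w + A w) (c + c').
Proof.
move=> [mZ Z0 Zc] [mA A0 Ac]; split; first exact: measurable_funD.
  by move=> w; rewrite addr_ge0.
under eq_integral do rewrite EFinD.
rewrite ge0_integralD // ?EFinD ?leeD //.
- by move=> w _; rewrite lee_fin.
- exact/measurable_EFinP.
- by move=> w _; rewrite lee_fin.
- exact/measurable_EFinP.
Qed.

Lemma mean_leZ a Z c : 0 <= a -> mean_le Z c -> mean_le (fun w => a * Z w) (a * c).
Proof.
move=> a0 [mZ Z0 Zc]; split; first exact: measurable_funM.
  by move=> w; rewrite mulr_ge0.
under eq_integral do rewrite EFinM.
rewrite ge0_integralZl_EFin //.
- by rewrite EFinM lee_wpmul2l ?lee_fin.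
- by move=> w _; rewrite lee_fin.
- exact/measurable_EFinP.
Qed.

Lemma mean_le_cst c : 0 <= c -> mean_le (fun _ => c) c.
Proof.
move=> c0; split => //.
by rewrite integral_cst // [X in (_ * X)%E]probability_setT mule1.
Qed.

Lemma mean_le_sum (I : Type) (r : seq I) (Z : I -> T -> R) (c : I -> R) :
  (forall i, mean_le (Z i) (c i)) ->
  mean_le (fun w => \sum_(i <- r) Z i w) (\sum_(i <- r) c i).
Proof.
move=> h; elim: r => [|i r ih].
  by under eq_fun do rewrite big_nil; rewrite big_nil; exact: mean_le_cst.
under eq_fun do rewrite big_cons.
by rewrite big_cons; exact: mean_leD.
Qed.

Lemma mean_le_avg N (Z : 'I_N -> T -> R) c : (0 < N)%N -> (forall i, mean_le (Z i) c) ->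
  mean_le (fun w => avg (Z^~ w)) c.
Proof.
move=> N0 h; rewrite -[c](avg_cst _ N0); apply: mean_leZ; first by rewrite invr_ge0.
exact: mean_le_sum.
Qed.

Lemma mean_le_integrable Z c : mean_le Z c -> P.-integrable setT (EFin \o Z).
Proof.
move=> [mZ Z0 Zc]; apply/integrableP; split; first exact/measurable_EFinP.
under eq_integral => w _ do rewrite gee0_abs ?lee_fin //.
by apply: le_lt_trans Zc _; rewrite ltry.
Qed.

Lemma mean_le_pow_le Z c (i j : nat) : (i <= j)%N -> measurable_fun setT Z ->
  (forall w, 0 <= Z w) -> mean_le (fun w => Z w ^+ j) c -> mean_le (fun w => Z w ^+ i) (1 + c).
Proof.
move=> ij mZ Z0 Zc; apply: mean_le_le (mean_leD (mean_le_cst ler01) Zc).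
- exact: measurable_funX.
- by move=> w; rewrite exprn_ge0.
- by move=> w; exact: pow_le_pow1.
Qed.

Definition mean0 (m : T -> R) : Prop :=
  P.-integrable setT (EFin \o m) /\ (\int[P]_w (m w)%:E = 0)%E.

Lemma mean0D m m' : mean0 m -> mean0 m' -> mean0 (fun w => m w + m' w).
Proof.
move=> [im m0] [im' m'0]; split; first exact: (integrableD measurableT im im').
under eq_integral do rewrite EFinD.
by rewrite (integralD measurableT im im') m0 m'0 adde0.
Qed.

Lemma mean0Z a m : mean0 m -> mean0 (fun w => a * m w).
Proof.
move=> [im m0]; split; first exact: (integrableZl measurableT a im).
under eq_integral do rewrite EFinM.
by rewrite (integralZl measurableT im) m0 mule0.
Qed.

Lemma mean0_sum (I : Type) (r : seq I) (m : I -> T -> R) :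
  (forall i, mean0 (m i)) -> mean0 (fun w => \sum_(i <- r) m i w).
Proof.
move=> h; elim: r => [|i r ih].
  under eq_fun do rewrite big_nil; split; first exact: integrable0.
  exact: integral0.
by under eq_fun do rewrite big_cons; exact: mean0D.
Qed.

(** Takes the place of conditioning on the past: a mean-zero summand of either sign disappears from
    a pointwise bound once it is integrated. *)
Lemma mean_le_le_mean0 Z A m c : measurable_fun setT Z -> (forall w, 0 <= Z w) ->
  (forall w, Z w <= A w + m w) -> mean_le A c -> mean0 m -> mean_le Z c.
Proof.
move=> mZ Z0 ZA Ac [im m0]; split => //.
have iA := mean_le_integrable Ac.
have iAm := integrableD measurableT iA im.
case: Ac => mA A0 Ac; apply: le_trans Ac.
apply: (@le_trans _ _ (\int[P]_w ((A w)%:E + (m w)%:E))%E).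
  apply: ge0_le_integral => //.
  - by move=> w _; rewrite lee_fin.
  - exact/measurable_EFinP.
  - exact: measurable_int iAm.
  - by move=> w _; rewrite -EFinD lee_fin.
by rewrite (integralD measurableT iA im) m0 adde0.
Qed.

(* The good events [A k] need not be monotone, so this is Fatou's lemma. *)
Lemma mean_le_fatou Z c (A : nat -> set T) (k0 : nat) :
  (forall k, measurable (A k)) -> measurable_fun setT Z -> (forall w, 0 <= Z w) ->
  {ae P, forall w, exists k1 : nat, forall k, (k1 <= k)%N -> A k w} ->
  (forall k, (k0 <= k)%N -> mean_le (fun w => \1_(A k) w * Z w) c) -> mean_le Z c.
Proof.
move=> mA mZ Z0 Aev hk; split => //.
pose u k w := (\1_(A k) w * Z w)%:E.
have mu k : measurable_fun setT (u k).
  by apply/measurable_EFinP; apply: measurable_funM => //; exact: measurable_indic.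
have u0 k w : (0 <= u k w)%E by rewrite lee_fin mulr_ge0.
have mlim : measurable_fun setT (fun w => limn_einf (u^~ w)).
  have -> : (fun w => limn_einf (u^~ w)) = (fun w => - limn_esup (fun k => - u k w))%E.
    by apply/funext => w; rewrite -[LHS]oppeK -limn_esupN.
  apply: (measurableT_comp (@oppe_measurable R setT)).
  by apply: measurable_fun_limn_esup => k; exact: measurableT_comp.
have lim0 w : (0 <= limn_einf (u^~ w))%E.
  rewrite limn_einf_lim; apply: lime_ge; first exact: is_cvg_einfs.
  by apply: nearW => k; apply: le_ereal_inf_tmp => _ [j _ <-].
have le1 : (\int[P]_w (Z w)%:E <= \int[P]_w limn_einf (u^~ w))%E.
  apply: ae_ge0_le_integral => //.
  - by move=> w _; rewrite lee_fin.
  - exact/measurable_EFinP.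
  - apply: filterS Aev => w [k1 hk1] _.
    have : u^~ w @ \oo --> (Z w)%:E.
      apply: cvg_near_cst; exists k1 => // k /= kk.
      by rewrite /u indicE mem_set ?mul1r //; exact: hk1.
    by move=> /cvg_limn_einf_sup[-> _].
apply: le_trans le1 _; apply: le_trans (fatou _ measurableT mu (fun k w _ => u0 k w)) _.
rewrite limn_einf_lim; apply: lime_le; first exact: is_cvg_einfs.
near=> k; apply: le_trans (ereal_inf_lbound _) _; first by exists k => //=.
by case: (hk k _) => //; near: k; exists k0.
Unshelve. all: by end_near. Qed.

End bounded_expectation.

(** * Measurability with respect to a sub-sigma-algebra, Brownian increments *)

Section sub_sigma_algebra.
Context {R : realType} disp (T : measurableType disp).
Implicit Types (G : set (set T)) (Z : T -> R).

(** The carrier is given the sigma-algebra generated by [G], so that the closure properties of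
    measurable functions apply to a sub-sigma-algebra as they stand. *)
Definition meas_wrt G Z : Prop :=
  measurable_fun setT (Z : g_sigma_algebraType G -> R).

Lemma meas_wrt_preimage G Z (B : set R) : sigma_algebra setT G -> meas_wrt G Z ->
  measurable B -> G (Z @^-1` B).
Proof.
move=> sG mZ mB; have := mZ measurableT B mB.
by rewrite setTI /measurable /= sigma_algebra_id.
Qed.

Lemma meas_wrt_measurable G Z : G `<=` measurable -> meas_wrt G Z -> measurable_fun setT Z.
Proof.
move=> GM mZ _ B mB; have := mZ measurableT B mB.
rewrite /measurable /=; apply: smallest_sub => //.
exact: sigma_algebra_measurable.
Qed.

Lemma meas_wrt_sub G G' Z : G `<=` G' -> meas_wrt G Z -> meas_wrt G' Z.
Proof.
move=> GG' mZ _ B mB; have := mZ measurableT B mB.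
by apply: smallest_sub; [exact: smallest_sigma_algebra|move=> A /GG'; exact: sub_sigma_algebra].
Qed.

Lemma measurable_coordinate d k (B : set R) : measurable B ->
  measurable [set x : borelRV R d | B (x 0 k)].
Proof.
move=> mB; have ck : continuous (fun x : 'rV[R]_d => x 0 k) by exact: coord_continuous.
have : measurable_fun setT (fun x : borelRV R d => x 0 k : R).
  apply: (measurability _ (RGenOpens.measurableE R)) => _ [_ [a [b ->]] <-].
  have oP : open ((fun x : 'rV[R]_d => x 0 k) @^-1` `]a, b[%classic).
    by apply: open_comp => [x _|]; [exact: ck|exact: interval_open].
  by rewrite setTI; apply: sub_sigma_algebra; exact: oP.
by move=> /(_ measurableT _ mB); rewrite setTI.
Qed.

Lemma sigma_rV_coordinate d (X : T -> 'rV[R]_d) k (B : set R) : measurable B ->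
  sigma_rV X [set w | B (X w 0 k)].
Proof.
move=> mB; exists [set x : borelRV R d | B (x 0 k)]; last by rewrite setTI.
exact: measurable_coordinate.
Qed.

Lemma meas_wrt_entry G d (X : T -> 'rV[R]_d) k : sigma_rV X `<=` G ->
  meas_wrt G (fun w => X w 0 k).
Proof.
move=> XG _ B mB; rewrite setTI; apply: sub_sigma_algebra; apply: XG.
exact: sigma_rV_coordinate.
Qed.

Lemma sub_sigma_measurable G (A : set T) : sigma_algebra setT G ->
  @measurable _ (g_sigma_algebraType G) A -> G A.
Proof. by move=> sG; rewrite /measurable /= sigma_algebra_id. Qed.

Lemma measurable_meas_wrt_le G Z c : meas_wrt G Z ->
  @measurable _ (g_sigma_algebraType G) [set w | Z w <= c].
Proof.
move=> mZ; have := mZ measurableT `]-oo, c]%classic (measurable_itv _).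
rewrite setTI; congr (measurable _); apply/seteqP; split => w /=; by rewrite in_itv.
Qed.

Lemma meas_wrt_indic G (A : set T) : G A -> meas_wrt G (\1_A : T -> R).
Proof. by move=> GA; apply: measurable_indic; exact: sub_sigma_algebra. Qed.

End sub_sigma_algebra.

Section independence.
Context {R : realType} disp (T : measurableType disp) (P : probability T R).
Variables psi eta : T -> R.
Hypotheses (mpsi : measurable_fun setT psi) (meta : measurable_fun setT eta).
Hypothesis indep : forall A B : set R, measurable A -> measurable B ->
  P (psi @^-1` A `&` eta @^-1` B) = (P (psi @^-1` A) * P (eta @^-1` B))%E.

(** Independence on rectangles makes the joint law the product of the two laws; Tonelli's theorem
    then factors the integral without integrability. *)
Lemma ge0_expectation_indep (g1 g2 : R -> R) :
  measurable_fun setT g1 -> measurable_fun setT g2 ->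
  (forall x, 0 <= g1 x) -> (forall x, 0 <= g2 x) ->
  (\int[P]_w (g1 (psi w) * g2 (eta w))%:E =
   \int[P]_w (g1 (psi w))%:E * \int[P]_w (g2 (eta w))%:E)%E.
Proof.
move=> mg1 mg2 g10 g20.
pose X1 : {mfun T >-> R} := HB.pack psi (isMeasurableFun.Build _ _ _ _ psi mpsi).
pose X2 : {mfun T >-> R} := HB.pack eta (isMeasurableFun.Build _ _ _ _ eta meta).
have mX : measurable_fun setT (fun w => (psi w, eta w)) by exact: measurable_fun_pair.
pose X : {mfun T >-> (R * R)%type} :=
  HB.pack (fun w => (psi w, eta w)) (isMeasurableFun.Build _ _ _ _ _ mX).
pose g z : \bar R := (g1 z.1 * g2 z.2)%:E.
have mg : measurable_fun setT g.
  apply/measurable_EFinP; apply: measurable_funM.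
    exact: (measurableT_comp mg1 measurable_fst).
  exact: (measurableT_comp mg2 measurable_snd).
have g0 z : (0 <= g z)%E by rewrite lee_fin mulr_ge0.
transitivity (\int[distribution P X]_z g z)%E.
  by rewrite ge0_integral_distribution.
rewrite -(@eq_measure_integral _ _ _ _ (distribution P X)
  (distribution P X1 \x distribution P X2)%E); last first.
  by move=> A mA _; apply: product_measure_unique.
rewrite fubini_tonelli1 // /fubini_F.
rewrite (eq_integral (fun x => (g1 x)%:E * \int[P]_w (g2 (eta w))%:E)%E); last first.
  move=> x _; rewrite /g /=.
  under eq_integral do rewrite EFinM.
  rewrite ge0_integralZl_EFin //; last 2 first.
  - by move=> y _; rewrite lee_fin.
  - exact/measurable_EFinP.
  rewrite ge0_integral_distribution; [by []|exact/measurable_EFinP|].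
  by move=> y; rewrite lee_fin.
rewrite ge0_integralZr //; last 3 first.
- exact/measurable_EFinP.
- by move=> y _; rewrite lee_fin.
- by apply: integral_ge0 => y _; rewrite lee_fin.
rewrite ge0_integral_distribution; [by []|exact/measurable_EFinP|].
by move=> y; rewrite lee_fin.
Qed.

Let pos (x : R) : R := Num.max x 0.
Let neg (x : R) : R := Num.max (- x) 0.

(** Both factors are split into positive and negative parts. The product formula bounds each of the
    four products by [a * b] in mean, hence they are integrable, and the hypothesis on [eta] cancels
    them in pairs. *)
Lemma mean0_indep (a b : R) : mean_le P (fun w => `|psi w|) a ->
  mean_le P (fun w => `|eta w|) b ->
  (\int[P]_w (pos (eta w))%:E = \int[P]_w (neg (eta w))%:E)%E ->
  mean0 P (fun w => psi w * eta w).
Proof.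
move=> ha hb eta0.
have mpos : measurable_fun setT pos by exact: measurable_maxr.
have mneg : measurable_fun setT neg.
  by apply: measurable_maxr => //; exact: oppr_measurable.
have pos0 x : 0 <= pos x by rewrite le_max lexx orbT.
have neg0 x : 0 <= neg x by rewrite le_max lexx orbT.
have pos_le x : pos x <= `|x| by rewrite ge_max ler_norm normr_ge0.
have neg_le x : neg x <= `|x| by rewrite ge_max -normrN ler_norm normr_ge0.
have pn x : x = pos x - neg x.
  rewrite /pos /neg; have [x0|x0] := leP x 0.
    by rewrite max_l ?oppr_ge0 // sub0r opprK.
  by rewrite max_r ?subr0 // oppr_le0 ltW.
have key (g : R -> R) : measurable_fun setT g -> (forall x : R, 0 <= g x) ->
    (forall x, g x <= `|x|) -> mean0 P (fun w => g (psi w) * eta w).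
  move=> mg g0 g_le.
  have E (g2 : R -> R) : measurable_fun setT g2 -> (forall x : R, 0 <= g2 x) -> (forall x, g2 x
      <= `|x|) ->
      mean_le P (fun w => g (psi w) * g2 (eta w)) (a * b).
    move=> mg2 g20 g2_le; split.
    - by apply: measurable_funM; exact: measurableT_comp.
    - by move=> w; rewrite mulr_ge0.
    rewrite ge0_expectation_indep // EFinM; apply: lee_pmul.
    - by apply: integral_ge0 => w _; rewrite lee_fin.
    - by apply: integral_ge0 => w _; rewrite lee_fin.
    - have [] // := mean_le_le (measurableT_comp mg mpsi) (fun w => g0 _) (fun w => g_le _) ha.
    - have [] // := mean_le_le (measurableT_comp mg2 meta) (fun w => g20 _) (fun w => g2_le _) hb.
  have i1 := mean_le_integrable (E _ mpos pos0 pos_le).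
  have i2 := mean_le_integrable (E _ mneg neg0 neg_le).
  have -> : (fun w => g (psi w) * eta w) =
      (fun w => g (psi w) * pos (eta w) - g (psi w) * neg (eta w)).
    by apply/funext => w; rewrite -mulrBr -pn.
  split; first by have := integrableB measurableT i1 i2.
  under eq_integral do rewrite EFinB.
  rewrite (integralB measurableT i1 i2) /= !ge0_expectation_indep // eta0 subee //.
  rewrite -ge0_expectation_indep //.
  by have := integrable_fin_num measurableT i2.
have -> : (fun w => psi w * eta w) =
    (fun w => pos (psi w) * eta w + - 1 * (neg (psi w) * eta w)).
  by apply/funext => w; rewrite mulN1r -mulrBl -pn.
by apply: mean0D; [exact: key|apply: mean0Z; exact: key].
Qed.

End independence.

Section brownian_increments.
Context {R : realType} disp (Omega : measurableType disp) (P : probability Omega R)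
  (F : R -> set (set Omega)) (l : nat) (W : R -> Omega -> 'rV[R]_l).
Hypotheses (hF : complete_filtration P F) (bW : brownian P F W).
Implicit Types (s t : R) (c : 'I_l).

Lemma filtration_algebra t : 0 <= t -> sigma_algebra setT (F t).
Proof. by case: hF => h _ _ _; exact: h. Qed.

Lemma filtration_measurable t : 0 <= t -> F t `<=` measurable.
Proof. by case: hF => _ h _ _; exact: h. Qed.

Lemma filtration_mono s t : 0 <= s -> s <= t -> F s `<=` F t.
Proof. by case: hF => _ _ h _; exact: h. Qed.

Lemma meas_wrt_filtration_meas t (Z : Omega -> R) : 0 <= t -> meas_wrt (F t) Z ->
  measurable_fun setT Z.
Proof. by move=> t0; apply: meas_wrt_measurable; exact: filtration_measurable. Qed.

Lemma meas_wrt_bm t c : 0 <= t -> meas_wrt (F t) (fun w => W t w 0 c).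
Proof. by move=> t0; apply: meas_wrt_entry; exact: bm_adapted bW t t0. Qed.

Lemma meas_wrt_increment s t c : 0 <= s -> s <= t ->
  meas_wrt (F t) (fun w => (W t w - W s w) 0 c).
Proof.
move=> s0 st; have t0 := le_trans s0 st.
under eq_fun do rewrite !mxE.
apply: measurable_funB; first exact: meas_wrt_bm.
by apply: meas_wrt_sub (meas_wrt_bm c s0); exact: filtration_mono.
Qed.

Lemma ge0_integral_increment s t c (g : R -> R) : 0 <= s -> s < t ->
  measurable_fun setT g -> (forall x, 0 <= g x) ->
  (\int[P]_w (g ((W t w - W s w) 0 c))%:E =
   \int[normal_prob 0 (Num.sqrt (t - s))]_x (g x)%:E)%E.
Proof.
move=> s0 st mg g0; have t0 := le_trans s0 (ltW st).
pose eta w : measurableTypeR R := (W t w - W s w) 0 c.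
have meta : measurable_fun setT eta := meas_wrt_filtration_meas t0 (meas_wrt_increment c s0 (ltW
    st)).
pose X : {mfun Omega >-> measurableTypeR R} := HB.pack eta (isMeasurableFun.Build _ _ _ _ eta meta).
transitivity (\int[distribution P X]_x (g x)%:E)%E.
  rewrite ge0_integral_distribution; [by []|exact/measurable_EFinP|].
  by move=> y; rewrite lee_fin.
apply: eq_measure_integral => B mB _.
(* The law of the increment is given on rectangles; leaving all other coordinates free yields its
   marginal. *)
pose Bs k := if k == c then B else setT.
have mBs k : measurable (Bs k) by rewrite /Bs; case: ifP.
transitivity (P [set w | forall k, Bs k ((W t w - W s w) 0 k)]).
  congr (P _); apply/seteqP; split => w /=.
    by move=> Bw k; rewrite /Bs; case: eqP => // ->.
  by move=> /(_ c); rewrite /Bs eqxx.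
rewrite (bm_increment_law bW s0 st mBs) (bigD1 c) //= big1 => [|k kc].
  by rewrite mule1 /Bs eqxx.
by rewrite /Bs (negbTE kc); exact: probability_setT.
Qed.

End brownian_increments.

Lemma increment_moment {R : realType} (l : nat) p : (0 < l)%N ->
  exists2 C : R, 0 <= C &
  forall disp (Omega : measurableType disp) (P : probability Omega R)
    (F : R -> set (set Omega)) (W : R -> Omega -> 'rV[R]_l),
  complete_filtration P F -> brownian P F W -> forall s t : R, 0 <= s -> s <= t ->
  mean_le P (fun w => frob (W t w - W s w) ^+ (2 * p)) (C * (t - s) ^+ p).
Proof.
move=> hl.
have [C C0 hC] := @normal_even_moment R p.
have lC0 : 0 <= l%:R ^+ p * C by rewrite mulr_ge0 ?exprn_ge0.
(* The summand 1 serves the case [s = t], [p = 0], where both powers are 1 and the constant itself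
   must be at least 1. *)
exists (l%:R ^+ p * C + 1) => [|disp Omega P F W hF bW s t s0]; first by rewrite addr_ge0.
rewrite le_eqVlt => /predU1P[<-|st].
  under eq_fun do rewrite subrr frob0.
  case: (p) lC0 => [|p'] lC0.
    apply: (mean_le_trans (c := 1)); last by rewrite muln0; exact: mean_le_cst.
    by rewrite subrr expr0 mulr1 lerDr.
  rewrite subrr mulnS !expr0n mulr0; exact: mean_le_cst.
pose eta c w : R := (W t w - W s w) 0 c.
have t0 := le_trans s0 (ltW st).
have meta c : measurable_fun setT (eta c).
  exact (meas_wrt_filtration_meas hF t0 (meas_wrt_increment hF bW c s0 (ltW st))).
have ts0 : 0 < t - s by rewrite subr_gt0.
have eta_mom c : mean_le P (fun w => (eta c w ^+ 2) ^+ p) (C * (t - s) ^+ p).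
  split.
  - by apply: measurable_funX; exact: measurable_funX.
  - by move=> w; rewrite exprn_ge0 // sqr_ge0.
  under eq_integral do rewrite -exprM.
  rewrite (ge0_integral_increment hF bW c s0 st (g := fun x => x ^+ (2 * p))).
  - have := hC (Num.sqrt (t - s)); rewrite sqrtr_gt0 => /(_ ts0) /le_trans; apply.
    by rewrite lee_fin exprM sqr_sqrtr // ltW.
  - exact: exprn_measurable.
  - by move=> x; rewrite exprM exprn_ge0 // sqr_ge0.
have frobE w : frob (W t w - W s w) ^+ (2 * p) = l%:R ^+ p * avg (fun c => eta c w ^+ 2) ^+ p.
  rewrite exprM frob_sqr big_ord1 -exprMn /avg mulrA mulfV ?mul1r // pnatr_eq0.
  by rewrite -lt0n.
have mfrob : measurable_fun setT (fun w => frob (W t w - W s w) ^+ (2 * p)).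
  under eq_fun do rewrite frobE; apply: measurable_funM => //; apply: measurable_funX.
  by apply: measurable_funM => //; apply: measurable_sum => c; exact: measurable_funX.
apply: (mean_le_trans (c := l%:R ^+ p * (C * (t - s) ^+ p))).
  by rewrite mulrDl mulrA lerDl mul1r exprn_ge0 // ltW.
apply: mean_le_le mfrob _ _ (mean_leZ (exprn_ge0 p (ler0n R l)) (mean_le_avg hl eta_mom)) => w.
  by rewrite exprn_ge0 ?frob_ge0.
rewrite frobE; apply: ler_wpM2l; first exact: exprn_ge0.
by apply: avg_pow_le => // c; exact: sqr_ge0.
Qed.


Lemma mean0_increment {R : realType} disp (Omega : measurableType disp)
  (P : probability Omega R) (F : R -> set (set Omega)) (l : nat)
  (W : R -> Omega -> 'rV[R]_l) (s t : R) c (psi : Omega -> R) (a : R) :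
  (0 < l)%N -> complete_filtration P F -> brownian P F W -> 0 <= s -> s <= t ->
  meas_wrt (F s) psi -> mean_le P (fun w => `|psi w|) a ->
  mean0 P (fun w => psi w * (W t w - W s w) 0 c).
Proof.
move=> hl hF bW s0; rewrite le_eqVlt => /predU1P[<-|st] mpsi hpsi.
  under eq_fun do rewrite subrr mxE mulr0.
  by split; [exact: integrable0|exact: integral0].
have t0 := le_trans s0 (ltW st).
have meta := meas_wrt_filtration_meas hF t0 (meas_wrt_increment hF bW c s0 (ltW st)).
have [C C0 /(_ _ _ _ _ _ hF bW s t s0 (ltW st)) hC] := @increment_moment R l 1 hl.
have mfrob : measurable_fun setT (fun w => `|(W t w - W s w) 0 c|) by exact: measurableT_comp.
have heta : mean_le P (fun w => `|(W t w - W s w) 0 c|) (1 + C * (t - s) ^+ 1).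
  apply: mean_le_le (mean_leD (mean_le_cst P ler01) hC) => // w.
  apply: le_trans (entry_le_frob _ 0 c) _; rewrite muln1 -[X in X <= _]expr1.
  by apply: pow_le_pow1 => //; exact: frob_ge0.
apply: (mean0_indep _ meta _ hpsi heta).
- exact (meas_wrt_filtration_meas hF s0 mpsi).
- move=> A B mA mB; apply: (bm_increment_indep bW s0 st).
    exact: meas_wrt_preimage (filtration_algebra hF s0) mpsi mA.
  exact: (@sigma_rV_coordinate R disp Omega l (fun w => W t w - W s w) c B mB).
have pos0 (x : R) : 0 <= Num.max x 0 by rewrite le_max lexx orbT.
have mneg : measurable_fun setT (fun x : R => Num.max (- x) 0).
  by apply: measurable_maxr => //; exact: oppr_measurable.
apply: etrans (ge0_integral_increment hF bW c s0 st (g := fun x => Num.max x 0) _ _) _ => //.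
  exact: measurable_maxr.
rewrite normal_pos_neg ?sqrtr_gt0 ?subr_gt0 //.
apply/esym/(ge0_integral_increment hF bW c s0 st (g := fun x => Num.max (- x) 0)).
- exact: mneg.
- by move=> x; exact: pos0.
Qed.

(* [al], [b] are the norms of the error before and after the addition of the noise
   of one step, [x] is their cross term, [nu] and [c] measure the noise and
   the remaining drift. *)
Lemma moment_recursion {R : realType} p (L : R) : 0 <= L -> exists2 C : R, 0 <= C &
  forall disp (Omega : measurableType disp) (P : probability Omega R)
    (h beta a0 : R) (n : nat) (A : nat -> set Omega) (al b x nu c : nat -> Omega -> R),
  0 < h -> h <= 1 -> h * L <= 2^-1 -> 0 <= beta ->
  (forall k, (k <= n)%N -> measurable (A k)) ->
  (forall k, (k < n)%N -> A k.+1 `<=` A k) ->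
  (forall k, (k <= n)%N -> measurable_fun setT (al k)) ->
  (forall k w, 0 <= al k w) -> (forall k w, 0 <= b k w) ->
  (forall k w, 0 <= nu k w) -> (forall k w, 0 <= c k w) ->
  (forall k w, b k w ^+ 2 <= al k w ^+ 2 + 2 * x k w + h * nu k w ^+ 2) ->
  (forall k w, `|b k w - al k w| <= Num.sqrt h * nu k w) ->
  (forall k w, (k < n)%N -> A k.+1 w ->
     (1 - h * L) * al k.+1 w <= b k w + h * c k w) ->
  (forall k, (k < n)%N -> mean_le P (fun w => nu k w ^+ p.+2) beta) ->
  (forall k, (k < n)%N -> mean_le P (fun w => c k w ^+ p.+2) beta) ->
  (forall k a, (k < n)%N -> mean_le P (fun w => \1_(A k) w * al k w ^+ p.+2) a ->
     mean0 P (fun w => \1_(A k) w * (al k w ^+ p * x k w))) ->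
  mean_le P (fun w => \1_(A 0%N) w * al 0%N w ^+ p.+2) a0 ->
  forall k, (k <= n)%N -> mean_le P (fun w => \1_(A k) w * al k w ^+ p.+2)
    (expR (k%:R * (C * h)) * (a0 + k%:R * (C * h * beta))).
Proof.
move=> L0; have [K K0 step] := one_step p L0.
(* The factor 2 merges the two growth factors of [one_step]: [expR (K * h) * (1 + K * h) <= expR (2
   * K * h)]. *)
exists (2 * K) => [|disp Omega P h be a0 n A al b x nu c h0 h1 hL be0 mA dA mal al0 b0 nu0 c0 hb
    hba hal hnu hc hx ha0].
  by rewrite mulr_ge0.
pose g := 2 * K * h; have g0 : 0 <= g by rewrite !mulr_ge0 // ltW.
pose u k := iter k (fun v => expR g * (v + g * be)) a0.
have a00 : 0 <= a0.
  case: ha0 => _ h2 h3; rewrite -lee_fin; apply: le_trans h3.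
  by apply: integral_ge0 => w _; rewrite lee_fin.
have u0 k : 0 <= u k.
  by elim: k => //= k ih; rewrite mulr_ge0 ?expR_ge0 // addr_ge0 // mulr_ge0.
suff hu k : (k <= n)%N -> mean_le P (fun w => \1_(A k) w * al k w ^+ p.+2) (u k).
  move=> k kn; apply: mean_le_trans (hu k kn).
  have := @discrete_gronwall R u g (g * be) n g0 (mulr_ge0 g0 be0).
  by move=> /(_ (fun k _ => lexx _) k kn).
elim: k => [//|k ih kn]; have {}ih := ih (ltnW kn).
have mZ : measurable_fun setT (fun w => \1_(A k.+1) w * al k.+1 w ^+ p.+2).
  apply: measurable_funM; first exact/measurable_indic/mA.
  exact/measurable_funX/mal.
have Kh0 : 0 <= K * h by rewrite mulr_ge0 // ltW.
set G := expR (K * h); have G0 : 0 <= G by exact: expR_ge0.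
have G1 : 1 + K * h <= G by exact: expR_ge1Dx.
have GG : expR g = G * G by rewrite -expRD /g; congr expR; ring.
apply: (@mean_le_le_mean0 _ _ _ P _
  (fun w => G * ((1 + K * h) * (\1_(A k) w * al k w ^+ p.+2) +
                 K * h * (nu k w ^+ p.+2 + c k w ^+ p.+2)))
  (fun w => G * (p.+2%:R * (\1_(A k) w * (al k w ^+ p * x k w))))) => //.
- by move=> w; rewrite mulr_ge0 ?exprn_ge0.
- move=> w; rewrite -mulrDr.
  have st a' : 0 <= a' -> (1 - h * L) * a' <= b k w + h * c k w -> a' ^+ p.+2 <=
      G * ((1 + K * h) * al k w ^+ p.+2 + p.+2%:R * al k w ^+ p * x k w
     + K * h * (nu k w ^+ p.+2 + c k w ^+ p.+2)).
    by move=> a'0 ha'; apply: step (hba k w) ha'.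
  have nuc0 : 0 <= G * (K * h * (nu k w ^+ p.+2 + c k w ^+ p.+2)).
    by rewrite mulr_ge0 // mulr_ge0 // addr_ge0 ?exprn_ge0.
  rewrite !indicE; have [Akw|nAkw] := boolP (w \in A k); last first.
    have -> : (w \in A k.+1) = false.
      by apply: contraNF nAkw; rewrite !inE; exact: dA.
    by rewrite /= !mul0r !mulr0 add0r addr0.
  rewrite !mul1r; have -> : (1 + K * h) * al k w ^+ p.+2 +
     K * h * (nu k w ^+ p.+2 + c k w ^+ p.+2) + p.+2%:R * (al k w ^+ p * x k w) =
     (1 + K * h) * al k w ^+ p.+2 + p.+2%:R * al k w ^+ p * x k w
     + K * h * (nu k w ^+ p.+2 + c k w ^+ p.+2) by rewrite !mulrA addrAC.
  have [Ak1|_] := boolP (w \in A k.+1).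
    by rewrite mul1r; apply: st => //; apply: hal => //; rewrite inE in Ak1.
  (* On [A k] minus [A k.+1] the left side is 0, but the cross term may be negative; [one_step] with
     [a' = 0] shows that the right side is nonnegative all the same. *)
  rewrite mul0r; have := st 0 (lexx _); rewrite expr0n /=; apply.
  by rewrite mulr0 addr_ge0 // mulr_ge0 // ltW.
- apply: (mean_le_trans (c := G * ((1 + K * h) * u k + K * h * (be + be)))).
    rewrite /= GG -[G * G * _]mulrA; apply: ler_wpM2l => //.
    rewrite [leRHS]mulrDr; apply: lerD; first exact: ler_wpM2r.
    have -> : K * h * (be + be) = g * be by rewrite /g; ring.
    by apply: ler_peMl; [rewrite mulr_ge0|apply: le_trans G1; rewrite lerDl].
  apply: mean_leZ => //; apply: mean_leD; first by apply: mean_leZ => //; rewrite addr_ge0.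
  by apply: mean_leZ => //; apply: mean_leD; [exact: hnu|exact: hc].
- by apply: mean0Z; apply: mean0Z; apply: hx ih.
Qed.

(** * Drift of the particle system along paths *)

Section empirical_integral.
Context {R : realType} (d N : nat) (x : 'I_N -> borelRV R d).

Lemma ge0_integral_empirical (phi : borelRV R d -> R) :
  measurable_fun setT phi -> (forall y, 0 <= phi y) ->
  (\int[empirical x]_y (phi y)%:E = (avg (fun j => phi (x j)))%:E)%E.
Proof.
move=> mphi phi0; have mE : measurable_fun setT (EFin \o phi) by exact/measurable_EFinP.
have c0 : (0 <= N%:R^-1 :> R)%R by rewrite invr_ge0.
pose c : {nonneg R} := NngNum c0.
pose m (k : nat) : {measure set (borelRV R d) -> \bar R} :=
  if insub k is Some j then dirac (x j) else mzero.
rewrite (@eq_measure_integral _ _ _ _ (mscale c (msum m N))); last first.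
  move=> B mB _; rewrite /= /empirical /mscale /msum /=; congr (_ * _)%E.
  by apply: eq_bigr => j _; rewrite /m valK.
rewrite ge0_integral_mscale //; last by move=> y _; rewrite lee_fin.
rewrite ge0_integral_measure_sum //; last by move=> y _; rewrite lee_fin.
rewrite /avg EFinM -sumEFin; congr (_ * _)%E; apply: eq_bigr => j _.
rewrite /m valK integral_dirac // diracT mul1e //.
Qed.

Lemma Rintegral_empirical (phi : borelRV R d -> R) : measurable_fun setT phi ->
  \int[empirical x]_y phi y = avg (fun j => phi (x j)).
Proof.
move=> mphi; have mpos : measurable_fun setT (fun y => Num.max (phi y) 0).
  by apply: measurable_maxr.
have mneg : measurable_fun setT (fun y => Num.max (- phi y) 0).
  by apply: measurable_maxr => //; exact: measurableT_comp.
rewrite /Rintegral integralE.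
rewrite (_ : (EFin \o phi)^\+ = (fun y => (Num.max (phi y) 0)%:E))%E; last first.
  by apply/funext => y; rewrite funeposE /= -EFin_max.
rewrite (_ : (EFin \o phi)^\- = (fun y => (Num.max (- phi y) 0)%:E))%E; last first.
  by apply/funext => y; rewrite funenegE /= -EFin_max.
rewrite !ge0_integral_empirical //; last 2 first.
- by move=> y; rewrite le_max lexx orbT.
- by move=> y; rewrite le_max lexx orbT.
rewrite -EFinB /= /avg -mulrBr -sumrB; congr (_ * _); apply: eq_bigr => j _.
have [h|h] := leP (phi (x j)) 0.
  by rewrite max_l ?oppr_ge0 // sub0r opprK.
by rewrite max_r ?subr0 // oppr_le0 ltW.
Qed.

End empirical_integral.

Section continuity.
Context {R : realType} (d q : nat) (f : 'rV[R]_d -> 'rV[R]_d) (Lf Lhf Lf1 Lf2 : R)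
  (hf : granular_media q f Lf Lhf Lf1 Lf2).

Lemma f_continuous : continuous f.
Proof. by move=> x; apply: differentiable_continuous; exact: gm_diff hf x. Qed.

Lemma drift_empirical N (x : 'I_N -> 'rV[R]_d) z :
  drift f z (empirical (x : 'I_N -> borelRV R d)) = vfield f x z.
Proof.
apply/rowP => k; rewrite !mxE summxE Rintegral_empirical //.
apply: (measurability _ (RGenOpens.measurableE R)) => _ [_ [a [b ->]] <-].
rewrite setTI; apply: sub_sigma_algebra.
have c1 : continuous (fun y : 'rV[R]_d => z - y).
  move=> y; apply: cvgB; [exact: (nbhs_filter (y : 'rV[R]_d))|exact: (@cst_continuous _ _ z
      y)|exact: cvg_id].
have cg : continuous (fun y : 'rV[R]_d => f (z - y) 0 k).
  move=> y; apply: (cvg_comp (fun y => f (z - y)) (fun y : 'rV[R]_d => y 0 k)).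
    exact: (cvg_comp (fun y => z - y) f (c1 y) (@f_continuous _)).
  exact: coord_continuous.
have oP : open ((fun y : 'rV[R]_d => f (z - y) 0 k) @^-1` `]a, b[%classic).
  by apply: open_comp => [y _|]; [exact: cg|exact: interval_open].
exact: oP.
Qed.

Lemma within_continuous_vfield N (x : R -> 'I_N -> 'rV[R]_d) (z : R -> 'rV[R]_d) (A : set R) k :
  (forall j, {within A, continuous (fun t => x t j)}) ->
  {within A, continuous z} ->
  {within A, continuous (fun t => vfield f (x t) (z t) 0 k)}.
Proof.
move=> cx cz t.
apply: (cvg_comp (fun t : subspace A => vfield f (x t) (z t)) (fun y : 'rV[R]_d => y 0 k)).
  apply: cvgZr; apply: cvg_big => [|j _]; first exact: add_continuous.
  apply: (cvg_comp (fun t : subspace A => z t - x t j) f _ (@f_continuous (z t - x t j))).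
  by apply: cvgB; [exact: cz|exact: cx].
exact: coord_continuous.
Qed.

End continuity.

(** * Increments of integrals along continuous paths *)

Section riemann.
Context {R : realType}.
Local Notation mu := (@lebesgue_measure R).

Lemma segment_uniform_continuity (a b : R) (y : R -> R) :
  {within `[a, b], continuous y} -> forall e, 0 < e ->
  exists2 r : R, 0 < r & forall s t, s \in `[a, b] -> t \in `[a, b] ->
    `|s - t| < r -> `|y s - y t| <= e.
Proof.
move=> cy e e0.
have /compact_near_coveringP cpt := @segment_compact R a b.
pose Q (r s : R) := s \in `[a, b] -> forall t, t \in `[a, b] ->
    `|s - t| < r -> `|y s - y t| <= e.
have : \forall r \near 0^'+, `[a, b] `<=` Q r.
  apply: cpt => x xab.
  have /cvgrPdist_lt/(_ (e / 2)) := (subspace_continuousP _ _).1 cy x xab.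
  rewrite divr_gt0 // => /(_ isT).
  rewrite near_withinE near_nbhs => -[r /= r0 hr].
  have r20 : 0 < r / 2 by rewrite divr_gt0.
  exists (ball x (r / 2), [set r' | r' < r / 2]) => /=.
    split; first exact: nbhsx_ballx.
    by apply: nbhs_right_lt.
  move=> [s r'] /= [xs r'r] sab t tab st.
  rewrite /ball /= in xs.
  have h1 : `|y x - y s| < e / 2.
    by apply: (hr s) => //; rewrite /ball /=; lra.
  have h2 : `|y x - y t| < e / 2.
    by apply: (hr t) => //; rewrite /ball /=; apply: le_lt_trans (ler_distD s _ _) _; lra.
  apply: le_trans (ler_distD (y x) _ _) _; rewrite distrC in h1; lra.
rewrite near_withinE => -[r /= r0 hr].
exists (r / 2) => [|s t sab]; first by rewrite divr_gt0.
apply: (hr (r / 2)) => //=; last by rewrite divr_gt0.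
by rewrite /ball_ /= sub0r normrN gtr0_norm ?divr_gt0 // ltr_pdivrMr // ltr_pMr // ltr1n.
Qed.

(** The integrand is sampled at the right end, to match an implicit Euler step. The error is
    relative to [t - s] and uniform in both times, so that it can be summed over a mesh. *)
Lemma riemann_increment (T : R) (y : R -> R) : 0 <= T ->
  {within `[0, T], continuous y} -> forall e, 0 < e ->
  exists2 r : R, 0 < r & forall s t, 0 <= s -> s <= t -> t <= T -> t - s < r ->
    `|\int[mu]_(u in `[0, t]) y u - \int[mu]_(u in `[0, s]) y u - (t - s) * y t|
       <= e * (t - s).
Proof.
move=> T0 cy e e0; have [r r0 hr] := segment_uniform_continuity cy e0.
exists r => // s t s0 st tT tsr.
have sub u v : 0 <= u -> v <= T -> `[u, v] `<=` `[0, T].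
  move=> u0 vT w /=; rewrite !in_itv /= => /andP[uw wv].
  by rewrite (le_trans u0 uw) (le_trans wv vT).
have int u v : 0 <= u -> v <= T -> mu.-integrable `[u, v] (EFin \o y).
  move=> u0 vT; apply: continuous_compact_integrable; first exact: segment_compact.
  by apply: continuous_subspaceW cy; exact: sub.
rewrite Rintegral_itvB ?bnd_simp //; last by apply: int => //; exact: lexx.
have tsE : fine (mu `]s, t]%classic) = t - s.
  rewrite lebesgue_measure_itv /= lte_fin; case: ltP => // ts.
  by apply/eqP; rewrite eq_sym subr_eq0 eq_le ts st.
have sub' : `]s, t] `<=` `[s, t] by apply: subset_itvr; rewrite bnd_simp.
have intc (c : R) : mu.-integrable `]s, t] (EFin \o (fun=> c)).
  apply: integrableS; [| |exact: sub'|] => //.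
  by apply: continuous_compact_integrable; [exact: segment_compact|move=> ?; exact: cvg_cst].
have inty : mu.-integrable `]s, t] (EFin \o y).
  by apply: integrableS; [| |exact: sub'|] => //; exact: int.
have -> : (t - s) * y t = \int[mu]_(u in `]s, t]) y t by rewrite Rintegral_cst // tsE mulrC.
rewrite -RintegralB //.
have intB := integrableB _ inty (intc (y t)).
apply: le_trans (le_normr_Rintegral _ _) _ => //; first exact: intB.
have -> : e * (t - s) = \int[mu]_(u in `]s, t]) e by rewrite Rintegral_cst // tsE.
apply: le_Rintegral => //.
  by apply: (integrable_abse (intB _)).
move=> u /=; rewrite in_itv /= => /andP[su ut]; apply: hr.
- by rewrite in_itv /= (le_trans s0 (ltW su)) (le_trans ut tT).
- by rewrite in_itv /= (le_trans s0 st) tT.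
- by rewrite distrC ger0_norm ?subr_ge0 //; lra.
Qed.

End riemann.

Section vector_measurability.
Context {R : realType} disp (T : measurableType disp) (G : set (set T)) (d : nat).
Implicit Types X Y : T -> 'rV[R]_d.

Definition vmeas_wrt X : Prop := forall k, meas_wrt G (fun w => X w 0 k).

Lemma vswrtD X Y : vmeas_wrt X -> vmeas_wrt Y -> vmeas_wrt (fun w => X w + Y w).
Proof. by move=> hX hY k; under eq_fun do rewrite mxE; apply: measurable_funD; [exact: hX|exact:
    hY]. Qed.

Lemma vswrtB X Y : vmeas_wrt X -> vmeas_wrt Y -> vmeas_wrt (fun w => X w - Y w).
Proof. by move=> hX hY k; under eq_fun do rewrite !mxE; apply: measurable_funB; [exact: hX|exact:
    hY]. Qed.

Lemma vswrtZ a X : vmeas_wrt X -> vmeas_wrt (fun w => a *: X w).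
Proof. by move=> hX k; under eq_fun do rewrite mxE; apply: measurable_funM => //; exact: hX. Qed.

Lemma vmeas_wrt_sum (I : Type) (r : seq I) (X : I -> T -> 'rV[R]_d) :
  (forall i, vmeas_wrt (X i)) -> vmeas_wrt (fun w => \sum_(i <- r) X i w).
Proof. by move=> hX k; under eq_fun do rewrite summxE; apply: measurable_sum => i; exact: hX. Qed.

Lemma meas_wrt_dotp X Y : vmeas_wrt X -> vmeas_wrt Y -> meas_wrt G (fun w => dotp (X w) (Y w)).
Proof. by move=> hX hY; apply: measurable_sum => k; apply: measurable_funM; [exact: hX|exact:
    hY]. Qed.

Lemma meas_wrt_frob X : vmeas_wrt X -> meas_wrt G (fun w => frob (X w)).
Proof.
move=> hX; under eq_fun do rewrite -[frob _]ger0_norm ?frob_ge0 // -sqrtr_sqr -dotpp.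
apply: (measurableT_comp _ (meas_wrt_dotp hX hX)).
by apply: continuous_measurable_fun; exact: sqrt_continuous.
Qed.

Lemma meas_wrt_continuous X (g : 'rV[R]_d -> R) : continuous g -> vmeas_wrt X ->
  meas_wrt G (fun w => g (X w)).
Proof.
move=> cg hX; apply: (@measurable_factor _ _ (g_sigma_algebraType G) 'I_d
  (fun k w => X w 0 k) hX) => w e e0.
have /cvgrPdist_lt/(_ e e0) := cg (X w).
rewrite near_nbhs => /nbhs_ballP[r /= r0 hr].
by exists r => // w' hw'; apply: hr; split => // i j; rewrite ord1; exact: hw'.
Qed.

End vector_measurability.

Lemma vmeas_wrt_map {R : realType} disp (T : measurableType disp) (G : set (set T)) (d n : nat)
  (X : T -> 'rV[R]_d) (g : 'rV[R]_d -> 'rV[R]_n) :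
  continuous g -> vmeas_wrt G X -> vmeas_wrt G (fun w => g (X w)).
Proof.
move=> cg hX k; apply: (meas_wrt_continuous (g := fun x => g x 0 k)) hX => x.
exact: (cvg_comp g (fun y : 'rV[R]_n => y 0 k) (cg x) (@coord_continuous _ _ _ _ _ _)).
Qed.

Lemma vmeas_wrt_sub {R : realType} disp (T : measurableType disp) (G G' : set (set T)) d
  (X : T -> 'rV[R]_d) : G `<=` G' -> vmeas_wrt G X -> vmeas_wrt G' X.
Proof. by move=> GG' hX k; exact (meas_wrt_sub GG' (hX k)). Qed.

Lemma vmeas_wrt_sigma_rV {R : realType} disp (T : measurableType disp) (G : set (set T)) d
  (X : T -> 'rV[R]_d) : sigma_rV X `<=` G -> vmeas_wrt G X.
Proof. by move=> hX k; exact: meas_wrt_entry. Qed.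

Lemma vmeas_wrt_mulmx {R : realType} disp (T : measurableType disp) (G : set (set T)) d n
  (X : T -> 'rV[R]_d) (A : 'M[R]_(d, n)) : vmeas_wrt G X -> vmeas_wrt G (fun w => X w *m A).
Proof.
move=> hX k; under eq_fun do rewrite mxE; apply: measurable_sum => j.
by apply: measurable_funM => //; exact: hX.
Qed.

Lemma mean0_dotp {R : realType} disp (T : measurableType disp) (P : probability T R) d
  (X Y : T -> 'rV[R]_d) : (forall k, mean0 P (fun w => X w 0 k * Y w 0 k)) ->
  mean0 P (fun w => dotp (X w) (Y w)).
Proof. by move=> h; apply: mean0_sum. Qed.

Section noise.
Context {R : realType} (d l : nat) (hl : (0 < l)%N) (sigma : 'M[R]_(d, l)).

Lemma noise_moment p : exists2 C : R, 0 <= C &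
  forall disp (Omega : measurableType disp) (P : probability Omega R)
    (F : R -> set (set Omega)) (W : nat -> R -> Omega -> 'rV[R]_l) (i : nat),
  complete_filtration P F -> brownian P F (W i) -> forall s t : R, 0 <= s -> s <= t ->
  mean_le P (fun w => frob (noise sigma W i s t w) ^+ (2 * p)) (C * (t - s) ^+ p).
Proof.
have [C C0 hC] := @increment_moment R l p hl.
exists (frob sigma ^+ (2 * p) * C) => [|disp Omega P F W i hF bW s t s0 st].
  by rewrite mulr_ge0 ?exprn_ge0 ?frob_ge0.
have t0 := le_trans s0 st.
have hincr : vmeas_wrt (F t) (fun w => W i t w - W i s w).
  by move=> k; exact (meas_wrt_increment hF bW k s0 st).
have mn : measurable_fun setT (fun w => frob (noise sigma W i s t w) ^+ (2 * p)).
  apply: measurable_funX.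
  exact (meas_wrt_filtration_meas hF t0 (meas_wrt_frob (vmeas_wrt_mulmx _ hincr))).
rewrite -mulrA; apply: mean_le_le mn _ _ (mean_leZ _ (hC _ _ _ _ _ hF bW s t s0 st)) => [w|w|].
- by rewrite exprn_ge0 ?frob_ge0.
- rewrite mulrC -exprMn lerXn2r ?nnegrE ?mulr_ge0 ?frob_ge0 //.
  by rewrite /noise; apply: le_trans (frob_mulmx _ _) _; rewrite frob_trmx.
- by rewrite exprn_ge0 ?frob_ge0.
Qed.

Context disp (Omega : measurableType disp) (P : probability Omega R)
  (F : R -> set (set Omega)) (W : nat -> R -> Omega -> 'rV[R]_l).
Hypotheses (hF : complete_filtration P F) (bW : forall i, brownian P F (W i)).

Lemma vmeas_wrt_noise i s t : 0 <= s -> s <= t -> vmeas_wrt (F t) (noise sigma W i s t).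
Proof.
move=> s0 st; apply: vmeas_wrt_mulmx => k; exact (meas_wrt_increment hF (bW i) k s0 st).
Qed.

Lemma noiseD i r s t w :
  noise sigma W i r s w + noise sigma W i s t w = noise sigma W i r t w.
Proof. by rewrite /noise -mulmxDl [W i s w - _ + _]addrC addrA subrK. Qed.

Lemma noise_refl i s w : noise sigma W i s s w = 0.
Proof. by rewrite /noise subrr mul0mx. Qed.

Lemma mean0_noise i s t k (phi : Omega -> R) a : 0 <= s -> s <= t ->
  meas_wrt (F s) phi -> mean_le P (fun w => `|phi w|) a ->
  mean0 P (fun w => phi w * noise sigma W i s t w 0 k).
Proof.
move=> s0 st mphi hphi.
have -> : (fun w => phi w * noise sigma W i s t w 0 k) =
    (fun w => \sum_c sigma k c * (phi w * (W i t w - W i s w) 0 c)).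
  apply/funext => w; rewrite !mxE mulr_sumr; apply: eq_bigr => c _.
  by rewrite !mxE; ring.
by apply: mean0_sum => c; apply: mean0Z; exact: mean0_increment hl hF (bW i) s0 st mphi hphi.
Qed.

End noise.

Section model.
Context {R : realType} (d l q : nat) (T : R) (f : 'rV[R]_d -> 'rV[R]_d)
  (sigma : 'M[R]_(d, l)) (m0 : R).

(** Collects what may vary once the constants are fixed; the initial law enters those constants
    through the number [m0] that bounds its moment of order [8 * q]. *)
Record particle_model disp (Omega : measurableType disp) (P : probability Omega R)
    (F : R -> set (set Omega)) (W : nat -> R -> Omega -> 'rV[R]_l)
    (X0 : nat -> Omega -> 'rV[R]_d) (N : nat) : Prop := ParticleModel {
  pm_F : complete_filtration P F ;
  pm_W : forall i, brownian P F (W i) ;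
  pm_X0 : forall i, sigma_rV (X0 i) `<=` F 0 ;
  pm_X0_moment : forall i, mean_le P (fun w => frob (X0 i w) ^+ (8 * q)) m0 ;
  pm_N : (0 < N)%N }.

End model.

(** * Moments of the particle system *)

Section pair_moment.
Context {R : realType} (d l q : nat) (hl : (0 < l)%N) (hq : (1 < q)%N)
  (sigma : 'M[R]_(d, l)) (m0 Lp : R) (Lp0 : 0 <= Lp).

(** Serves twice. For the exact solution, [h] is the width of a refining mesh, [A] the good events,
    and the summand [h] absorbs the defects of the two particles. For the scheme, [h] is its step
    and [A] the whole space. *)
Lemma pair_moment : exists2 C : R, 0 <= C &
  forall disp (Omega : measurableType disp) (P : probability Omega R)
    (F : R -> set (set Omega)) (W : nat -> R -> Omega -> 'rV[R]_l),
  complete_filtration P F -> (forall i, brownian P F (W i)) ->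
  forall (a b : nat) (h a0 : R) (n : nat) (tm : nat -> R) (A : nat -> set Omega)
    (D : nat -> Omega -> 'rV[R]_d),
  0 < h -> h <= 1 -> h * Lp <= 2^-1 ->
  (forall k, 0 <= tm k) -> (forall k, tm k.+1 = tm k + h) ->
  (forall k, (k <= n)%N -> F (tm k) (A k)) ->
  (forall k, (k < n)%N -> A k.+1 `<=` A k) ->
  (forall k, (k <= n)%N -> vmeas_wrt (F (tm k)) (D k)) ->
  (forall k w, (k < n)%N -> A k.+1 w ->
    (1 - h * Lp) * frob (D k.+1 w) <=
    frob (D k w + (noise sigma W a (tm k) (tm k.+1) w - noise sigma W b (tm k) (tm k.+1) w)) + h) ->
  mean_le P (fun w => \1_(A 0%N) w * frob (D 0%N w) ^+ (8 * q)) a0 ->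
  forall k, (k <= n)%N -> mean_le P (fun w => \1_(A k) w * frob (D k w) ^+ (8 * q))
    (expR (k%:R * h * C) * (a0 + k%:R * h * C)).
Proof.
have [p pE] : exists p, (8 * q = p.+2)%N.
  by exists ((8 * q).-2); rewrite !prednK //; case: q hq => // -[].
have [K K0 rec] := @moment_recursion R p Lp Lp0.
have [Cn Cn0 hn] := @noise_moment R d l hl sigma (4 * q).
(* The first summand bounds the normalised noise of two particles. The 1 makes [be >= 1], which
   covers the constant remainder [c = 1] and lets [K * be] replace [K] in the exponent. *)
pose be : R := 2 ^+ p.+2 * (Cn + Cn) + 1.
have be1 : 1 <= be by rewrite lerDr mulr_ge0 ?exprn_ge0 // addr_ge0.
have be0 : 0 <= be by exact: le_trans be1.
exists (K * be) => [|disp Omega P F W hF bW a b h a0 n tm A D h0 h1 hL tm0 tmS FA dA mD hD hD0 k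
    kn].
  by rewrite mulr_ge0.
have tmle k' : tm k' <= tm k'.+1 by rewrite tmS lerDl ltW.
pose xi k' w := noise sigma W a (tm k') (tm k'.+1) w - noise sigma W b (tm k') (tm k'.+1) w.
have mxi k' : vmeas_wrt (F (tm k'.+1)) (xi k') by apply: vswrtB; exact (vmeas_wrt_noise sigma hF
    bW _ (tm0 k') (tmle k')).
have sh0 : 0 < Num.sqrt h by rewrite sqrtr_gt0.
have sh2 : Num.sqrt h ^+ 2 = h by rewrite sqr_sqrtr // ltW.
have indic_meas k' : (k' <= n)%N -> meas_wrt (F (tm k')) (\1_(A k') : Omega -> R).
  by move=> k'n; apply: meas_wrt_indic; exact: FA.
have mal k' : (k' <= n)%N -> meas_wrt (F (tm k')) (fun w => frob (D k' w)).
  by move=> k'n; apply: meas_wrt_frob; exact: mD.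
rewrite pE in hD0 *.
have mono : expR (k%:R * (K * h)) * (a0 + k%:R * (K * h * be)) <=
    expR (k%:R * h * (K * be)) * (a0 + k%:R * h * (K * be)).
  have a00 : 0 <= a0.
    case: hD0 => _ h2 h3; rewrite -lee_fin; apply: le_trans h3.
    by apply: integral_ge0 => w _; rewrite lee_fin.
  have e : k%:R * h * (K * be) = k%:R * (K * h * be) by ring.
  rewrite e; apply: ler_wpM2r.
    by rewrite addr_ge0 // !mulr_ge0 // ltW.
  by rewrite ler_expR ler_wpM2l // ler_peMr // mulr_ge0 // ltW.
apply: mean_le_trans mono _.
apply: (rec _ _ P h be a0 n A (fun k w => frob (D k w)) (fun k w => frob (D k w + xi k w))
  (fun k w => dotp (D k w) (xi k w)) (fun k w => frob (xi k w) / Num.sqrt h) (fun _ _ => 1)) => //.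
- move=> k' k'n; exact: (filtration_measurable hF (tm0 k')) (FA k' k'n).
- move=> k' k'n; exact (meas_wrt_filtration_meas hF (tm0 k') (mal k' k'n)).
- by move=> k' w; exact: frob_ge0.
- by move=> k' w; exact: frob_ge0.
- by move=> k' w; rewrite divr_ge0 ?frob_ge0 // ltW.
- by move=> k' w; rewrite frobDsqr expr_div_n sh2 [h * _]mulrC divfK ?gt_eqF.
- move=> k' w; rewrite [leRHS]mulrC divfK ?gt_eqF //.
  have h1' := frobD (D k' w) (xi k' w).
  have := frobB (D k' w + xi k' w) (xi k' w); rewrite addrK => h2'.
  by rewrite ler_norml; apply/andP; split; lra.
- by move=> k' w k'n Aw; rewrite mulr1; exact: hD.
- move=> k' k'n.
  have mxi' : measurable_fun setT (fun w => frob (xi k' w)).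
    by exact (meas_wrt_filtration_meas hF (tm0 k'.+1) (meas_wrt_frob (mxi k'))).
  have hna := hn _ _ _ _ _ _ hF (bW a) _ _ (tm0 k') (tmle k').
  have hnb := hn _ _ _ _ _ _ hF (bW b) _ _ (tm0 k') (tmle k').
  have tmd : tm k'.+1 - tm k' = h by rewrite tmS addrC addKr.
  have h4 : (2 * (4 * q) = p.+2)%N by rewrite mulnA -pE.
  rewrite tmd h4 in hna hnb.
  have hs : (Num.sqrt h)^-1 ^+ p.+2 * h ^+ (4 * q) = 1.
    by rewrite -h4 exprVn exprM sh2 mulVf // expf_neq0 // gt_eqF.
  have := mean_leZ (exprn_ge0 p.+2 (_ : 0 <= (Num.sqrt h)^-1))
    (mean_leZ (exprn_ge0 p.+2 (ler0n R 2)) (mean_leD hna hnb)).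
  rewrite invr_ge0 (ltW sh0) => /(_ isT) hle.
  apply: (mean_le_trans (c := (Num.sqrt h)^-1 ^+ p.+2 *
     (2 ^+ p.+2 * (Cn * h ^+ (4 * q) + Cn * h ^+ (4 * q))))).
    rewrite -mulrDl [2 ^+ _ * _]mulrA mulrCA hs mulr1 /be lerDl //.
  apply: mean_le_le hle => [|w|w].
  + by apply: measurable_funX; apply: measurable_funM.
  + by rewrite exprn_ge0 // divr_ge0 ?frob_ge0 // ltW.
  + rewrite exprMn [leLHS]mulrC; apply: ler_wpM2l.
      by rewrite exprn_ge0 // invr_ge0 ltW.
    apply: le_trans (pow_add_le _ (frob_ge0 _) (frob_ge0 _)).
    by rewrite lerXn2r ?nnegrE ?addr_ge0 ?frob_ge0 // frobB.
- move=> k' k'n; rewrite -[be]mulr1; under eq_fun do rewrite expr1n.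
  by rewrite mulr1; apply: mean_le_trans be1 _; exact: mean_le_cst.
move=> k' c k'n hc; have k'n' := ltnW k'n.
have -> : (fun w => \1_(A k') w * (frob (D k' w) ^+ p * dotp (D k' w) (xi k' w))) =
   (fun w => dotp ((\1_(A k') w * frob (D k' w) ^+ p) *: D k' w) (xi k' w)).
  by apply/funext => w; rewrite dotpZl mulrA.
apply: mean0_dotp => j.
have mphi : meas_wrt (F (tm k')) (fun w => ((\1_(A k') w * frob (D k' w) ^+ p) *: D k' w) 0 j).
  under eq_fun do rewrite mxE.
  apply: measurable_funM; last exact: mD.
  apply: measurable_funM; first exact: indic_meas.
  by apply: measurable_funX; exact: mal.
(* The weight has degree [p.+1], one less than the moment at hand, which gives its integrability. *)
have hphi : mean_le P (fun w => `|((\1_(A k') w * frob (D k' w) ^+ p) *: D k' w) 0 j|) (1 + c).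
  apply: mean_le_le (mean_leD (mean_le_cst P ler01) hc) => [|//|w].
    by apply: measurableT_comp => //; exact (meas_wrt_filtration_meas hF (tm0 k') mphi).
  rewrite mxE !normrM [ `|\1_ _ _|]ger0_norm // ger0_norm ?exprn_ge0 ?frob_ge0 //.
  rewrite -mulrA; apply: (@le_trans _ _ (\1_(A k') w * frob (D k' w) ^+ p.+1)).
    rewrite exprSr; apply: ler_wpM2l => //; apply: ler_wpM2l; first by rewrite exprn_ge0 ?frob_ge0.
    exact: entry_le_frob.
  have := @pow_le_pow1 R p.+1 p.+2 (frob (D k' w)) (leqnSn _) (frob_ge0 _).
  by rewrite indicE; case: (w \in A k') => /=; rewrite ?mul1r ?mul0r ?addr0.
have -> : (fun w => ((\1_(A k') w * frob (D k' w) ^+ p) *: D k' w) 0 j * xi k' w 0 j) =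
  (fun w => ((\1_(A k') w * frob (D k' w) ^+ p) *: D k' w) 0 j * noise sigma W a (tm k') (tm
      k'.+1) w 0 j
    + -1 * (((\1_(A k') w * frob (D k' w) ^+ p) *: D k' w) 0 j * noise sigma W b (tm k') (tm
        k'.+1) w 0 j)).
  by apply/funext => w; rewrite [xi _ _ 0 j]mxE [(- noise _ _ _ _ _ _) 0 j]mxE; ring.
apply: mean0D; [|apply: mean0Z];
  exact: (mean0_noise hl sigma hF bW _ _ (tm0 k') (tmle k') mphi hphi).
Qed.

End pair_moment.

Lemma Rintegral_sum_ord {R : realType} disp (T : measurableType disp)
  (mu : {measure set T -> \bar R}) (D : set T) (I : Type) (r : seq I) (F : I -> T -> R) :
  measurable D -> (forall i, mu.-integrable D (EFin \o F i)) ->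
  mu.-integrable D (EFin \o (fun x => \sum_(i <- r) F i x)) /\
  \int[mu]_(x in D) (\sum_(i <- r) F i x) = \sum_(i <- r) \int[mu]_(x in D) F i x.
Proof.
move=> mD iF; elim: r => [|i r [ih1 ih2]].
  have e : (fun x : T => \sum_(i <- [::]) F i x) = cst 0.
    by apply/funext => x; rewrite big_nil.
  rewrite e big_nil; split; first exact: integrable0.
  by rewrite /Rintegral integral0.
have e : (fun x : T => \sum_(i <- i :: r) F i x) = (fun x => F i x + \sum_(i <- r) F i x).
  by apply/funext => x; rewrite big_cons.
rewrite e big_cons -ih2 -RintegralD //; split => //.
exact: (integrableD mD (iF i) ih1).
Qed.

(** * Paths of the interacting particle system *)

Section paths.
Context {R : realType} (d l q : nat) (T : R) (hT : 0 < T) (f : 'rV[R]_d -> 'rV[R]_d)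
  (sigma : 'M[R]_(d, l)) (Lf Lhf Lf1 Lf2 : R) (hf : granular_media q f Lf Lhf Lf1 Lf2)
  disp (Omega : measurableType disp) (P : probability Omega R)
  (F : R -> set (set Omega)) (W : nat -> R -> Omega -> 'rV[R]_l)
  (X0 : nat -> Omega -> 'rV[R]_d) (N : nat) (hN : (0 < N)%N)
  (X : 'I_N -> R -> Omega -> 'rV[R]_d).
Hypotheses (hF : complete_filtration P F) (bW : forall i, brownian P F (W i))
  (hX : ips_solution f sigma T X0 W P F X).
Local Notation mu := (@lebesgue_measure R).

Definition velocity (i : 'I_N) (t : R) (w : Omega) : 'rV[R]_d :=
  vfield f (fun j => X j t w) (X i t w).

(* The defect of one implicit Euler step of the exact solution. It involves no
   integral, hence is measurable for the filtration without any appeal to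
   joint measurability of [X]. *)
Definition defect (i : 'I_N) (s t : R) (w : Omega) : 'rV[R]_d :=
  X i t w - X i s w - noise sigma W i s t w - (t - s) *: velocity i t w.

(* Restricting to this event of the past controls all earlier defects; as the
   mesh is refined it occurs eventually, almost surely, by path continuity. *)
Definition good (tm : nat -> R) (e : R) (n : nat) : set Omega :=
  \bigcap_(k in `I_n) \bigcap_(i in [set: 'I_N])
    [set w | frob (defect i (tm k) (tm k.+1) w) <= e].

Lemma vmeas_wrt_X i (t : R) : 0 <= t <= T -> vmeas_wrt (F t) (X i t).
Proof. by move=> tT; apply: vmeas_wrt_sigma_rV; exact: ips_adapted hX i t tT. Qed.

Lemma vmeas_wrt_vfield G (Z : 'I_N -> Omega -> 'rV[R]_d) (z : Omega -> 'rV[R]_d) :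
  (forall j, vmeas_wrt G (Z j)) -> vmeas_wrt G z ->
  vmeas_wrt G (fun w => vfield f (fun j => Z j w) (z w)).
Proof.
move=> hZ hz; apply: vswrtZ; apply: vmeas_wrt_sum => j.
by apply: vmeas_wrt_map; [exact: f_continuous hf|exact: vswrtB].
Qed.

Lemma vmeas_wrt_velocity i (t : R) : 0 <= t <= T -> vmeas_wrt (F t) (velocity i t).
Proof. by move=> tT; apply: vmeas_wrt_vfield => [j|]; exact: vmeas_wrt_X. Qed.

Lemma vmeas_wrt_defect i (s t : R) : 0 <= s -> s <= t -> t <= T -> vmeas_wrt (F t) (defect i s t).
Proof.
move=> s0 st tT; have t0 := le_trans s0 st; have sT := le_trans st tT.
apply: vswrtB; last by apply: vswrtZ; apply: vmeas_wrt_velocity; rewrite t0.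
apply: vswrtB; last exact (vmeas_wrt_noise sigma hF bW i s0 st).
apply: vswrtB; first by apply: vmeas_wrt_X; rewrite t0.
by apply: vmeas_wrt_sub (filtration_mono hF s0 st) _; apply: vmeas_wrt_X; rewrite s0.
Qed.

Lemma good_measurable (tm : nat -> R) (e : R) n : (forall k, (k <= n)%N -> 0 <= tm k <= T) ->
  (forall k, (k < n)%N -> tm k <= tm k.+1) -> F (tm n) (good tm e n).
Proof.
move=> tm0 tmS; have /andP[tn0 tnT] := tm0 n (leqnn n).
have tmn k : (k <= n)%N -> tm k <= tm n.
  elim: n tmS {tm0 tn0 tnT} => [|n ih] tmS; first by rewrite leqn0 => /eqP ->.
  rewrite leq_eqVlt => /predU1P[->//|kn].
  apply: le_trans (tmS n (ltnSn n)); apply: ih => // j jn.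
  by apply: tmS; exact: ltnW.
apply: sub_sigma_measurable; first exact (filtration_algebra hF tn0).
apply: fin_bigcap_measurable => // k /= kn; apply: fin_bigcap_measurable => // i _.
apply: measurable_meas_wrt_le; apply: meas_wrt_frob.
have /andP[k0 kT] := tm0 k (ltnW kn); have /andP[k1 k1T] := tm0 k.+1 kn.
by apply: vmeas_wrt_sub (filtration_mono hF k1 (tmn _ kn)) _; apply: vmeas_wrt_defect => //;
    exact: tmS.
Qed.

Lemma good_sub tm e n : good tm e n.+1 `<=` good tm e n.
Proof. by move=> w h k /= kn; apply: h => /=; exact: ltnW. Qed.

Lemma ips_path : {ae P, forall w, forall i,
  {within `[0, T], continuous (fun t => X i t w)} /\
  forall t : R, 0 <= t <= T -> X i t w = X0 i w
    + rVintegral mu `[0, t] (fun s => velocity i s w) + noise sigma W i 0 t w}.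
Proof.
apply: filter_forall => i.
apply: filterS2 (ips_continuous hX i) (ips_equation hX i) => w cX eX; split => // t tT.
rewrite (eX t tT); congr (_ + _ + _); apply/rowP => k; rewrite !mxE.
by apply: eq_Rintegral => s _; rewrite (drift_empirical hf).
Qed.

Lemma velocity_within (w : Omega) (k : 'I_d) (i : 'I_N) :
  (forall i, {within `[0, T], continuous (fun t => X i t w)}) ->
  {within `[0, T], continuous (fun t => velocity i t w 0 k)}.
Proof. by move=> cX; apply: (within_continuous_vfield hf) => // j; exact: cX. Qed.

Lemma defect_small : {ae P, forall w, forall e : R, 0 < e -> exists2 r : R, 0 < r &
  forall i (s t : R), 0 <= s -> s <= t -> t <= T -> t - s < r ->
  frob (defect i s t w) <= e * (t - s)}.
Proof.
apply: filterS ips_path => w hw e e0.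
(* The tolerance is shared among the [d] coordinates; [d.+1] keeps the quotient positive when
   [d = 0]. *)
have e'0 : 0 < e / d.+1%:R by rewrite divr_gt0.
have key : \forall r \near 0^'+, forall i k (s t : R), 0 <= s -> s <= t -> t <= T ->
    t - s < r -> `|defect i s t w 0 k| <= e / d.+1%:R * (t - s).
  apply: filter_forall => i; apply: filter_forall => k.
  have [r r0 hr] := riemann_increment (ltW hT) (@velocity_within w k i (fun j => (hw j).1)) e'0.
  have : \forall r' \near 0^'+, r' < r by exact: nbhs_right_lt.
  apply: filterS => r' r'r s t s0 st tT tsr.
  have t0 := le_trans s0 st; have sT := le_trans st tT.
  apply: le_trans (hr s t s0 st tT (lt_trans tsr r'r)).
  rewrite /defect (hw i).2 ?t0 // (hw i).2 ?s0 //.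
  rewrite -(noiseD sigma W i 0 s t w) /rVintegral.
  have -> : (X0 i w + \row_k0 \int[mu]_(y in `[0, t]) velocity i y w 0 k0 +
     (noise sigma W i 0 s w + noise sigma W i s t w) -
     (X0 i w + \row_k0 \int[mu]_(y in `[0, s]) velocity i y w 0 k0 + noise sigma W i 0 s w) -
     noise sigma W i s t w - (t - s) *: velocity i t w) =
     \row_k0 \int[mu]_(y in `[0, t]) velocity i y w 0 k0 -
     \row_k0 \int[mu]_(y in `[0, s]) velocity i y w 0 k0 - (t - s) *: velocity i t w.
    by apply/rowP => k0; rewrite !mxE; ring.
  by rewrite !mxE.
have : \forall r \near 0^'+, 0 < r /\ forall i k (s t : R), 0 <= s -> s <= t -> t <= T ->
    t - s < r -> `|defect i s t w 0 k| <= e / d.+1%:R * (t - s).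
  by apply: filterS2 key (nbhs_right_gt 0) => r h1 h2.
move=> /(@filter_ex _ _ _) [r [r0 hr]]; exists r => // i s t s0 st tT tsr.
apply: le_trans (frob_le_sum _) _.
apply: (@le_trans _ _ (\sum_(k < d) e / d.+1%:R * (t - s))).
  by apply: ler_sum => k _; exact: hr.
rewrite sumr_const card_ord -[leLHS]mulr_natl mulrA ler_wpM2r ?subr_ge0 //.
rewrite mulrCA ler_piMr ?(ltW e0) // ler_pdivrMr // mul1r ler_nat //.
Qed.

Lemma good_eventually (h e : R) : 0 < h -> 0 < e ->
  {ae P, forall w, exists k1 : nat, forall k, (k1 <= k)%N -> forall n,
    n%:R * (h / k.+1%:R) <= T ->
    good (fun j => j%:R * (h / k.+1%:R)) (e * (h / k.+1%:R)) n w}.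
Proof.
move=> h0 e0; apply: filterS defect_small => w /(_ e e0)[r r0 hr].
(* From this index on, the mesh width [h / k.+1%:R] is below [r]. *)
exists (Num.truncn (h / r)) => k kk n nT j /= jn i _ /=.
have dk0 : 0 < h / k.+1%:R by rewrite divr_gt0.
have tE : j.+1%:R * (h / k.+1%:R) - j%:R * (h / k.+1%:R) = h / k.+1%:R.
  by rewrite -natr1 mulrDl mul1r addrC addKr.
rewrite -[in leRHS]tE; apply: hr.
- by rewrite mulr_ge0 // ltW.
- by rewrite -subr_ge0 tE ltW.
- by apply: le_trans nT; rewrite ler_wpM2r ?ler_nat // ltW.
rewrite tE ltr_pdivrMr // mulrC -ltr_pdivrMr //.
apply: lt_le_trans (truncnS_gt _) _; by rewrite ler_nat ltnS.
Qed.

Lemma mean_X : {ae P, forall w, forall t : R, 0 <= t <= T ->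
  \sum_i X i t w = \sum_(i < N) (X0 i w + noise sigma W i 0 t w)}.
Proof.
apply: filterS ips_path => w hw t tT.
transitivity (\sum_(i < N) (X0 i w + noise sigma W i 0 t w) +
   \sum_i rVintegral mu `[0, t] (fun s => velocity i s w)).
  rewrite -big_split; apply: eq_bigr => i _ /=; rewrite (hw i).2 //.
  by rewrite addrAC.
rewrite [X in _ + X](_ : _ = 0) ?addr0 //; apply/rowP => k; rewrite summxE mxE.
have /andP[t0 tT'] := tT.
have int i : mu.-integrable `[0, t] (EFin \o (fun s => velocity i s w 0 k)).
  apply: continuous_compact_integrable; first exact: segment_compact.
  apply: continuous_subspaceW (@velocity_within w k i (fun j => (hw j).1)).
  by apply: subset_itvl; rewrite bnd_simp.
have mt : measurable (`[0, t]%classic : set (measurableTypeR R)) by exact: measurable_itv.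
have [_] := Rintegral_sum_ord (index_enum 'I_N) mt int.
move=> e; transitivity (\sum_i \int[mu]_(s in `[0, t]) velocity i s w 0 k).
  by apply: eq_bigr => i _; rewrite mxE.
rewrite -e; transitivity (\int[mu]_(s in `[0, t]) (0 : R)); last first.
  by rewrite Rintegral_cst // mul0r.
apply: eq_Rintegral => s _.
by rewrite -summxE (sum_vfield hf) mxE.
Qed.

Lemma X_initial : {ae P, forall w, forall i, X i 0 w = X0 i w}.
Proof.
apply: filterS ips_path => w hw i; rewrite (hw i).2 ?lexx ?(ltW hT) //.
rewrite noise_refl addr0 [X in _ + X](_ : _ = 0) ?addr0 //.
by apply/rowP => k; rewrite !mxE set_itv1 Rintegral_set1.
Qed.

End paths.

(** Pairing [u - h *: g] with [u] and cancelling one factor [frob u] puts the one-sided condition on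
    the left, whatever the growth of [g]. This is where an implicit step gains over an explicit
    one. *)
Lemma implicit_step {R : realType} d (h L : R) (u g w : 'rV[R]_d) : 0 <= h ->
  dotp u g <= L * frob u ^+ 2 -> u - h *: g = w -> (1 - h * L) * frob u <= frob w.
Proof.
move=> h0 ug uw; have [u0|u0] := eqVneq (frob u) 0; first by rewrite u0 mulr0 frob_ge0.
have up : 0 < frob u by rewrite lt0r u0 frob_ge0.
rewrite -(ler_pM2l up); apply: le_trans (le_dotp_frob _ _).
rewrite -uw dotpBr dotpZr dotpp; have := ler_wpM2l h0 ug; lra.
Qed.

Lemma frob_le_mean {R : realType} d N (x : 'I_N -> 'rV[R]_d) (i : 'I_N) : (0 < N)%N ->
  frob (x i) <= avg (fun k => frob (x i - x k)) + N%:R^-1 * frob (\sum_k x k).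
Proof.
move=> N0; have N0' : N%:R != 0 :> R by rewrite pnatr_eq0 -lt0n.
have cN : \sum_(k < N) x i = N%:R *: x i by rewrite sumr_const card_ord scaler_nat.
rewrite {1}(_ : x i = N%:R^-1 *: (\sum_k (x i - x k)) + N%:R^-1 *: \sum_k x k); last first.
  by rewrite -scalerDr sumrB subrK cN scalerA mulVf // scale1r.
apply: le_trans (frobD _ _) _; rewrite !frobZ ger0_norm ?invr_ge0 //.
by apply: lerD => //; rewrite ler_wpM2l ?invr_ge0 // frob_sum.
Qed.

(** Pairing the drift of one particle with its own position has no sign, since [f] acts on
    differences. Each position is therefore split by [frob_le_mean] into pair differences and the
    mean, the mean being a sum of initial values and noises. [Z] stands for the solution at a time
    or for a stage of the scheme. *)
Lemma mean_split_moment {R : realType} (d l : nat) (hl : (0 < l)%N)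
  (sigma : 'M[R]_(d, l)) (q : nat) (m0 T : R) : 0 <= T -> exists2 C : R, 0 <= C &
  forall disp (Omega : measurableType disp) (P : probability Omega R)
    (F : R -> set (set Omega)) (W : nat -> R -> Omega -> 'rV[R]_l)
    (X0 : nat -> Omega -> 'rV[R]_d) (N : nat) (Z : 'I_N -> Omega -> 'rV[R]_d) (t Cp : R),
  particle_model q m0 P F W X0 N -> 0 <= t <= T -> 0 <= Cp ->
  (forall j, measurable_fun setT (fun w => frob (Z j w))) ->
  (forall i j, mean_le P (fun w => frob (Z i w - Z j w) ^+ (8 * q)) Cp) ->
  {ae P, forall w, \sum_i Z i w = \sum_(i < N) (X0 i w + noise sigma W i 0 t w)} ->
  forall i, mean_le P (fun w => frob (Z i w) ^+ (8 * q)) (C * (Cp + 1)).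
Proof.
move=> T0; have [Cn Cn0 hn] := @noise_moment R d l hl sigma (4 * q).
pose K : R := 2 ^+ (8 * q).
have K0 : 0 <= K by exact: exprn_ge0.
have Tq : 0 <= Cn * T ^+ (4 * q) by rewrite mulr_ge0 // exprn_ge0.
pose B := K * (`|m0| + Cn * T ^+ (4 * q)).
have B0 : 0 <= B by rewrite mulr_ge0 // addr_ge0.
exists (K * (1 + B)) => [|disp Omega P F W X0 N Z t Cp M tT Cp0 mZ hp mean i].
  by rewrite mulr_ge0 // addr_ge0.
have [hF bW X0F X0m hN] := M; have /andP[t0 tT'] := tT.
have n8 : (2 * (4 * q) = 8 * q)%N by rewrite mulnA.
have noise_m j : mean_le P (fun w => frob (noise sigma W j 0 t w) ^+ (8 * q)) (Cn * T ^+ (4 * q)).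
  have := hn _ _ _ _ _ _ hF (bW j) _ _ (lexx 0) t0; rewrite n8 subr0; apply: mean_le_trans.
  by rewrite ler_wpM2l // lerXn2r.
have X0m' j := mean_le_trans (ler_norm m0) (X0m j).
have mZ' : measurable_fun setT (fun w => frob (Z i w) ^+ (8 * q)) by exact: measurable_funX.
have tot := mean_leZ K0 (mean_leD (mean_le_avg hN (hp i))
  (mean_le_avg hN (fun k : 'I_N => mean_leZ K0 (mean_leD (X0m' k) (noise_m k))))).
apply: (mean_le_trans (c := K * (Cp + B))).
  by rewrite -mulrA; apply: ler_wpM2l => //; have := mulr_ge0 B0 Cp0; lra.
apply: mean_le_le_ae mZ' _ _ tot => [w|]; first by rewrite exprn_ge0 ?frob_ge0.
apply: filterS mean => w mE.
have a0 : 0 <= avg (fun k => frob (Z i w - Z k w)) by apply: avg_ge0 => k; exact: frob_ge0.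
have b0 (k : 'I_N) : 0 <= frob (X0 k w) + frob (noise sigma W k 0 t w).
  by rewrite addr_ge0 ?frob_ge0.
have := frob_le_mean (fun k => Z k w) i hN; rewrite mE => h1.
have h2 : frob (Z i w) <= avg (fun k => frob (Z i w - Z k w)) +
    avg (fun k : 'I_N => frob (X0 k w) + frob (noise sigma W k 0 t w)).
  apply: le_trans h1 _; rewrite lerD2l; apply: ler_wpM2l; first by rewrite invr_ge0.
  by apply: le_trans (frob_sum _ _) _; apply: ler_sum => k _; exact: frobD.
apply: (@le_trans _ _ ((avg (fun k => frob (Z i w - Z k w)) +
    avg (fun k : 'I_N => frob (X0 k w) + frob (noise sigma W k 0 t w))) ^+ (8 * q))).
  by rewrite lerXn2r ?nnegrE ?frob_ge0 // (addr_ge0 a0 (avg_ge0 b0)).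
apply: le_trans (pow_add_le _ a0 (avg_ge0 b0)) _; apply: ler_wpM2l => //.
apply: lerD; first by apply: avg_pow_le => // k; exact: frob_ge0.
apply: le_trans (avg_pow_le _ hN b0) _; apply: avg_le => k.
by apply: pow_add_le; exact: frob_ge0.
Qed.

Section X_moment.
Context {R : realType} (d l q : nat) (hl : (0 < l)%N) (T : R) (hT : 0 < T)
  (f : 'rV[R]_d -> 'rV[R]_d) (sigma : 'M[R]_(d, l)) (Lf Lhf Lf1 Lf2 : R)
  (hf : granular_media q f Lf Lhf Lf1 Lf2) (m0 : R).
Let Lp := Num.max 0 Lf.
Let Lp0 : 0 <= Lp. Proof. by rewrite le_max lexx. Qed.

Lemma X_pair_moment : exists2 C : R, 0 <= C &
  forall disp (Omega : measurableType disp) (P : probability Omega R)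
    (F : R -> set (set Omega)) (W : nat -> R -> Omega -> 'rV[R]_l)
    (X0 : nat -> Omega -> 'rV[R]_d) (N : nat) (X : 'I_N -> R -> Omega -> 'rV[R]_d),
  particle_model q m0 P F W X0 N -> ips_solution f sigma T X0 W P F X ->
  forall (a b : 'I_N) (t : R), 0 <= t <= T ->
  mean_le P (fun w => frob (X a t w - X b t w) ^+ (8 * q)) C.
Proof.
have [Cp Cp0 hp] := @pair_moment R d l q hl (gm_q hf) sigma Lp Lp0.
pose a0 : R := 2 ^+ (8 * q) * (`|m0| + `|m0|).
have a00 : 0 <= a0 by rewrite mulr_ge0 ?exprn_ge0 // addr_ge0.
exists (expR (T * Cp) * (a0 + T * Cp)) => [|disp Omega P F W X0 N X M hX a b t tT].
  by rewrite mulr_ge0 ?expR_ge0 // addr_ge0 // mulr_ge0 // ltW.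
have [hF bW X0F X0m hN] := M.
have mX s (i : 'I_N) : 0 <= s <= T -> vmeas_wrt (F s) (X i s) by move=> sT; exact (vmeas_wrt_X hX
    i sT).
have mXX s : 0 <= s <= T -> vmeas_wrt (F s) (fun w => X a s w - X b s w).
  by move=> sT; apply: vswrtB; exact: mX.
have mZ s : 0 <= s <= T -> measurable_fun setT (fun w => frob (X a s w - X b s w) ^+ (8 * q)).
  move=> sT; apply: measurable_funX; have /andP[s0 _] := sT.
  exact (meas_wrt_filtration_meas hF s0 (meas_wrt_frob (mXX s sT))).
have Z0 s w : 0 <= frob (X a s w - X b s w) ^+ (8 * q) by rewrite exprn_ge0 ?frob_ge0.
have T0 : 0 <= (0 : R) <= T by rewrite lexx ltW.
have init : mean_le P (fun w => frob (X a 0 w - X b 0 w) ^+ (8 * q)) a0.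
  have X0m' i := mean_le_trans (ler_norm m0) (X0m i).
  apply: mean_le_le_ae (mZ 0 T0) (Z0 0) _ (mean_leZ (exprn_ge0 _ (ler0n R 2)) (mean_leD (X0m' a)
      (X0m' b))).
  apply: filterS (X_initial hT hf hX) => w X0E; rewrite !X0E.
  apply: le_trans (pow_add_le _ (frob_ge0 _) (frob_ge0 _)).
  by rewrite lerXn2r ?nnegrE ?addr_ge0 ?frob_ge0 // frobB.
have /andP[t0 tT'] := tT.
(* At [t = 0] there is no mesh of positive width, and the initial bound applies directly. *)
move: t0; rewrite le_eqVlt => /predU1P[t0|t0].
  rewrite -t0; apply: mean_le_trans init; have TC0 : 0 <= T * Cp by rewrite mulr_ge0 // ltW.
  rewrite -[leLHS]mul1r; apply: ler_pM => //; first by rewrite -expR0 ler_expR.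
  by rewrite lerDl.
pose dk (k : nat) : R := t / k.+1%:R.
have dk0 k : 0 < dk k by rewrite divr_gt0.
pose tm k (j : nat) : R := j%:R * dk k.
have tmE k : tm k k.+1 = t by rewrite /tm /dk mulrC divfK // pnatr_eq0.
have tm0 k j : 0 <= tm k j by rewrite mulr_ge0 // ltW.
have tmS k j : tm k j.+1 = tm k j + dk k by rewrite /tm -natr1 mulrDl mul1r.
have tmT k j : (j <= k.+1)%N -> tm k j <= T.
  by move=> jk; apply: le_trans tT'; rewrite -(tmE k) ler_wpM2r ?ler_nat // ltW.
(* Half of the mesh width for each defect: a pair difference contains two of them, and [pair_moment]
   allows [h] in total. *)
pose A k := good f sigma W X (tm k) (2^-1 * dk k).
have FA k j : (j <= k.+1)%N -> F (tm k j) (A k j).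
  move=> jk; apply: (good_measurable hf hF bW hX) => i ij.
    by rewrite tm0 tmT // (leq_trans ij).
  by rewrite tmS lerDl ltW.
(* From [k0] on, [dk k * (1 + 2 * Lp) <= 1], which contains both step restrictions of
   [pair_moment]. *)
pose k0 := Num.truncn (t * (1 + 2 * Lp)).
apply: (mean_le_fatou (A := fun k => A k k.+1) (k0 := k0)).
- move=> k; exact: (filtration_measurable hF (tm0 k k.+1)) (FA k k.+1 (leqnn _)).
- exact: mZ.
- exact: Z0.
- have h2 : 0 < 2^-1 :> R by rewrite invr_gt0.
  apply: filterS (good_eventually hT hf hX t0 h2) => w [k1 hk1].
  by exists k1 => k kk; apply: hk1 => //; rewrite -/(dk k) -/(tm k k.+1) tmE.
move=> k kk.
have dkL : dk k * (1 + 2 * Lp) <= 1.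
  rewrite /dk mulrAC ler_pdivrMr // mul1r.
  by apply: ltW; apply: lt_le_trans (truncnS_gt _) _; rewrite ler_nat ltnS.
have dkL0 : 0 <= dk k * Lp by rewrite mulr_ge0 // ltW.
have tmk : k.+1%:R * dk k = t by exact: tmE.
have dkk := dk0 k.
have concl : mean_le P (fun w => \1_(A k k.+1) w *
    frob (X a (tm k k.+1) w - X b (tm k k.+1) w) ^+ (8 * q))
    (expR (k.+1%:R * dk k * Cp) * (a0 + k.+1%:R * dk k * Cp)).
  apply: (hp _ _ P F W hF bW a b (dk k) a0 k.+1 (tm k) (A k)
    (fun j w => X a (tm k j) w - X b (tm k j) w) (dk0 k) _ _ (tm0 k) (tmS k) (FA k) _ _ _ _
    k.+1 (leqnn _)).
  - by lra.
  - by lra.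
  - by move=> j _; exact: good_sub.
  - by move=> j jk; apply: mXX; rewrite tm0 tmT.
  - move=> j w jk Aw.
    have sd : tm k j.+1 - tm k j = dk k by rewrite tmS addrC addKr.
    have rhoa := Aw j (ltnSn j) a Logic.I; have rhob := Aw j (ltnSn j) b Logic.I.
    rewrite /= in rhoa rhob.
    set va := velocity f X a (tm k j.+1) w; set vb := velocity f X b (tm k j.+1) w.
    have vab := onesided_vfield hf (fun i => X i (tm k j.+1) w) (X a (tm k j.+1) w) (X b (tm k
        j.+1) w) hN.
    apply: le_trans (implicit_step (g := va - vb) (ltW (dk0 k)) vab (erefl _)) _.
    have -> : X a (tm k j.+1) w - X b (tm k j.+1) w - dk k *: (va - vb) =
      (X a (tm k j) w - X b (tm k j) w +
       (noise sigma W a (tm k j) (tm k j.+1) w - noise sigma W b (tm k j) (tm k j.+1) w))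
      + (defect f sigma W X a (tm k j) (tm k j.+1) w - defect f sigma W X b (tm k j) (tm k j.+1) w).
      by rewrite /defect sd -/va -/vb; apply/rowP => i; rewrite !mxE; ring.
    apply: le_trans (frobD _ _) _; rewrite lerD2l; apply: le_trans (frobB _ _) _.
    by lra.
  - apply: mean_le_le init => [|w|w].
    + apply: measurable_funM.
        by apply: measurable_indic; exact: (filtration_measurable hF (tm0 k 0%N)) (FA k 0%N _).
      by apply: mZ; rewrite tm0 tmT.
    + by rewrite mulr_ge0.
    + rewrite /tm mul0r indicE; case: (_ \in _); rewrite ?mul1r ?mul0r //.
rewrite tmE tmk in concl; apply: mean_le_trans concl.
apply: ler_pM; rewrite ?expR_ge0 ?addr_ge0 ?mulr_ge0 ?(ltW t0) //.
  by rewrite ler_expR ler_wpM2r.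
by rewrite lerD2l ler_wpM2r.
Qed.

Lemma X_moment : exists2 C : R, 0 <= C &
  forall disp (Omega : measurableType disp) (P : probability Omega R)
    (F : R -> set (set Omega)) (W : nat -> R -> Omega -> 'rV[R]_l)
    (X0 : nat -> Omega -> 'rV[R]_d) (N : nat) (X : 'I_N -> R -> Omega -> 'rV[R]_d),
  particle_model q m0 P F W X0 N -> ips_solution f sigma T X0 W P F X ->
  forall (i : 'I_N) (t : R), 0 <= t <= T ->
  mean_le P (fun w => frob (X i t w) ^+ (8 * q)) C.
Proof.
have [Cp Cp0 hp] := X_pair_moment.
have [C C0 hC] := mean_split_moment hl sigma q m0 (ltW hT).
exists (C * (Cp + 1)) => [|disp Omega P F W X0 N X M hX i t tT].
  by rewrite mulr_ge0 // addr_ge0.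
apply: (hC _ _ _ _ _ _ _ (fun j => X j t) t Cp M) => //.
- move=> j; have /andP[t0 _] := tT.
  exact (meas_wrt_filtration_meas (pm_F M) t0 (meas_wrt_frob (vmeas_wrt_X hX j tT))).
- by move=> i' j'; exact: (hp _ _ _ _ _ _ _ _ M hX i' j' t tT).
- by apply: filterS (mean_X hf hX) => w /(_ t tT).
Qed.

End X_moment.

(** * Moments of the scheme *)

Section system_norm.
Context {R : realType} (d N : nat) (hN : (0 < N)%N).
Implicit Types u w : 'I_N -> 'rV[R]_d.

(** The Euclidean norm of the whole system, normalised by the number of particles so that its bounds
    do not depend on [N]. *)
Definition snorm u : R := Num.sqrt (avg (fun i => frob (u i) ^+ 2)).

Lemma snorm_ge0 u : 0 <= snorm u. Proof. exact: sqrtr_ge0. Qed.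

Lemma snorm_sqr u : snorm u ^+ 2 = avg (fun i => frob (u i) ^+ 2).
Proof. by rewrite sqr_sqrtr // avg_ge0 // => i; exact: sqr_ge0. Qed.

Lemma avg_dotp_le u w : avg (fun i => dotp (u i) (w i)) <= snorm u * snorm w.
Proof.
apply: (@le_trans _ _ (avg (fun i => frob (u i) * frob (w i)))).
  by apply: avg_le => i; exact: le_dotp_frob.
have a0 : 0 <= avg (fun i => frob (u i) * frob (w i)).
  by apply: avg_ge0 => i; rewrite mulr_ge0 ?frob_ge0.
rewrite -(@ler_pXn2r _ 2) ?nnegrE //; last by rewrite mulr_ge0 ?snorm_ge0.
by rewrite [leRHS]exprMn !snorm_sqr; exact: avg_cauchy_schwarz.
Qed.

Lemma snormD_sqr u w : snorm (fun i => u i + w i) ^+ 2 =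
  snorm u ^+ 2 + 2 * avg (fun i => dotp (u i) (w i)) + snorm w ^+ 2.
Proof.
rewrite !snorm_sqr -avgZ -!avgD; congr avg; apply/funext => i.
exact: frobDsqr.
Qed.

Lemma snormD u w : snorm (fun i => u i + w i) <= snorm u + snorm w.
Proof.
rewrite -(@ler_pXn2r _ 2) ?nnegrE ?addr_ge0 ?snorm_ge0 // snormD_sqr sqrrD.
by have := avg_dotp_le u w; lra.
Qed.

Lemma snormB_le u w : `|snorm (fun i => u i + w i) - snorm u| <= snorm w.
Proof.
have h1 := snormD u w.
have := snormD (fun i => u i + w i) (fun i => - w i).
have -> : (fun i => u i + w i - w i) = u by apply/funext => i; rewrite addrK.
have -> : snorm (fun i => - w i) = snorm w.
  by rewrite /snorm; congr (Num.sqrt _); congr avg; apply/funext => i; rewrite frobN.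
by move=> h2; rewrite ler_norml; apply/andP; split; lra.
Qed.

(** The sharp factor is sqrt N. The crude one suffices, because the bound serves measurability and
    integrability and never enters a constant of an error estimate. *)
Lemma frob_le_snorm u i : frob (u i) <= N%:R * snorm u.
Proof.
have N1 : 1 <= N%:R :> R by rewrite ler1n.
rewrite -(@ler_pXn2r _ 2) ?nnegrE ?mulr_ge0 ?snorm_ge0 ?frob_ge0 // exprMn snorm_sqr.
have NN : N%:R * avg (fun i => frob (u i) ^+ 2) = \sum_i frob (u i) ^+ 2.
  by rewrite /avg mulrA mulfV ?mul1r // pnatr_eq0 -lt0n.
rewrite expr2 -mulrA NN; apply: (@le_trans _ _ (\sum_i frob (u i) ^+ 2)).
  by rewrite (bigD1 i) //= lerDl; apply: sumr_ge0 => j _; exact: sqr_ge0.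
by rewrite ler_peMl // sumr_ge0 // => j _; exact: sqr_ge0.
Qed.

Lemma snorm_le u c : 0 <= c -> (forall i, frob (u i) <= c) -> snorm u <= c.
Proof.
move=> c0 h; rewrite -(@ler_pXn2r _ 2) ?nnegrE ?snorm_ge0 // snorm_sqr.
rewrite -[leRHS](avg_cst _ hN); apply: avg_le => i.
by rewrite lerXn2r ?nnegrE ?frob_ge0.
Qed.

Context (q : nat) (f : 'rV[R]_d -> 'rV[R]_d) (Lf Lhf Lf1 Lf2 : R)
  (hf : granular_media q f Lf Lhf Lf1 Lf2).
Let Lp := Num.max 0 Lf.

(** The argument of [implicit_step] for the system as a whole. The particles of [x] and of [y] see
    different measures, so monotonicity is available through [onesided_system] after averaging. *)
Lemma implicit_system h (x y w : 'I_N -> 'rV[R]_d) : 0 <= h ->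
  (forall i, x i - y i - h *: (vfield f x (x i) - vfield f y (y i)) = w i) ->
  (1 - h * Lp) * snorm (fun i => x i - y i) <= snorm w.
Proof.
move=> h0 hw; set u := fun i => x i - y i.
have [u0|u0] := eqVneq (snorm u) 0; first by rewrite u0 mulr0 snorm_ge0.
have up : 0 < snorm u by rewrite lt0r u0 snorm_ge0.
rewrite -(ler_pM2l up); apply: le_trans (avg_dotp_le _ _).
have -> : avg (fun i => dotp (u i) (w i)) = snorm u ^+ 2 -
    h * avg (fun i => dotp (u i) (vfield f x (x i) - vfield f y (y i))).
  rewrite snorm_sqr -mulNr -avgZ -avgD; congr avg; apply/funext => i.
  have -> : w i = u i - h *: (vfield f x (x i) - vfield f y (y i)) by rewrite -hw.
  by rewrite [LHS]dotpBr dotpp [in LHS]dotpZr mulNr.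
have := ler_wpM2l h0 (onesided_system hf x y hN).
rewrite -/u -/Lp -snorm_sqr; lra.
Qed.

End system_norm.

Section scheme.
Context {R : realType} (d l q : nat) (hl : (0 < l)%N) (T : R) (hT : 0 < T)
  (f : 'rV[R]_d -> 'rV[R]_d) (sigma : 'M[R]_(d, l)) (Lf Lhf Lf1 Lf2 : R)
  (hf : granular_media q f Lf Lhf Lf1 Lf2) (m0 : R).
Let Lp := Num.max 0 Lf.
Let Lp0 : 0 <= Lp. Proof. by rewrite le_max lexx. Qed.

(** The member [4 * Num.max 0 Lf + 1] of the maximum [zeta] is the one that controls
    [step T M * Lp]. *)
Lemma step_small M : 0 < step T M < Num.min 1 (zeta Lf)^-1 ->
  [/\ 0 < step T M, step T M <= 1 & step T M * Lp <= 2^-1].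
Proof.
move=> /andP[h0]; rewrite lt_min => /andP[h1 hz]; split => //; first exact: ltW.
have z1 : 4 * Lp + 1 <= zeta Lf by rewrite /zeta !le_max lexx orbT.
have zp : 0 < zeta Lf by apply: lt_le_trans z1; rewrite ltr_wpDl // mulr_ge0.
have : step T M * zeta Lf < 1 by rewrite -ltr_pdivlMr // mul1r.
have := ler_wpM2l (ltW h0) z1; lra.
Qed.

Section realization.
Context disp (Omega : measurableType disp) (P : probability Omega R)
  (F : R -> set (set Omega)) (W : nat -> R -> Omega -> 'rV[R]_l)
  (X0 : nat -> Omega -> 'rV[R]_d) (N M : nat) (Y : nat -> 'I_N -> Omega -> 'rV[R]_d).
Hypotheses (PM : particle_model q m0 P F W X0 N)
  (hstep : 0 < step T M < Num.min 1 (zeta Lf)^-1)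
  (hY : ssm_implicit f sigma T X0 W M Y).
Local Notation h := (step T M).
Local Notation grid := (grid T M).

Lemma grid_ge0 n : 0 <= grid n.
Proof. by have [h0 _ _] := step_small hstep; rewrite mulr_ge0 // ltW. Qed.

Lemma gridS n : grid n.+1 = grid n + h.
Proof. by rewrite /Defs.grid -natr1 mulrDl mul1r. Qed.

Lemma grid_leS n : grid n <= grid n.+1.
Proof. by have [h0 _ _] := step_small hstep; rewrite gridS lerDl ltW. Qed.

Lemma M_gt0 : (0 < M)%N.
Proof.
have [] := step_small hstep; rewrite /step; case: M => // /[!invr0] /[!mulr0].
by rewrite ltxx.
Qed.

Lemma gridM : grid M = T.
Proof. by rewrite /Defs.grid /step mulrC divfK // pnatr_eq0 -lt0n M_gt0. Qed.

Lemma grid_le_T n : (n <= M)%N -> grid n <= T.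
Proof.
have [h0 _ _] := step_small hstep.
by move=> nM; rewrite -[leRHS]gridM /Defs.grid ler_wpM2r ?ler_nat // ltW.
Qed.

Lemma stage_equation n i w : (n < M)%N ->
  Y n i w - h *: vfield f (fun j => Y n j w) (Y n i w) = ssm sigma T X0 W M Y n i w.
Proof.
move=> nM; rewrite -(drift_empirical hf).
by rewrite {1}(hY nM i w) addrK.
Qed.

(** Stages are given outcome by outcome as solutions of an equation. If two outcomes have close
    values of [ssm], then [implicit_system], applied to the two stages, makes these close too;
    [measurable_factor] turns this continuity into measurability. *)
Lemma vmeas_wrt_stage_of_ssm G n i : (n < M)%N ->
  (forall j, vmeas_wrt G (ssm sigma T X0 W M Y n j)) -> vmeas_wrt G (Y n i).
Proof.
have hN := pm_N PM; have [h0 h1 hL] := step_small hstep.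
move=> nM mssm k; apply: (@measurable_factor _ _ (g_sigma_algebraType G) ('I_N * 'I_d)%type
  (fun jk w => ssm sigma T X0 W M Y n jk.1 w 0 jk.2)) => [jk|w e e0]; first exact: mssm.
have N0 : 0 < N%:R :> R by rewrite ltr0n.
have N4 : 0 < 4 * N%:R :> R by rewrite mulr_gt0.
have ed0 : 0 < e / (4 * N%:R) by rewrite divr_gt0.
exists (e / (4 * N%:R) / d.+1%:R) => [|w' hw']; first by rewrite divr_gt0.
pose u j := Y n j w - Y n j w'.
pose v j := ssm sigma T X0 W M Y n j w - ssm sigma T X0 W M Y n j w'.
have hv : snorm v <= e / (4 * N%:R).
  apply: snorm_le => // [|j]; first exact: ltW.
  apply: le_trans (frob_le_sum _) _.
  apply: (@le_trans _ _ (\sum_(c < d) e / (4 * N%:R) / d.+1%:R)).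
    by apply: ler_sum => c _; rewrite !mxE; apply: ltW; exact: (hw' (j, c)).
  rewrite sumr_const card_ord -[leLHS]mulr_natl mulrCA ler_piMr ?(ltW ed0) //.
  by rewrite ler_pdivrMr // mul1r ler_nat.
have hu : (1 - h * Lp) * snorm u <= snorm v.
  apply: (implicit_system hN hf (ltW h0)) => j; rewrite /v -!stage_equation //.
  by apply/rowP => c; rewrite !mxE; ring.
have hu2 : snorm u <= 2 * snorm v by have := snorm_ge0 u; nra.
have h3 := frob_le_snorm hN u i.
have := entry_le_frob (u i) 0 k; rewrite [u i 0 k]mxE [(- Y _ _ _) 0 k]mxE => h2.
apply: le_lt_trans h2 _; apply: le_lt_trans h3 _.
apply: (@le_lt_trans _ _ (N%:R * (2 * (e / (4 * N%:R))))).
  by rewrite ler_pM2l // (le_trans hu2) // ler_pM2l.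
have -> : N%:R * (2 * (e / (4 * N%:R))) = e / 2 by field; rewrite gt_eqF.
by rewrite ltr_pdivrMr // ltr_pMr // ltr1n.
Qed.

Lemma vmeas_wrt_stage n i : (n < M)%N -> vmeas_wrt (F (grid n)) (Y n i).
Proof.
have [hF bW X0F X0m hN] := PM.
elim: n i => [|n ih] i nM; apply: vmeas_wrt_stage_of_ssm => // j.
  rewrite /= /Defs.grid mul0r; exact (vmeas_wrt_sigma_rV (X0F j)).
apply: vswrtD; last exact (vmeas_wrt_noise sigma hF bW j (grid_ge0 n) (grid_leS n)).
exact (vmeas_wrt_sub (filtration_mono hF (grid_ge0 n) (grid_leS n)) (ih j (ltnW nM))).
Qed.

Lemma mean_stage n w : (n < M)%N ->
  \sum_i Y n i w = \sum_(i < N) (X0 i w + noise sigma W i 0 (grid n) w).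
Proof.
elim: n => [|n ih] nM.
  transitivity (\sum_(i < N) ssm sigma T X0 W M Y 0 i w).
    under [RHS]eq_bigr do rewrite -stage_equation //.
    by rewrite sumrB -scaler_sumr (sum_vfield hf) scaler0 subr0.
  by apply: eq_bigr => i _; rewrite /= /Defs.grid mul0r noise_refl addr0.
transitivity (\sum_(i < N) ssm sigma T X0 W M Y n.+1 i w).
  under [RHS]eq_bigr do rewrite -stage_equation //.
  by rewrite sumrB -scaler_sumr (sum_vfield hf) scaler0 subr0.
rewrite /= big_split /= (ih (ltnW nM)) -big_split; apply: eq_bigr => i _ /=.
by rewrite -addrA noiseD.
Qed.

End realization.

Lemma Y_pair_moment : exists2 C : R, 0 <= C &
  forall disp (Omega : measurableType disp) (P : probability Omega R)
    (F : R -> set (set Omega)) (W : nat -> R -> Omega -> 'rV[R]_l)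
    (X0 : nat -> Omega -> 'rV[R]_d) (N M : nat) (Y : nat -> 'I_N -> Omega -> 'rV[R]_d),
  particle_model q m0 P F W X0 N -> 0 < step T M < Num.min 1 (zeta Lf)^-1 ->
  ssm_implicit f sigma T X0 W M Y ->
  forall n (a b : 'I_N), (n < M)%N ->
  mean_le P (fun w => frob (Y n a w - Y n b w) ^+ (8 * q)) C.
Proof.
have [Cp Cp0 hp] := @pair_moment R d l q hl (gm_q hf) sigma Lp Lp0.
(* One power of 2 splits the difference of two initial values; the other passes from the initial
   values to the first stages, where [(1 - h * Lp)^-1 <= 2]. *)
pose a0 : R := 2 ^+ (8 * q) * (2 ^+ (8 * q) * (`|m0| + `|m0|)).
have a00 : 0 <= a0 by rewrite !mulr_ge0 ?exprn_ge0 // addr_ge0.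
exists (expR (T * Cp) * (a0 + T * Cp)) => [|disp Omega P F W X0 N M Y PM hst hY n a b nM].
  by rewrite mulr_ge0 ?expR_ge0 // addr_ge0 // mulr_ge0 // ltW.
have [hF bW X0F X0m hN] := PM; have [h0 h1 hL] := step_small hst.
have M0 := M_gt0 hst.
set h := step T M in h0 h1 hL.
have mD k : (k <= M.-1)%N -> vmeas_wrt (F (grid T M k)) (fun w => Y k a w - Y k b w).
  move=> kM; have kM' : (k < M)%N by rewrite -(prednK M0) ltnS.
  by apply: vswrtB; exact (vmeas_wrt_stage PM hst hY _ kM').
have mZ k : (k <= M.-1)%N -> measurable_fun setT (fun w => frob (Y k a w - Y k b w) ^+ (8 * q)).
  move=> kM; apply: measurable_funX.
  exact (meas_wrt_filtration_meas hF (grid_ge0 hst k) (meas_wrt_frob (mD k kM))).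
have step_le k w (D : 'rV[R]_d) : (k < M)%N ->
    ssm sigma T X0 W M Y k a w - ssm sigma T X0 W M Y k b w = D ->
    (1 - h * Lp) * frob (Y k a w - Y k b w) <= frob D.
  move=> kM DE; have vab := onesided_vfield hf (fun i => Y k i w) (Y k a w) (Y k b w) hN.
  apply: (implicit_step (ltW h0) vab); rewrite -DE -!(stage_equation hY) //.
  rewrite -/h; move: (vfield _ _ (Y k a w)) (vfield _ _ (Y k b w)) => va vb.
  by apply/rowP => i; rewrite !mxE; ring.
have init : mean_le P (fun w => frob (Y 0%N a w - Y 0%N b w) ^+ (8 * q)) a0.
  have X0m' i := mean_le_trans (ler_norm m0) (X0m i).
  have K0 : 0 <= 2 ^+ (8 * q) :> R by exact: exprn_ge0.
  apply: mean_le_le (mZ 0%N (leq0n _)) _ _ (mean_leZ K0 (mean_leZ K0 (mean_leD (X0m' a) (X0m'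
      b)))) => w.
    by rewrite exprn_ge0 ?frob_ge0.
  apply: (@le_trans _ _ ((2 * frob (X0 a w - X0 b w)) ^+ (8 * q))).
    rewrite lerXn2r ?nnegrE ?mulr_ge0 ?frob_ge0 //.
    have := step_le 0%N w _ M0 (erefl _).
    by have := frob_ge0 (Y 0%N a w - Y 0%N b w) => /=; nra.
  rewrite exprMn; apply: ler_wpM2l => //.
  apply: le_trans (pow_add_le _ (frob_ge0 _) (frob_ge0 _)).
  by rewrite lerXn2r ?nnegrE ?addr_ge0 ?frob_ge0 // frobB.
have nM' : (n <= M.-1)%N by rewrite -ltnS prednK.
have ev : mean_le P (fun w => \1_(setT : set Omega) w * frob (Y n a w - Y n b w) ^+ (8 * q))
    (expR (n%:R * h * Cp) * (a0 + n%:R * h * Cp)).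
  apply: (hp _ _ P F W hF bW a b h a0 M.-1 (grid T M) (fun _ => setT)
    (fun k w => Y k a w - Y k b w) h0 h1 hL (grid_ge0 hst) (gridS M) _ _ mD _ _ n nM') => //.
  - move=> k _; apply: sub_sigma_measurable; last exact: measurableT.
    exact (filtration_algebra hF (grid_ge0 hst k)).
  - move=> k w kM _; have kM' : (k.+1 < M)%N by rewrite -ltn_predRL.
    apply: le_trans (step_le k.+1 w _ kM' (erefl _)) _.
    rewrite -[leLHS]addr0; apply: lerD; last exact: ltW.
    rewrite le_eqVlt; apply/orP; left; apply/eqP; congr frob.
    by apply/rowP => i; rewrite /= !mxE; ring.
  - by under eq_fun do rewrite indicT mul1r.
have nhT : n%:R * h <= T by exact: (grid_le_T hst (ltnW nM)).
have nh0 : 0 <= n%:R * h by rewrite mulr_ge0 // ltW.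
have -> : (fun w => frob (Y n a w - Y n b w) ^+ (8 * q)) =
   (fun w => \1_(setT : set Omega) w * frob (Y n a w - Y n b w) ^+ (8 * q)).
  by apply/funext => w; rewrite indicT mul1r.
apply: mean_le_trans ev; apply: ler_pM.
- exact: expR_ge0.
- by rewrite addr_ge0 // mulr_ge0.
- by rewrite ler_expR ler_wpM2r.
- by rewrite lerD2l ler_wpM2r.
Qed.

Lemma Y_moment : exists2 C : R, 0 <= C &
  forall disp (Omega : measurableType disp) (P : probability Omega R)
    (F : R -> set (set Omega)) (W : nat -> R -> Omega -> 'rV[R]_l)
    (X0 : nat -> Omega -> 'rV[R]_d) (N M : nat) (Y : nat -> 'I_N -> Omega -> 'rV[R]_d),
  particle_model q m0 P F W X0 N -> 0 < step T M < Num.min 1 (zeta Lf)^-1 ->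
  ssm_implicit f sigma T X0 W M Y ->
  forall n (i : 'I_N), (n < M)%N -> mean_le P (fun w => frob (Y n i w) ^+ (8 * q)) C.
Proof.
have [Cp Cp0 hp] := Y_pair_moment.
have [C C0 hC] := mean_split_moment hl sigma q m0 (ltW hT).
exists (C * (Cp + 1)) => [|disp Omega P F W X0 N M Y PM hst hY n i nM].
  by rewrite mulr_ge0 // addr_ge0.
apply: (hC _ _ _ _ _ _ _ (fun j => Y n j) (grid T M n) Cp PM) => //.
- by rewrite (grid_ge0 hst) (grid_le_T hst (ltnW nM)).
- move=> j; apply: (meas_wrt_filtration_meas (pm_F PM) (grid_ge0 hst n)).
  exact (meas_wrt_frob (vmeas_wrt_stage PM hst hY _ nM)).
- by move=> i' j'; exact: (hp _ _ _ _ _ _ _ _ _ PM hst hY n i' j' nM).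
- by apply: aeW => w; exact: mean_stage nM.
Qed.

End scheme.

(** * Local error of implicit Euler steps *)

Section local_error.
Context {R : realType} (d q : nat) (f : 'rV[R]_d -> 'rV[R]_d) (Lf Lhf Lf1 Lf2 : R)
  (hf : granular_media q f Lf Lhf Lf1 Lf2) (N kap : nat) (hN : (0 < N)%N) (hkap : (0 < kap)%N)
  (h : R) (h0 : 0 < h) (h1 : h <= 1) (x xi r : nat -> 'I_N -> 'rV[R]_d).
Let v j i := vfield f (x j) (x j i).
Hypotheses (xS : forall j i, (j < kap)%N ->
    x j.+1 i = x j i + (xi j i - xi j.+1 i) + (h / kap%:R) *: v j.+1 i + r j i)
  (xi_end : forall i, xi kap i = 0)
  (r_le : forall j i, (j < kap)%N -> frob (r j i) <= h * (h / kap%:R)).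
Let z j i l := x j i - x j l.
Let S j i l := xi j i - xi j l.

(** Dominates the pair differences at the start, at the fine time [j] and at the end of the block.
    Dividing the noise by [Num.sqrt h] keeps the moments bounded as h decreases. *)
Definition spread_point (j : nat) (i l : 'I_N) : R :=
  1 + (frob (x 0%N i) + frob (x 0%N l) + (frob (x j i) + frob (x j l))
       + (frob (x kap i) + frob (x kap l)))
  + (frob (xi 0%N i) + frob (xi 0%N l) + (frob (xi j i) + frob (xi j l))) / Num.sqrt h.

Definition spread_drift (j : nat) (i l l' : 'I_N) : R :=
  1 + (frob (x j i) + frob (x j l) + frob (x j l')).

(** Bounds 1/h times the contribution of drift and defects to a pair difference from any fine time
    to the end of the block; the 2 pays for the defects of the two particles. *)
Definition drift_bound (i l : 'I_N) : R :=
  2 + 6 * Lhf * avg (fun j : 'I_kap => avg (fun l' => spread_drift j.+1 i l l' ^+ q.+1)).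

(* The only part of the local error of order [h ^ (3/2)] rather than [h ^ 2]; it
   is linear in the noise of the block, with coefficients fixed at its start,
   so it has conditional mean zero. *)
Definition martingale_part (i : 'I_N) : 'rV[R]_d :=
  - (h *: (kap%:R^-1 *: \sum_(j < kap) (N%:R^-1 *: \sum_l
      ((xi j.+1 i - xi j.+1 l) *m 'J f (x 0%N i - x 0%N l))))).

(** One bound for both [local_error] and [martingale_part_le]. Of the leading factor,
    [3 * Lhf + 6 * Lf2] comes from [pair_error], [2 * Lf1] from the martingale part and 1 from the
    defects. *)
Definition local_bound (i : 'I_N) : R :=
  (3 * Lhf + 6 * Lf2 + 2 * Lf1 + 1) *
  (1 + avg (fun j : 'I_kap => avg (fun l =>
      spread_point j.+1 i l ^+ q * (drift_bound i l + spread_point j.+1 i l)))).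

Let sh0 : 0 < Num.sqrt h. Proof. by rewrite sqrtr_gt0. Qed.
Let sh1 : Num.sqrt h <= 1. Proof. by rewrite -sqrtr1 ler_wsqrtr. Qed.
Let shh : Num.sqrt h * Num.sqrt h = h. Proof. by rewrite -expr2 sqr_sqrtr // ltW. Qed.
Let Lhf0 : 0 <= Lhf := ltW (gm_Lhf hf).
Let Lf10 : 0 <= Lf1 := ltW (gm_Lf1 hf).
Let Lf20 : 0 <= Lf2 := ltW (gm_Lf2 hf).

Lemma spread_drift_ge1 j i l l' : 1 <= spread_drift j i l l'.
Proof. by rewrite lerDl !addr_ge0 ?frob_ge0. Qed.

Lemma spread_point_ge1 j i l : 1 <= spread_point j i l.
Proof.
by rewrite /spread_point -addrA lerDl addr_ge0 ?divr_ge0 ?addr_ge0 ?frob_ge0.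
Qed.

Lemma drift_bound_ge0 i l : 0 <= drift_bound i l.
Proof.
apply: addr_ge0 => //; apply: mulr_ge0; first by rewrite mulr_ge0.
apply: avg_ge0 => j; apply: avg_ge0 => l'.
by rewrite exprn_ge0 // (le_trans ler01) // spread_drift_ge1.
Qed.

Let incr j i : 'rV[R]_d := \sum_(j <= m < kap) ((h / kap%:R) *: v m.+1 i + r m i).

(** [xi j] is the noise still to come in the block, hence [xi_end]. Positions are compared with the
    end of the block because the implicit step evaluates the drift there. *)
Lemma telescope j i : (j <= kap)%N -> x kap i = x j i + xi j i + incr j i.
Proof.
move=> jk; suff H m : (j <= m)%N -> (m <= kap)%N -> x m i = x j i + (xi j i - xi m i) +
    \sum_(j <= m' < m) ((h / kap%:R) *: v m'.+1 i + r m' i).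
  by rewrite (H kap jk (leqnn _)) xi_end subr0.
elim: m => [|m ih] jm mk.
  by move: jm; rewrite leqn0 => /eqP ->; rewrite big_geq // subrr !addr0.
move: jm; rewrite leq_eqVlt => /predU1P[<-|jm].
  by rewrite big_geq // subrr !addr0.
rewrite big_nat_recr //= xS // (ih jm (ltnW mk)).
by apply/rowP => c; rewrite !mxE; ring.
Qed.

Lemma velocity_le m i l : frob (v m i) <= 3 * Lhf * avg (fun l' => spread_drift m i l l' ^+ q.+1).
Proof.
apply: le_trans (frob_vfield_le _ _ _) _; rewrite -avgZ; apply: avg_le => l'.
apply: (f_growth hf (spread_drift_ge1 m i l l')).
apply: le_trans (frobB _ _) _; rewrite /spread_drift.
by have := frob_ge0 (x m l); lra.
Qed.

Lemma spread_driftC m i l l' : spread_drift m i l l' = spread_drift m l i l'.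
Proof. by rewrite /spread_drift (addrC (frob (x m i))). Qed.

Lemma incr_le j i l : (j <= kap)%N -> frob (incr j i - incr j l) <= h * drift_bound i l.
Proof.
move=> jk; have k0 : 0 < kap%:R :> R by rewrite ltr0n.
have hk0 : 0 < h / kap%:R by rewrite divr_gt0.
have one a : frob (incr j a) <= h * avg (fun m : 'I_kap => frob (v m.+1 a)) + h * h.
  apply: le_trans (frob_sum _ _) _.
  apply: (@le_trans _ _ (\sum_(0 <= m < kap) (h / kap%:R * frob (v m.+1 a) + h * (h / kap%:R)))).
    rewrite [leRHS](big_cat_nat (leq0n j) jk) /= -[leLHS]add0r; apply: lerD.
      by apply: sumr_ge0 => m _; rewrite addr_ge0 ?mulr_ge0 ?frob_ge0 ?(ltW h0) ?invr_ge0 ?ler0n.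
    rewrite !big_nat; apply: ler_sum => m /andP[_ mk].
    apply: le_trans (frobD _ _) _; rewrite frobZ gtr0_norm //.
    by rewrite lerD2l; exact: r_le.
  rewrite big_mkord big_split /= -mulr_sumr sumr_const card_ord -[_ * (h / _) *+ kap]mulr_natl.
  have -> : kap%:R * (h * (h / kap%:R)) = h * h by field; rewrite gt_eqF.
  rewrite /avg; set s := \sum_(_ < _) _.
  by rewrite [h * (_ * s)]mulrA.
apply: le_trans (frobB _ _) _; apply: le_trans (lerD (one i) (one l)) _.
have vi : avg (fun m : 'I_kap => frob (v m.+1 i)) <=
    3 * Lhf * avg (fun j : 'I_kap => avg (fun l' => spread_drift j.+1 i l l' ^+ q.+1)).
  by rewrite -avgZ; apply: avg_le => m; exact: velocity_le.
have vl : avg (fun m : 'I_kap => frob (v m.+1 l)) <=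
    3 * Lhf * avg (fun j : 'I_kap => avg (fun l' => spread_drift j.+1 i l l' ^+ q.+1)).
  rewrite -avgZ; apply: avg_le => m; apply: le_trans (velocity_le _ _ i) _.
  by under eq_fun do rewrite spread_driftC.
have := ler_wpM2l (ltW h0) vi; have := ler_wpM2l (ltW h0) vl.
have := ler_wpM2l (ltW h0) h1; rewrite /drift_bound.
by set A := avg _; lra.
Qed.

Lemma spread_noise_le j i l : (j <= kap)%N ->
  frob (S j i l) <= Num.sqrt h * (spread_point j i l) /\
  frob (S 0 i l) <= Num.sqrt h * (spread_point j i l).
Proof.
move=> jk; have h2 := frobB (xi j i) (xi j l); have h3 := frobB (xi 0%N i) (xi 0%N l).
have e : Num.sqrt h * spread_point j i l = Num.sqrt h *
   (1 + (frob (x 0%N i) + frob (x 0%N l) + (frob (x j i) + frob (x j l))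
       + (frob (x kap i) + frob (x kap l)))) +
   (frob (xi 0%N i) + frob (xi 0%N l) + (frob (xi j i) + frob (xi j l))).
  rewrite /spread_point mulrDr [X in _ + X](_ : _ = (frob (xi 0%N i) + frob (xi 0%N l) +
    (frob (xi j i) + frob (xi j l)))) //.
  by rewrite mulrC divfK // gt_eqF.
have e0 : 0 <= Num.sqrt h *
   (1 + (frob (x 0%N i) + frob (x 0%N l) + (frob (x j i) + frob (x j l))
       + (frob (x kap i) + frob (x kap l)))).
  by rewrite mulr_ge0 ?(ltW sh0) // !addr_ge0 ?frob_ge0.
have := frob_ge0 (xi j i); have := frob_ge0 (xi j l).
have := frob_ge0 (xi 0%N i); have := frob_ge0 (xi 0%N l).
rewrite e /S; split; lra.
Qed.

(** Up to O(h), [z j] is [z kap - S j]. The expansion is centred at [z kap], the argument in the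
    implicit step, with the Jacobian frozen at [z 0]. Both [S j] and the distance from [z 0] to
    [z kap] are of order sqrt h, so the Taylor remainder is again O(h). *)
Lemma pair_error j i l : (j <= kap)%N ->
  frob (f (z j i l) - f (z kap i l) + S j i l *m 'J f (z 0 i l)) <=
  h * ((3 * Lhf + 6 * Lf2) *
    (spread_point j i l ^+ q * (drift_bound i l + spread_point j i l))).
Proof.
move=> jk; set U := spread_point j i l; set I := drift_bound i l.
have U1 : 1 <= U by exact: spread_point_ge1.
have U0 : 0 <= U by exact: le_trans U1.
have I0 : 0 <= I by exact: drift_bound_ge0.
have [Sj S0] := spread_noise_le i l jk; rewrite -/U in Sj S0.
set Ij := incr j i - incr j l; set I0' := incr 0 i - incr 0 l.
have Ij_le : frob Ij <= h * I by exact: incr_le.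
have I0_le : frob I0' <= h * I by exact: incr_le.
have zj : z kap i l = z j i l + S j i l + Ij.
  by rewrite /z !(@telescope j) // /S /Ij; apply/rowP => c; rewrite !mxE; ring.
have z0 : z kap i l = z 0 i l + S 0 i l + I0'.
  by rewrite /z !(@telescope 0) // /S /I0'; apply/rowP => c; rewrite !mxE; ring.
have Upart : frob (z 0 i l) <= U /\ frob (z j i l) <= U /\
    frob (z kap i l) + frob (S j i l) <= U.
  have a0 := frobB (x 0%N i) (x 0%N l); have aj := frobB (x j i) (x j l).
  have ak := frobB (x kap i) (x kap l); have b := frobB (xi j i) (xi j l).
  have q1 a : 0 <= a -> a <= a / Num.sqrt h.
    by move=> a0'; rewrite ler_pdivlMr // ler_piMr.
  have c := q1 _ (addr_ge0 (addr_ge0 (frob_ge0 (xi 0%N i)) (frob_ge0 (xi 0%N l)))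
     (addr_ge0 (frob_ge0 (xi j i)) (frob_ge0 (xi j l)))).
  have := frob_ge0 (xi j i); have := frob_ge0 (xi j l).
  have := frob_ge0 (xi 0%N i); have := frob_ge0 (xi 0%N l).
  have := frob_ge0 (x j i); have := frob_ge0 (x j l).
  have := frob_ge0 (x 0%N i); have := frob_ge0 (x 0%N l).
  have := frob_ge0 (x kap i); have := frob_ge0 (x kap l).
  rewrite /U /spread_point /z /S; move: c b ak aj a0.
  by split; [|split]; lra.
case: Upart => z0U [zjU zkU].
have -> : f (z j i l) - f (z kap i l) + S j i l *m 'J f (z 0 i l) =
    (f (z j i l) - f (z kap i l - S j i l)) +
    (f (z kap i l - S j i l) - f (z kap i l) + S j i l *m 'J f (z 0 i l)).
  by rewrite addrA addrA subrK.
apply: le_trans (frobD _ _) _.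
have t1 : frob (f (z j i l) - f (z kap i l - S j i l)) <= 3 * Lhf * U ^+ q * (h * I).
  apply: le_trans (lip_growth hf U1 zjU _) _; first exact: le_trans (frobB _ _) zkU.
  apply: ler_wpM2l; first by rewrite !mulr_ge0 ?exprn_ge0.
  rewrite [X in frob X](_ : _ = - Ij) ?frobN //.
  by rewrite zj; apply/rowP => c; rewrite !mxE; ring.
have t2 : frob (f (z kap i l - S j i l) - f (z kap i l) + S j i l *m 'J f (z 0 i l)) <=
    3 * Lf2 * U ^+ q.-1 * (h * ((I + U + U) * U)).
  apply: le_trans (f_taylor hf U1 z0U zkU) _; rewrite -mulrA; apply: ler_wpM2l.
    by rewrite !mulr_ge0 ?exprn_ge0.
  have zz : frob (z kap i l - z 0 i l) <= Num.sqrt h * U + h * I.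
    rewrite z0 [X in frob X](_ : _ = S 0 i l + I0'); last first.
      by apply/rowP => c; rewrite !mxE; ring.
    by apply: le_trans (frobD _ _) _; exact: lerD.
  apply: (@le_trans _ _ ((Num.sqrt h * (I + U + U)) * (Num.sqrt h * U))).
    apply: ler_pM; rewrite ?addr_ge0 ?frob_ge0 //.
    have hsh : h <= Num.sqrt h by rewrite -[leLHS]shh ler_piMr // ltW.
    have : h * I <= Num.sqrt h * I by rewrite ler_wpM2r.
    by move: zz Sj; lra.
  by rewrite mulrACA shh.
have qS : q = q.-1.+1 by rewrite prednK // ltnW // (gm_q hf).
have UqS : U ^+ q = U ^+ q.-1 * U by rewrite {1}qS exprSr.
have Uq0 : 0 <= U ^+ q by exact: exprn_ge0.
have e2 : 3 * Lf2 * U ^+ q.-1 * (h * ((I + U + U) * U)) = 3 * Lf2 * h * (U ^+ q * (I + U + U)).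
  by rewrite UqS; ring.
rewrite e2 in t2; apply: le_trans (lerD t1 t2) _.
have UI : 0 <= h * (U ^+ q * I) by rewrite !mulr_ge0 // ltW.
have UU : 0 <= h * (U ^+ q * U) by rewrite !mulr_ge0 // ltW.
have := mulr_ge0 Lf20 UI; have := mulr_ge0 Lhf0 UU; lra.
Qed.

Let fine_sum (G : nat -> 'rV[R]_d) : \sum_(j < kap) (h / kap%:R) *: G j =
  h *: (kap%:R^-1 *: \sum_(j < kap) G j).
Proof. by rewrite scalerA -scaler_sumr. Qed.

(** Summing [pair_error] over the fine steps contributes one more factor h, and the defects add up
    to at most h^2 by [r_le]. *)
Lemma local_error i :
  frob (x kap i - x 0%N i - xi 0%N i - h *: v kap i - martingale_part i) <=
  h ^+ 2 * local_bound i.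
Proof.
have k0 : 0 < kap%:R :> R by rewrite ltr0n.
have hk0 : 0 < h / kap%:R by rewrite divr_gt0.
have kapE (a : 'rV[R]_d) : h *: a = \sum_(j < kap) (h / kap%:R) *: a.
  rewrite sumr_const card_ord -scaler_nat scalerA; congr (_ *: _).
  by rewrite mulrC divfK // gt_eqF.
have -> : x kap i - x 0%N i - xi 0%N i - h *: v kap i - martingale_part i =
    \sum_(j < kap) ((h / kap%:R) *: (N%:R^-1 *: \sum_l
       (f (z j.+1 i l) - f (z kap i l) + S j.+1 i l *m 'J f (z 0 i l))) + r j i).
  pose m j := N%:R^-1 *: \sum_l ((xi j.+1 i - xi j.+1 l) *m 'J f (x 0%N i - x 0%N l)).
  have inner j : N%:R^-1 *: \sum_l (f (z j.+1 i l) - f (z kap i l) + S j.+1 i l *m 'J f (z 0 i l))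
      = v j.+1 i - v kap i + m j.
    by rewrite big_split sumrB scalerDr scalerBr.
  have -> : \sum_(j < kap) ((h / kap%:R) *: (N%:R^-1 *: \sum_l
       (f (z j.+1 i l) - f (z kap i l) + S j.+1 i l *m 'J f (z 0 i l))) + r j i) =
     \sum_(j < kap) ((h / kap%:R) *: v j.+1 i + r j i) - h *: v kap i +
     h *: (kap%:R^-1 *: \sum_(j < kap) m j).
    rewrite kapE -(fine_sum m) -sumrB -big_split; apply: eq_bigr => j _; rewrite inner.
    move: (v j.+1 i) (v kap i) (m j) (r j i) (h / kap%:R) => a b c e s.
    by apply/rowP => k; rewrite /= !mxE; ring.
  rewrite (telescope i (leq0n _)) /incr big_mkord.
  have -> : martingale_part i = - (h *: (kap%:R^-1 *: \sum_(j < kap) m j)) by [].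
  move: (\sum_(j < kap) _) (h *: v kap i) (h *: _) => a b c.
  by apply/rowP => k; rewrite !mxE; ring.
apply: le_trans (frob_sum _ _) _.
have B0 j l : 0 <= spread_point j i l ^+ q * (drift_bound i l + spread_point j i l).
  have U0 : 0 <= spread_point j i l by apply: le_trans (spread_point_ge1 j i l).
  by rewrite mulr_ge0 ?exprn_ge0 // addr_ge0 // drift_bound_ge0.
pose A j := avg (fun l => spread_point j i l ^+ q * (drift_bound i l + spread_point j i l)).
apply: (@le_trans _ _ (\sum_(j < kap) (h / kap%:R * (h * ((3 * Lhf + 6 * Lf2) * A j.+1)) +
    h * (h / kap%:R)))).
  apply: ler_sum => j _; apply: le_trans (frobD _ _) _; apply: lerD; last exact: r_le.
  rewrite frobZ gtr0_norm //; apply: ler_wpM2l; first exact: ltW.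
  rewrite frobZ ger0_norm ?invr_ge0 // /A -avgZ -avgZ.
  apply: ler_wpM2l; first by rewrite invr_ge0.
  by apply: le_trans (frob_sum _ _) _; apply: ler_sum => l _; exact: pair_error.
have -> : \sum_(j < kap) (h / kap%:R * (h * ((3 * Lhf + 6 * Lf2) * A j.+1)) + h * (h / kap%:R)) =
    h * (h / kap%:R) * ((3 * Lhf + 6 * Lf2) * (\sum_(j < kap) A j.+1) + kap%:R).
  transitivity (\sum_(j < kap) h * (h / kap%:R) * ((3 * Lhf + 6 * Lf2) * A j.+1 + 1)).
    by apply: eq_bigr => j _; ring.
  by rewrite -mulr_sumr; congr (_ * _); rewrite big_split /= -mulr_sumr sumr_const card_ord.
have -> : h * (h / kap%:R) * ((3 * Lhf + 6 * Lf2) * (\sum_(j < kap) A j.+1) + kap%:R) =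
    h * h * ((3 * Lhf + 6 * Lf2) * avg (fun j : 'I_kap => A j.+1) + 1).
  by rewrite /avg; field; rewrite gt_eqF.
have Aav0 : 0 <= avg (fun j : 'I_kap => A j.+1).
  by apply: avg_ge0 => j; apply: avg_ge0 => l; exact: B0.
rewrite /local_bound expr2.
have hh : 0 <= h * h by rewrite mulr_ge0 // ltW.
apply: ler_wpM2l => //.
rewrite -[avg (fun j : 'I_kap => avg _)]/(avg (fun j : 'I_kap => A j.+1)).
move: (avg (fun j : 'I_kap => A j.+1)) Aav0 => a Aav0.
have := mulr_ge0 Lf10 Aav0; have := mulr_ge0 Lhf0 Aav0; have := mulr_ge0 Lf20 Aav0.
by have := Lhf0; have := Lf10; have := Lf20; lra.
Qed.

Lemma martingale_part_le i : frob (martingale_part i) <= h * Num.sqrt h * local_bound i.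
Proof.
have B0 j l : 0 <= spread_point j i l ^+ q * (drift_bound i l + spread_point j i l).
  have U0 : 0 <= spread_point j i l by apply: le_trans (spread_point_ge1 j i l).
  by rewrite mulr_ge0 ?exprn_ge0 // addr_ge0 // drift_bound_ge0.
rewrite frobN frobZ gtr0_norm // -mulrA; apply: ler_wpM2l; first exact: ltW.
set a := avg (fun j : 'I_kap => avg (fun l =>
      spread_point j.+1 i l ^+ q * (drift_bound i l + spread_point j.+1 i l))).
have a0 : 0 <= a by apply: avg_ge0 => j; apply: avg_ge0 => l; exact: B0.
apply: (@le_trans _ _ (Num.sqrt h * (2 * Lf1 * a))); last first.
  apply: ler_wpM2l; first exact: ltW.
  rewrite /local_bound -/a.
  have := mulr_ge0 Lf10 a0; have := mulr_ge0 Lhf0 a0; have := mulr_ge0 Lf20 a0.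
  by have := Lhf0; have := Lf10; have := Lf20; lra.
rewrite mulrA frobZ ger0_norm ?invr_ge0 // /a -avgZ.
apply: ler_wpM2l; first by rewrite invr_ge0.
apply: le_trans (frob_sum _ _) _; apply: ler_sum => j _.
rewrite frobZ ger0_norm ?invr_ge0 // -avgZ; apply: ler_wpM2l; first by rewrite invr_ge0.
apply: le_trans (frob_sum _ _) _; apply: ler_sum => l _.
set U := spread_point j.+1 i l.
have U1 : 1 <= U by exact: spread_point_ge1.
have U0 : 0 <= U by exact: le_trans U1.
have [Sj _] := spread_noise_le i l (ltn_ord j).
have z0U : frob (x 0%N i - x 0%N l) <= U.
  apply: le_trans (frobB _ _) _; rewrite /U /spread_point -!addrA.
  rewrite -[leLHS]add0r; apply: lerD => //; rewrite -[leLHS]addr0 -addrA.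
  rewrite !lerD2l !addr_ge0 ?frob_ge0 // divr_ge0 ?addr_ge0 ?frob_ge0 //.
apply: le_trans (frob_mulmx _ _) _.
have J := jacobian_growth hf U1 z0U.
apply: (@le_trans _ _ ((Num.sqrt h * U) * (2 * Lf1 * U ^+ q))).
  by apply: ler_pM; rewrite ?frob_ge0.
have -> : Num.sqrt h * U * (2 * Lf1 * U ^+ q) = Num.sqrt h * (2 * Lf1) * (U ^+ q * U) by ring.
apply: ler_wpM2l; first by rewrite !mulr_ge0 // ltW.
by apply: ler_wpM2l; [exact: exprn_ge0|rewrite lerDr drift_bound_ge0].
Qed.

End local_error.

(** * Moments of the local error bound *)

Section moment_class.
Context {R : realType} disp (Omega : measurableType disp) (P : probability Omega R) (p : nat).
Implicit Types Z A : Omega -> R.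

Definition moment_le Z c : Prop :=
  [/\ measurable_fun setT Z, forall w, 0 <= Z w & mean_le P (fun w => Z w ^+ p) c].

(** Kept as an explicit function, so that the constants of composite bounds can be named before any
    probability space is given. *)
Definition moment_sum (c c' : R) : R := 2 ^+ p * (c + c').

Lemma moment_leD Z A c c' : moment_le Z c -> moment_le A c' -> moment_le (fun w => Z w + A w)
    (moment_sum c c').
Proof.
move=> [mZ Z0 hZ] [mA A0 hA]; split.
- exact: measurable_funD.
- by move=> w; rewrite addr_ge0.
apply: mean_le_le (mean_leZ (exprn_ge0 p (ler0n R 2)) (mean_leD hZ hA)) => [|w|w].
- by apply: measurable_funX; exact: measurable_funD.
- by rewrite exprn_ge0 // addr_ge0.
- exact: pow_add_le.
Qed.

Lemma moment_le1 : moment_le (fun _ => 1) 1.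
Proof. by split => //; under eq_fun do rewrite expr1n; exact: mean_le_cst. Qed.

End moment_class.

(* [local_bound] has degree [2 * q + 1] in the positions and the normalised noise,
   and [3 * (2 * q + 1) <= 8 * q]. *)
Lemma local_bound_moment {R : realType} (q : nat) (Lhf Lf1 Lf2 Cx Cn : R) :
  (1 < q)%N -> 0 < Lhf -> 0 < Lf1 -> 0 < Lf2 -> 0 <= Cx -> 0 <= Cn ->
  exists2 C : R, 0 <= C &
  forall d disp (Omega : measurableType disp) (P : probability Omega R) (N kap : nat) (h : R)
    (x xi : nat -> 'I_N -> Omega -> 'rV[R]_d), (0 < N)%N -> (0 < kap)%N -> 0 < h ->
  (forall j i, (j <= kap)%N -> moment_le P (8 * q) (fun w => frob (x j i w)) Cx) ->
  (forall j i, (j <= kap)%N -> moment_le P (8 * q) (fun w => frob (xi j i w) / Num.sqrt h) Cn) ->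
  forall i, measurable_fun setT (fun w =>
      local_bound q Lhf Lf1 Lf2 kap h (fun j i => x j i w) (fun j i => xi j i w) i) /\
    mean_le P (fun w =>
      local_bound q Lhf Lf1 Lf2 kap h (fun j i => x j i w) (fun j i => xi j i w) i ^+ 3) C.
Proof.
move=> q1 Lhf0 Lf10 Lf20 Cx0 Cn0; pose p := (8 * q)%N; pose D := @moment_sum R p.
have p1 : (3 * q <= p)%N by rewrite /p; lia.
(* The binding degree count, 6 q + 3 <= 8 q; it uses q >= 2. *)
have p2 : (3 * q + q.+1 * 3 <= p)%N by rewrite /p; lia.
have p3 : (3 * q + 3 <= p)%N by rewrite /p; lia.
have D0 a b : 0 <= a -> 0 <= b -> 0 <= D a b.
  by move=> a0 b0; rewrite /D /moment_sum mulr_ge0 ?exprn_ge0 ?addr_ge0.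
pose CU := D (D 1 (D (D (D Cx Cx) (D Cx Cx)) (D Cx Cx))) (D (D Cn Cn) (D Cn Cn)).
pose CV := D 1 (D (D Cx Cx) Cx).
have CU0 : 0 <= CU by rewrite /CU !D0.
have CV0 : 0 <= CV by rewrite /CV !D0.
pose c1 := 3 * Lhf + 6 * Lf2 + 2 * Lf1 + 1.
have c10 : 0 <= c1 by rewrite /c1; lra.
(* The outer 8 comes from the cube of a sum. Inside, 64 and [8 * (6 * Lhf) ^+ 3] come from the two
   terms of [I3], 1 from [u ^+ 3], and the rest is slack. *)
pose c2 := 8 * (73 + 8 * (6 * Lhf) ^+ 3).
have L30 : 0 <= (6 * Lhf) ^+ 3 by rewrite exprn_ge0 // mulr_ge0 // ltW.
have c20 : 0 <= c2 by rewrite /c2; lra.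
exists (c1 ^+ 3 * (8 * (1 + c2 * (CU + CV)))) => [|d disp Omega P N kap h x xi hN hk h0 hx hxi i].
  by rewrite mulr_ge0 ?exprn_ge0 // mulr_ge0 // addr_ge0 // mulr_ge0 // addr_ge0.
pose U (j : nat) l w := spread_point kap h (fun j i => x j i w) (fun j i => xi j i w) j i l.
pose V (j : nat) l l' w := spread_drift (fun j i => x j i w) j i l l'.
have U1 j l w : 1 <= U j l w by exact: spread_point_ge1.
have V1 j l l' w : 1 <= V j l l' w by exact: spread_drift_ge1.
have U0 j l w : 0 <= U j l w by exact: le_trans (U1 j l w).
have V0 j l l' w : 0 <= V j l l' w by exact: le_trans (V1 j l l' w).
have hU (j : nat) l : (j <= kap)%N -> moment_le P p (U j l) CU.
  move=> jk; rewrite /U /spread_point.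
  have -> : (fun w => 1 + (frob (x 0%N i w) + frob (x 0%N l w) + (frob (x j i w) + frob (x j l w))
       + (frob (x kap i w) + frob (x kap l w)))
      + (frob (xi 0%N i w) + frob (xi 0%N l w) + (frob (xi j i w) + frob (xi j l w))) / Num.sqrt h)
     = (fun w => 1 + (frob (x 0%N i w) + frob (x 0%N l w) + (frob (x j i w) + frob (x j l w))
       + (frob (x kap i w) + frob (x kap l w)))
      + (frob (xi 0%N i w) / Num.sqrt h + frob (xi 0%N l w) / Num.sqrt h +
         (frob (xi j i w) / Num.sqrt h + frob (xi j l w) / Num.sqrt h))).
    by apply/funext => w; rewrite !mulrDl.
  apply: moment_leD; first by apply: moment_leD (moment_le1 P p) (moment_leD (moment_leD
      (moment_leD _ _) (moment_leD _ _)) (moment_leD _ _)); exact: hx.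
  by apply: moment_leD (moment_leD _ _) (moment_leD _ _); exact: hxi.
have hV (j : nat) l l' : (j <= kap)%N -> moment_le P p (V j l l') CV.
  by move=> jk; apply: moment_leD (moment_le1 P p) (moment_leD (moment_leD _ _) _); exact: hx.
pose I l w := drift_bound q Lhf kap (fun j i => x j i w) i l.
have mI l : measurable_fun setT (I l).
  apply: measurable_funD => //; apply: measurable_funM => //; apply: measurable_funM => //.
  apply: measurable_sum => j; apply: measurable_funM => //; apply: measurable_sum => l'.
  by apply: measurable_funX; case: (hV j.+1 l l' (ltn_ord j)).
have I0 l w : 0 <= I l w.
  apply: addr_ge0 => //; apply: mulr_ge0; first by rewrite mulr_ge0 // ltW.
  by apply: avg_ge0 => j; apply: avg_ge0 => l'; rewrite exprn_ge0 // V0.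
pose G w := local_bound q Lhf Lf1 Lf2 kap h (fun j i => x j i w) (fun j i => xi j i w) i.
have mG : measurable_fun setT G.
  apply: measurable_funM => //; apply: measurable_funD => //; apply: measurable_funM => //.
  apply: measurable_sum => j; apply: measurable_funM => //; apply: measurable_sum => l.
  have [mU _ _] := hU j.+1 l (ltn_ord j).
  by apply: measurable_funM; [exact: measurable_funX|exact: (measurable_funD (mI l) mU)].
split => //.
have tot : mean_le P (fun w => c1 ^+ 3 * (8 * (1 + avg (fun j : 'I_kap => avg (fun l =>
     c2 * (U j.+1 l w ^+ p + avg (fun r : 'I_kap => avg (fun l' => V r.+1 l l' w ^+ p))))))))
   (c1 ^+ 3 * (8 * (1 + c2 * (CU + CV)))).
  apply: mean_leZ; first exact: exprn_ge0.
  apply: mean_leZ => //; apply: mean_leD; first exact: mean_le_cst.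
  apply: mean_le_avg => // j; apply: mean_le_avg => // l; apply: mean_leZ => //; apply: mean_leD.
    by case: (hU j.+1 l (ltn_ord j)).
  by apply: mean_le_avg => // r; apply: mean_le_avg => // l'; case: (hV r.+1 l l' (ltn_ord r)).
have G0 w : 0 <= G w.
  apply: mulr_ge0 => //; apply: addr_ge0 => //; apply: avg_ge0 => j; apply: avg_ge0 => l.
  by apply: mulr_ge0; [exact: (exprn_ge0 q (U0 j.+1 l w))|exact: (addr_ge0 (I0 l w) (U0 j.+1 l w))].
apply: mean_le_le tot => [|w|w]; [exact: (measurable_funX 3 mG)|exact: (exprn_ge0 3 (G0 w))|].
rewrite /local_bound -/c1 exprMn; apply: ler_wpM2l; first exact: exprn_ge0.
set a := avg _.
have B0 j l : 0 <= U j l w ^+ q * (I l w + U j l w).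
  by apply: mulr_ge0; [exact: (exprn_ge0 q (U0 j l w))|exact: (addr_ge0 (I0 l w) (U0 j l w))].
have a0 : 0 <= a by apply: avg_ge0 => j; apply: avg_ge0 => l; exact: B0.
have := pow_add_le 3 ler01 a0; rewrite expr1n (_ : 2 ^+ 3 = 8); last by rewrite !exprS expr0; ring.
move=> /le_trans; apply; apply: ler_wpM2l => //; rewrite lerD2l.
apply: le_trans (avg_pow_le _ hk (fun j => avg_ge0 (fun l => B0 j.+1 l))) _.
apply: avg_le => j; apply: le_trans (avg_pow_le _ hN (B0 j.+1)) _; apply: avg_le => l.
rewrite -/(U j.+1 l w) -/(I l w).
set u := U j.+1 l w; have u1 : 1 <= u by exact: U1.
have u0 : 0 <= u by exact: U0.
set y := avg (fun r : 'I_kap => avg (fun l' => V r.+1 l l' w ^+ p)).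
have I3 : I l w ^+ 3 <= 8 * (8 + (6 * Lhf) ^+ 3 * avg (fun r : 'I_kap => avg (fun l' => V r.+1 l
    l' w ^+ (q.+1 * 3)))).
  rewrite /I /drift_bound.
  have b0 : 0 <= avg (fun r : 'I_kap => avg (fun l' => V r.+1 l l' w ^+ q.+1)).
    by apply: avg_ge0 => r; apply: avg_ge0 => l'; rewrite exprn_ge0.
  have b0' : 0 <= 6 * Lhf * avg (fun r : 'I_kap => avg (fun l' => V r.+1 l l' w ^+ q.+1)).
    by rewrite mulr_ge0 // mulr_ge0 // ltW.
  have := pow_add_le 3 (ler0n R 2) b0'; rewrite (_ : 2 ^+ 3 = 8); last by rewrite !exprS expr0;
      ring.
  move=> /le_trans; apply; apply: ler_wpM2l => //; rewrite lerD2l exprMn.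
  apply: ler_wpM2l => //.
  apply: le_trans (avg_pow_le _ hk _) _ => [r|].
    by apply: avg_ge0 => l'; rewrite exprn_ge0.
  apply: avg_le => r; apply: le_trans (avg_pow_le _ hN _) _ => [l'|]; first by rewrite exprn_ge0.
  by apply: avg_le => l'; rewrite -exprM.
have uV : u ^+ (3 * q) * avg (fun r : 'I_kap => avg (fun l' => V r.+1 l l' w ^+ (q.+1 * 3))) <= u
    ^+ p + y.
  rewrite -avgZ; apply: (@le_trans _ _ (avg (fun r : 'I_kap => avg (fun l' => u ^+ p + V r.+1 l
      l' w ^+ p)))).
    apply: avg_le => r; rewrite -avgZ; apply: avg_le => l'.
    apply: le_trans (pow_mixed_le _ _ u0 (V0 r.+1 l l' w)) _.
    by apply: lerD; [exact: (ler_weXn2l u1 p2)|exact: (ler_weXn2l (V1 r.+1 l l' w) p2)].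
  by under eq_fun do rewrite avgD avg_cst //; rewrite avgD avg_cst.
have up1 : u ^+ (3 * q) <= u ^+ p by exact: (ler_weXn2l u1 p1).
have up2 : u ^+ (3 * q) * u ^+ 3 <= u ^+ p.
  by rewrite -exprD; exact: (ler_weXn2l u1 p3).
have y0 : 0 <= y by apply: avg_ge0 => r; apply: avg_ge0 => l'; rewrite exprn_ge0.
have uq0 : 0 <= u ^+ (3 * q) by exact: exprn_ge0.
rewrite exprMn -exprM [(q * 3)%N]mulnC.
apply: (@le_trans _ _ (u ^+ (3 * q) * (8 * (I l w ^+ 3 + u ^+ 3)))).
  apply: ler_wpM2l => //; have := pow_add_le 3 (I0 l w) u0.
  by rewrite (_ : 2 ^+ 3 = 8) //; rewrite !exprS expr0; ring.
have f1 := ler_wpM2l uq0 I3.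
have f2 := ler_wpM2l L30 uV.
have f3 := mulr_ge0 L30 y0.
have f4 : 0 <= u ^+ p by exact: exprn_ge0.
move: f1 f2 f3 up1 up2 y0 f4; rewrite /c2.
clear uV; clearbody y.
move: (u ^+ (3 * q)) (u ^+ p) (u ^+ 3) (I l w ^+ 3) (avg _) ((6 * Lhf) ^+ 3) y => a1 a2 a3 a4 a5
    a6 a7.
lra.
Qed.

(** * Blocks of the refined mesh *)

Section blocks.
Context {R : realType} (d l q : nat) (hl : (0 < l)%N) (T : R) (hT : 0 < T)
  (f : 'rV[R]_d -> 'rV[R]_d) (sigma : 'M[R]_(d, l)) (Lf Lhf Lf1 Lf2 : R)
  (hf : granular_media q f Lf Lhf Lf1 Lf2) (m0 : R).

Section realization.
Context disp (Omega : measurableType disp) (P : probability Omega R)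
  (F : R -> set (set Omega)) (W : nat -> R -> Omega -> 'rV[R]_l)
  (X0 : nat -> Omega -> 'rV[R]_d) (N M : nat) (X : 'I_N -> R -> Omega -> 'rV[R]_d).
Local Notation h := (step T M).
Local Notation grid := (grid T M).

Definition fine_time (k j : nat) : R := j%:R * (h / k.+1%:R).

(** The tolerance is h per unit of time, so that the defects of the [k.+1] fine steps in a block add
    up to at most h^2 whatever [k] is, as [r_le] demands. *)
Definition fine_good (k n : nat) : set Omega :=
  good f sigma W X (fine_time k) (h * (h / k.+1%:R)) (n * k.+1).

Definition block_point (k n j : nat) (i : 'I_N) (w : Omega) : 'rV[R]_d :=
  X i (fine_time k (n * k.+1 + j)) w.

Definition block_noise (k n j : nat) (i : 'I_N) (w : Omega) : 'rV[R]_d :=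
  noise sigma W i (fine_time k (n * k.+1 + j)) (grid n.+1) w.

Definition block_bound (k n : nat) (i : 'I_N) (w : Omega) : R :=
  local_bound q Lhf Lf1 Lf2 k.+1 h
    (fun j i => block_point k n j i w) (fun j i => block_noise k n j i w) i.

Definition block_martingale (k n : nat) (i : 'I_N) (w : Omega) : 'rV[R]_d :=
  martingale_part f k.+1 h
    (fun j i => block_point k n j i w) (fun j i => block_noise k n j i w) i.

Hypotheses (PM : particle_model q m0 P F W X0 N)
  (hst : 0 < step T M < Num.min 1 (zeta Lf)^-1)
  (hX : ips_solution f sigma T X0 W P F X).

Lemma fine_step_gt0 k : 0 < h / k.+1%:R.
Proof. by have [h0 _ _] := step_small hst; rewrite divr_gt0. Qed.

Lemma fine_time_ge0 k j : 0 <= fine_time k j.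
Proof. by rewrite mulr_ge0 // ltW // fine_step_gt0. Qed.

Lemma fine_time_grid k n : fine_time k (n * k.+1) = grid n.
Proof.
rewrite /fine_time /Defs.grid natrM.
by rewrite -mulrA [_ * (h / _)]mulrC divfK // pnatr_eq0.
Qed.

Lemma fine_timeS k j : fine_time k j.+1 = fine_time k j + h / k.+1%:R.
Proof. by rewrite /fine_time -natr1 mulrDl mul1r. Qed.

Lemma fine_time_le k i j : (i <= j)%N -> fine_time k i <= fine_time k j.
Proof. by move=> ij; rewrite ler_wpM2r ?ler_nat // ltW // fine_step_gt0. Qed.

Lemma fine_time_block k n j : (n < M)%N -> (j <= k.+1)%N ->
  [/\ grid n <= fine_time k (n * k.+1 + j), fine_time k (n * k.+1 + j) <= grid n.+1 &
   0 <= fine_time k (n * k.+1 + j) <= T].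
Proof.
move=> nM jk; have le1 : fine_time k (n * k.+1 + j) <= grid n.+1.
  by rewrite -(fine_time_grid k n.+1) fine_time_le // mulSn addnC leq_add2r.
split => //; first by rewrite -(fine_time_grid k n) fine_time_le // leq_addr.
by rewrite fine_time_ge0 (le_trans le1) // (grid_le_T hst).
Qed.

Lemma fine_good_measurable k n : (n <= M)%N -> F (grid n) (fine_good k n).
Proof.
move=> nM; rewrite -(fine_time_grid k n).
apply: (good_measurable hf (pm_F PM) (pm_W PM) hX) => j jn; last first.
  by rewrite fine_time_le.
rewrite fine_time_ge0 (le_trans (fine_time_le k jn)) // fine_time_grid.
exact: (grid_le_T hst).
Qed.

Lemma fine_good_sub k n : fine_good k n.+1 `<=` fine_good k n.
Proof.
by move=> w hw j /= jn; apply: hw => /=; apply: (leq_trans jn); rewrite leq_mul2r leqnSn orbT.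
Qed.

Lemma fine_good_eventually n : (n <= M)%N ->
  {ae P, forall w, exists k1 : nat, forall k, (k1 <= k)%N -> fine_good k n w}.
Proof.
move=> nM; have [h0 _ _] := step_small hst.
apply: filterS (good_eventually hT hf hX h0 h0) => w [k1 hk1]; exists k1 => k kk.
apply: hk1 => //; rewrite -/(fine_time k _) fine_time_grid; exact: (grid_le_T hst).
Qed.

Lemma block_step k n i w : (n < M)%N -> fine_good k n.+1 w ->
  frob (X i (grid n.+1) w - X i (grid n) w - noise sigma W i (grid n) (grid n.+1) w
    - h *: vfield f (fun j => X j (grid n.+1) w) (X i (grid n.+1) w)
    - block_martingale k n i w) <= h ^+ 2 * block_bound k n i w.
Proof.
move=> nM Aw; have [h0 h1 _] := step_small hst.
have := local_error hf (ltn0Sn k) h0 h1 (x := fun j i => block_point k n j i w)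
  (xi := fun j i => block_noise k n j i w)
  (r := fun j i => defect f sigma W X i (fine_time k (n * k.+1 + j)) (fine_time k (n * k.+1 +
      j).+1) w).
rewrite /block_point /block_noise addn0.
have -> : fine_time k (n * k.+1 + k.+1) = grid n.+1.
  by rewrite -(fine_time_grid k n.+1) mulSn addnC.
rewrite fine_time_grid; apply => [j i' jk|i'|j i' jk].
- have dE : fine_time k (n * k.+1 + j).+1 - fine_time k (n * k.+1 + j) = h / k.+1%:R.
    by rewrite fine_timeS addrC addKr.
  rewrite addnS /defect /velocity -(noiseD sigma W i' (fine_time k (n * k.+1 + j))
    (fine_time k (n * k.+1 + j).+1) (grid n.+1)).
  rewrite dE.
  move: (vfield _ _ _) => v.
  by apply/rowP => c; rewrite !mxE; ring.
- exact: noise_refl.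
- apply: (Aw (n * k.+1 + j)%N _ i') => //=.
  by rewrite mulSn addnC ltn_add2r.
Qed.

Lemma block_martingale_le k n i w :
  frob (block_martingale k n i w) <= h * Num.sqrt h * block_bound k n i w.
Proof. by have [h0 _ _] := step_small hst; exact (martingale_part_le hf k.+1 h0 _ _ i). Qed.

Lemma block_bound_ge0 k n i w : 0 <= block_bound k n i w.
Proof.
have [h0 _ _] := step_small hst.
have := le_trans (frob_ge0 _) (block_martingale_le k n i w).
by rewrite pmulr_rge0 // mulr_gt0 // sqrtr_gt0.
Qed.

End realization.

Lemma block_bound_moment : exists2 C : R, 0 <= C &
  forall disp (Omega : measurableType disp) (P : probability Omega R)
    (F : R -> set (set Omega)) (W : nat -> R -> Omega -> 'rV[R]_l)
    (X0 : nat -> Omega -> 'rV[R]_d) (N M : nat) (X : 'I_N -> R -> Omega -> 'rV[R]_d),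
  particle_model q m0 P F W X0 N -> 0 < step T M < Num.min 1 (zeta Lf)^-1 ->
  ips_solution f sigma T X0 W P F X ->
  forall k n (i : 'I_N), (n < M)%N ->
  measurable_fun setT (block_bound W M X k n i) /\
  mean_le P (fun w => block_bound W M X k n i w ^+ 3) C.
Proof.
have [Cx Cx0 hCx] := X_moment hl hT sigma hf m0.
have [Cn Cn0 hCn] := @noise_moment R d l hl sigma (4 * q).
have [C C0 hC] := @local_bound_moment R q Lhf Lf1 Lf2 Cx Cn (gm_q hf) (gm_Lhf hf)
  (gm_Lf1 hf) (gm_Lf2 hf) Cx0 Cn0.
exists C => // disp Omega P F W X0 N M X PM hst hX k n i nM.
have [h0 h1 _] := step_small hst; have [hF bW X0F X0m hN] := PM.
apply: (hC _ _ _ P _ _ _ _ _ hN (ltn0Sn k) h0) => j a jk.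
  have [_ _ tT] := fine_time_block hst nM jk; have /andP[t0 _] := tT.
  split.
  - exact (meas_wrt_filtration_meas hF t0 (meas_wrt_frob (vmeas_wrt_X hX a tT))).
  - by move=> w; exact: frob_ge0.
  - exact: hCx PM hX a _ tT.
have [nt tn /andP[t0 _]] := fine_time_block hst nM jk.
have s0 : 0 < Num.sqrt (step T M) by rewrite sqrtr_gt0.
have mn := meas_wrt_filtration_meas hF (le_trans t0 tn) (meas_wrt_frob (vmeas_wrt_noise sigma hF
    bW a t0 tn)).
split.
- exact: measurable_funM.
- by move=> w; rewrite divr_ge0 ?frob_ge0 // ltW.
have n8 : (2 * (4 * q) = 8 * q)%N by rewrite mulnA.
have := hCn _ _ P F W a hF (bW a) _ _ t0 tn; rewrite n8 => hn.
have hq0 : 0 < step T M ^+ (4 * q) by exact: exprn_gt0.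
have shq : Num.sqrt (step T M) ^+ (8 * q) = step T M ^+ (4 * q).
  by rewrite -n8 exprM sqr_sqrtr // ltW.
have i0 : 0 <= (step T M ^+ (4 * q))^-1 by rewrite invr_ge0 ltW.
have := mean_leZ i0 hn; under eq_fun do rewrite mulrC -shq -exprVn -exprMn.
apply: mean_le_trans; rewrite mulrCA ler_piMr // mulrC ler_pdivrMr // mul1r.
rewrite lerXn2r ?nnegrE ?subr_ge0 ?(ltW h0) //.
have := gridS T M n; lra.
Qed.

End blocks.

(** * Vanishing of the martingale cross terms *)

Section martingale.
Context {R : realType} (d l q : nat) (hl : (0 < l)%N) (T : R) (hT : 0 < T)
  (f : 'rV[R]_d -> 'rV[R]_d) (sigma : 'M[R]_(d, l)) (Lf Lhf Lf1 Lf2 : R)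
  (hf : granular_media q f Lf Lhf Lf1 Lf2) (m0 : R).
Context disp (Omega : measurableType disp) (P : probability Omega R)
  (F : R -> set (set Omega)) (W : nat -> R -> Omega -> 'rV[R]_l)
  (X0 : nat -> Omega -> 'rV[R]_d) (N M : nat) (X : 'I_N -> R -> Omega -> 'rV[R]_d).
Local Notation h := (step T M).
Local Notation grid := (grid T M).
Hypotheses (PM : particle_model q m0 P F W X0 N)
  (hst : 0 < step T M < Num.min 1 (zeta Lf)^-1)
  (hX : ips_solution f sigma T X0 W P F X).

Lemma meas_wrt_jacobian G (Z : Omega -> 'rV[R]_d) a b : vmeas_wrt G Z ->
  meas_wrt G (fun w => 'J f (Z w) a b).
Proof.
apply: (meas_wrt_continuous (g := fun x => 'J f x a b)) => x.
apply: (@continuous_comp _ _ _ (fun y => 'J f y) (fun A : 'M[R]_(d, d) => A a b)).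
  exact: (gm_C1 hf).
exact: coord_continuous.
Qed.

(** The coefficients, products of [phi] with Jacobians at the start of the block, belong to the past
    of the noise. Their integrability is Young's inequality between [Z ^+ p.+1] and a Jacobian of
    growth [q]: the latter is raised to the power [p.+2], and moments of order [8 * q] suffice when
    [p.+2 <= 8]. *)
Lemma mean0_block_martingale (p k n : nat) (i : 'I_N) (phi : Omega -> 'rV[R]_d)
    (Z : Omega -> R) (K a : R) : (n < M)%N -> (p.+2 <= 8)%N -> vmeas_wrt (F (grid n)) phi ->
  0 <= K -> (forall w, 0 <= Z w) -> (forall w, frob (phi w) <= K * Z w ^+ p.+1) ->
  mean_le P (fun w => Z w ^+ p.+2) a ->
  mean0 P (fun w => dotp (phi w) (block_martingale T f sigma W M X k n i w)).
Proof.
move=> nM p8 mphi K0 Z0 phiZ Zm; have [hF bW X0F X0m hN] := PM.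
have [Cx Cx0 /(_ _ _ _ _ _ _ _ _ PM hX) hCx] := X_moment hl hT sigma hf m0.
have gn0 := grid_ge0 hst n; have gnT : 0 <= grid n <= T.
  by rewrite gn0 (grid_le_T hst (ltnW nM)).
pose J r w := 'J f (X i (grid n) w - X r (grid n) w).
have mJ r b c : meas_wrt (F (grid n)) (fun w => phi w 0 b * J r w c b).
  apply: measurable_funM; first exact: mphi.
  apply: meas_wrt_jacobian; apply: vswrtB; exact (vmeas_wrt_X hX _ gnT).
have pX r : moment_le P (8 * q) (fun w => frob (X r (grid n) w)) Cx.
  split => [|w|]; [|exact: frob_ge0|exact: hCx].
  exact (meas_wrt_filtration_meas hF gn0 (meas_wrt_frob (vmeas_wrt_X hX r gnT))).
have eJ r b c : exists2 a', 0 <= a' & mean_le P (fun w => `|phi w 0 b * J r w c b|) a'.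
  pose u w := 1 + frob (X i (grid n) w) + frob (X r (grid n) w).
  have [mu u0 um] : moment_le P (8 * q) u (moment_sum (8 * q) (moment_sum (8 * q) 1 Cx) Cx).
    exact: moment_leD (moment_leD (moment_le1 P (8 * q)) (pX i)) (pX r).
  have up := mean_le_pow_le (i := q * p.+2) _ mu u0 um.
  have qp : (q * p.+2 <= 8 * q)%N by rewrite mulnC leq_mul2r p8 orbT.
  have L0 : 0 <= 2 * Lf1 by rewrite mulr_ge0 // ltW // (gm_Lf1 hf).
  have := mean_leZ K0 (mean_leD Zm (mean_leZ (exprn_ge0 p.+2 L0) (up qp))).
  set a' := K * _ => h1; exists `|a'| => //; apply: mean_le_trans (ler_norm a') _.
  apply: mean_le_le h1 => [|w|w]; last 1 first.
  - apply: (@le_trans _ _ (K * Z w ^+ p.+1 * (2 * Lf1 * u w ^+ q))).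
      rewrite normrM; apply: ler_pM => //.
        by apply: le_trans (phiZ w); exact: entry_le_frob.
      have u1 : 1 <= u w by rewrite /u -addrA lerDl addr_ge0 ?frob_ge0.
      apply: le_trans (entry_le_frob _ _ _) _; apply: (jacobian_growth hf u1).
      by apply: le_trans (frobB _ _) _; rewrite /u; lra.
    rewrite -mulrA; apply: ler_wpM2l => //.
    have v0 : 0 <= 2 * Lf1 * u w ^+ q by rewrite mulr_ge0 ?exprn_ge0.
    have := pow_mixed_le p.+1 1 (Z0 w) v0.
    by rewrite expr1 addn1 exprMn -exprM.
  - apply: measurableT_comp => //; exact (meas_wrt_filtration_meas hF gn0 (mJ r b c)).
  - exact: normr_ge0.
pose bn j r w := noise sigma W r (fine_time T M k (n * k.+1 + j)) (grid n.+1) w.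
have -> : (fun w => dotp (phi w) (block_martingale T f sigma W M X k n i w)) =
   (fun w => -1 * (h * (k.+1%:R^-1 * \sum_(j < k.+1) (N%:R^-1 * \sum_r \sum_b \sum_c
      (phi w 0 b * J r w c b * bn j.+1 (i : nat) w 0 c +
       -1 * (phi w 0 b * J r w c b * bn j.+1 (r : nat) w 0 c)))))).
  apply/funext => w; rewrite /block_martingale /martingale_part dotpNr !dotpZr dotp_sumr.
  rewrite mulN1r; congr (- (_ * (_ * _))); apply: eq_bigr => j _; rewrite dotpZr dotp_sumr; congr
      (_ * _).
  apply: eq_bigr => r _; apply: eq_bigr => b _.
  rewrite mxE mulr_sumr; apply: eq_bigr => c _.
  rewrite /block_point /block_noise addn0 (fine_time_grid T M k n) -/(J r w) -!/(bn _ _ _).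
  by rewrite !mxE; ring.
apply: mean0Z; apply: mean0Z; apply: mean0Z; apply: mean0_sum => j.
apply: mean0Z; apply: mean0_sum => r; apply: mean0_sum => b; apply: mean0_sum => c.
have [nt tn /andP[t0 _]] := fine_time_block hst (k := k) nM (ltn_ord j).
have [a' a'0 ha] := eJ r b c.
have ms := meas_wrt_sub (filtration_mono hF gn0 nt) (mJ r b c).
apply: mean0D; first exact (mean0_noise hl sigma hF bW _ _ t0 tn ms ha).
by apply: mean0Z; exact (mean0_noise hl sigma hF bW _ _ t0 tn ms ha).
Qed.

End martingale.

(** * Propagation of the error *)

(** Jensen's inequality for the power 3/2, kept within integer powers: 2 G^3 + s^3 - 3 s G^2 = (G -
    s)^2 (2 G + s) is nonnegative. *)
Lemma rms_cube {R : realType} N (G : 'I_N -> R) : (0 < N)%N -> (forall i, 0 <= G i) ->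
  Num.sqrt (avg (fun i => G i ^+ 2)) ^+ 3 <= avg (fun i => G i ^+ 3).
Proof.
move=> hN G0; set s := Num.sqrt _; have s0 : 0 <= s by exact: sqrtr_ge0.
have s2 : s ^+ 2 = avg (fun i => G i ^+ 2).
  by rewrite sqr_sqrtr // avg_ge0 // => i; exact: sqr_ge0.
have key : avg (fun i => 3 * s * G i ^+ 2) <= avg (fun i => 2 * G i ^+ 3 + s ^+ 3).
  apply: avg_le => i; rewrite -subr_ge0.
  have -> : 2 * G i ^+ 3 + s ^+ 3 - 3 * s * G i ^+ 2 = (G i - s) ^+ 2 * (2 * G i + s) by ring.
  by rewrite mulr_ge0 ?sqr_ge0 // addr_ge0 // mulr_ge0.
rewrite avgZ -s2 avgD avgZ avg_cst // in key.
have : 3 * s * s ^+ 2 = 3 * s ^+ 3 by ring.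
by move: key; lra.
Qed.

Lemma snorm_scale {R : realType} d N (hN : (0 < N)%N) (u : 'I_N -> 'rV[R]_d)
    (G : 'I_N -> R) c : 0 <= c -> (forall i, 0 <= G i) ->
  (forall i, frob (u i) <= c * G i) -> snorm u <= c * Num.sqrt (avg (fun i => G i ^+ 2)).
Proof.
move=> c0 G0 uG; rewrite -(@ler_pXn2r _ 2) ?nnegrE ?mulr_ge0 ?snorm_ge0 ?sqrtr_ge0 //.
rewrite snorm_sqr exprMn sqr_sqrtr; last by apply: avg_ge0 => i; exact: sqr_ge0.
rewrite -avgZ; apply: avg_le => i.
by rewrite -exprMn lerXn2r ?nnegrE ?mulr_ge0 ?frob_ge0.
Qed.

Lemma vfield_moment {R : realType} (d q p : nat) (f : 'rV[R]_d -> 'rV[R]_d)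
    (Lf Lhf Lf1 Lf2 Cx : R) (hf : granular_media q f Lf Lhf Lf1 Lf2) :
  0 <= Cx -> (q.+1 * p <= 8 * q)%N -> exists2 C : R, 0 <= C &
  forall disp (Omega : measurableType disp) (P : probability Omega R) (N : nat)
    (Z : 'I_N -> Omega -> 'rV[R]_d), (0 < N)%N ->
  (forall j, moment_le P (8 * q) (fun w => frob (Z j w)) Cx) -> forall i,
  measurable_fun setT (fun w => frob (vfield f (fun j => Z j w) (Z i w))) ->
  mean_le P (fun w => frob (vfield f (fun j => Z j w) (Z i w)) ^+ p) C.
Proof.
move=> Cx0 qp; have L0 : 0 <= 3 * Lhf by rewrite mulr_ge0 // ltW // (gm_Lhf hf).
have D0 a b : 0 <= a -> 0 <= b -> 0 <= moment_sum (8 * q) a b :> R.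
  by move=> a0 b0; rewrite /moment_sum mulr_ge0 ?exprn_ge0 ?addr_ge0.
exists ((3 * Lhf) ^+ p * (1 + moment_sum (8 * q) (moment_sum (8 * q) 1 Cx) Cx)).
  by rewrite mulr_ge0 ?exprn_ge0 // addr_ge0 // !D0.
move=> disp Omega P N Z hN hZ i mv.
pose u j w := 1 + frob (Z i w) + frob (Z j w).
have hu j : moment_le P (8 * q) (u j) (moment_sum (8 * q) (moment_sum (8 * q) 1 Cx) Cx).
  exact (moment_leD (moment_leD (moment_le1 P (8 * q)) (hZ i)) (hZ j)).
have u1 j w : 1 <= u j w by rewrite /u -addrA lerDl addr_ge0 ?frob_ge0.
have tot : mean_le P (fun w => (3 * Lhf) ^+ p * avg (fun j => u j w ^+ (q.+1 * p)))
    ((3 * Lhf) ^+ p * (1 + moment_sum (8 * q) (moment_sum (8 * q) 1 Cx) Cx)).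
  apply: mean_leZ; first exact: exprn_ge0.
  by apply: mean_le_avg => // j; have [mu u0 um] := hu j; exact: mean_le_pow_le qp mu u0 um.
apply: mean_le_le tot => [|w|w]; [exact: measurable_funX|by rewrite exprn_ge0 ?frob_ge0|].
have u0 j : 0 <= u j w by apply: le_trans (u1 j w).
have h1 : frob (vfield f (fun j => Z j w) (Z i w)) <= 3 * Lhf * avg (fun j => u j w ^+ q.+1).
  apply: le_trans (frob_vfield_le _ _ _) _; rewrite -avgZ; apply: avg_le => j.
  apply: (f_growth hf (u1 j w)); apply: le_trans (frobB _ _) _; rewrite /u; lra.
have a0 : 0 <= avg (fun j => u j w ^+ q.+1) by apply: avg_ge0 => j; rewrite exprn_ge0.
apply: (@le_trans _ _ ((3 * Lhf * avg (fun j => u j w ^+ q.+1)) ^+ p)).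
  by rewrite lerXn2r ?nnegrE ?frob_ge0 // (mulr_ge0 L0 a0).
rewrite exprMn; apply: ler_wpM2l; first exact: exprn_ge0.
apply: le_trans (avg_pow_le _ hN _) _ => [j|]; first by rewrite exprn_ge0.
by apply: avg_le => j; rewrite -exprM.
Qed.

Section errors.
Context {R : realType} (d l q : nat) (hl : (0 < l)%N) (T : R) (hT : 0 < T)
  (f : 'rV[R]_d -> 'rV[R]_d) (sigma : 'M[R]_(d, l)) (Lf Lhf Lf1 Lf2 : R)
  (hf : granular_media q f Lf Lhf Lf1 Lf2) (m0 : R).

Definition stage_error disp (Omega : measurableType disp) N M
    (X : 'I_N -> R -> Omega -> 'rV[R]_d) (Y : nat -> 'I_N -> Omega -> 'rV[R]_d)
    (n : nat) (i : 'I_N) (w : Omega) : 'rV[R]_d :=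
  X i (grid T M n) w - Y n i w.

Section realization.
Context disp (Omega : measurableType disp) (P : probability Omega R)
  (F : R -> set (set Omega)) (W : nat -> R -> Omega -> 'rV[R]_l)
  (X0 : nat -> Omega -> 'rV[R]_d) (N M : nat) (X : 'I_N -> R -> Omega -> 'rV[R]_d)
  (Y : nat -> 'I_N -> Omega -> 'rV[R]_d).
Local Notation h := (step T M).
Local Notation grid := (grid T M).
Local Notation E := (stage_error M X Y).
Hypotheses (PM : particle_model q m0 P F W X0 N)
  (hst : 0 < step T M < Num.min 1 (zeta Lf)^-1)
  (hX : ips_solution f sigma T X0 W P F X)
  (hY : ssm_implicit f sigma T X0 W M Y).

Lemma stage_errorS n i w : (n.+1 < M)%N ->
  E n.+1 i w - h *: (vfield f (fun j => X j (grid n.+1) w) (X i (grid n.+1) w)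
     - vfield f (fun j => Y n.+1 j w) (Y n.+1 i w)) =
  E n i w + (X i (grid n.+1) w - X i (grid n) w - noise sigma W i (grid n) (grid n.+1) w
    - h *: vfield f (fun j => X j (grid n.+1) w) (X i (grid n.+1) w)).
Proof.
move=> nM; have /= eY := stage_equation hf hY i w nM.
rewrite /stage_error; move: eY.
move: (noise _ _ _ _ _ _) (vfield f (fun j => X j _ w) _) (vfield _ _ _) => e b a eY.
have -> : Y n i w = Y n.+1 i w - h *: a - e by rewrite eY addrK.
by apply/rowP => c; rewrite !mxE; ring.
Qed.

(** The first stage already lies one drift step away from the initial value, so the recursion starts
    from an error of order h and not from 0. *)
Lemma stage_error0 : {ae P, forall w, forall i,
  E 0 i w - h *: (vfield f (fun j => X j (grid 0) w) (X i (grid 0) w)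
     - vfield f (fun j => Y 0%N j w) (Y 0%N i w)) =
  - (h *: vfield f (fun j => X j (grid 0) w) (X i (grid 0) w))}.
Proof.
have M0 := M_gt0 hst.
apply: filterS (X_initial hT hf hX) => w X0E i.
have /= eY := stage_equation hf hY i w M0.
have e0 : X i (grid 0) w = Y 0%N i w - h *: vfield f (fun j => Y 0%N j w) (Y 0%N i w).
  by rewrite eY /Defs.grid mul0r X0E.
rewrite /stage_error; move: e0; move: (vfield f _ (X _ _ _)) => b; move: (vfield _ _ _) => a ->.
by apply/rowP => c; rewrite !mxE; ring.
Qed.

Lemma vmeas_wrt_stage_error n i : (n < M)%N -> vmeas_wrt (F (grid n)) (E n i).
Proof.
move=> nM; have gT : 0 <= grid n <= T by rewrite (grid_ge0 hst) (grid_le_T hst (ltnW nM)).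
by apply: vswrtB; [exact (vmeas_wrt_X hX i gT)|exact (vmeas_wrt_stage hf PM hst hY i nM)].
Qed.

End realization.
End errors.

Lemma measurable_sqrtr {R : realType} disp (T : measurableType disp) (Z : T -> R) :
  measurable_fun setT Z -> measurable_fun setT (fun w => Num.sqrt (Z w)).
Proof.
by apply: measurableT_comp; apply: continuous_measurable_fun; exact: sqrt_continuous.
Qed.

Lemma meas_wrt_snorm {R : realType} disp (T : measurableType disp) (G : set (set T)) d N
  (u : 'I_N -> T -> 'rV[R]_d) : (forall i, vmeas_wrt G (u i)) ->
  meas_wrt G (fun w => snorm (fun i => u i w)).
Proof.
move=> hu; apply: measurable_sqrtr; apply: measurable_funM => //.
by apply: measurable_sum => i; apply: measurable_funX; exact (meas_wrt_frob (hu i)).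
Qed.

Section errors.
Context {R : realType} (d l q : nat) (hl : (0 < l)%N) (T : R) (hT : 0 < T)
  (f : 'rV[R]_d -> 'rV[R]_d) (sigma : 'M[R]_(d, l)) (Lf Lhf Lf1 Lf2 : R)
  (hf : granular_media q f Lf Lhf Lf1 Lf2) (m0 : R).
Let Lp := Num.max 0 Lf.
Let Lp0 : 0 <= Lp. Proof. by rewrite le_max lexx. Qed.

Lemma initial_velocity_moment p : (q.+1 * p <= 8 * q)%N -> exists2 C : R, 0 <= C &
  forall disp (Omega : measurableType disp) (P : probability Omega R)
    (F : R -> set (set Omega)) (W : nat -> R -> Omega -> 'rV[R]_l)
    (X0 : nat -> Omega -> 'rV[R]_d) (N : nat) (X : 'I_N -> R -> Omega -> 'rV[R]_d),
  particle_model q m0 P F W X0 N -> ips_solution f sigma T X0 W P F X ->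
  forall i (t : R), 0 <= t <= T ->
  measurable_fun setT (fun w => frob (vfield f (fun j => X j t w) (X i t w))) /\
  mean_le P (fun w => frob (vfield f (fun j => X j t w) (X i t w)) ^+ p) C.
Proof.
have [Cx Cx0 hCx] := X_moment hl hT sigma hf m0.
move=> qp; have [C C0 hC] := vfield_moment hf Cx0 qp.
exists C => // disp Omega P F W X0 N X PM hX i t tT; have /andP[t0 _] := tT.
have [hF bW X0F X0m hN] := PM.
have mv : measurable_fun setT (fun w => frob (vfield f (fun j => X j t w) (X i t w))).
  exact (meas_wrt_filtration_meas hF t0 (meas_wrt_frob (vmeas_wrt_velocity hf hX i tT))).
split => //; apply: (hC _ _ P N (fun j => X j t) hN) => // j; split.
- exact (meas_wrt_filtration_meas hF t0 (meas_wrt_frob (vmeas_wrt_X hX j tT))).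
- by move=> w; exact: frob_ge0.
- exact: hCx PM hX j t tT.
Qed.

(** Here [nu = c = h * g], with [g] the root mean square of the block bounds: the martingale part is
    at most sqrt h times [nu] and the remainder h times [c], exactly the sizes that
    [moment_recursion] admits. The cube of the error is the case [p = 1]. *)
Lemma system_error : exists2 C : R, 0 <= C &
  forall disp (Omega : measurableType disp) (P : probability Omega R)
    (F : R -> set (set Omega)) (W : nat -> R -> Omega -> 'rV[R]_l)
    (X0 : nat -> Omega -> 'rV[R]_d) (N M : nat) (X : 'I_N -> R -> Omega -> 'rV[R]_d)
    (Y : nat -> 'I_N -> Omega -> 'rV[R]_d),
  particle_model q m0 P F W X0 N -> 0 < step T M < Num.min 1 (zeta Lf)^-1 ->
  ips_solution f sigma T X0 W P F X -> ssm_implicit f sigma T X0 W M Y ->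
  forall k n, (n < M)%N ->
  mean_le P (fun w => \1_(fine_good T f sigma W M X k n) w *
    snorm (fun i => stage_error T M X Y n i w) ^+ 3) (C * step T M ^+ 3).
Proof.
have [Cr Cr0 hr] := moment_recursion 1 Lp0.
have [Cb Cb0 hCb] := block_bound_moment hl hT sigma hf m0.
have q3 : (q.+1 * 3 <= 8 * q)%N by have := gm_q hf; lia.
have [Cv Cv0 hCv] := initial_velocity_moment q3.
exists (expR (T * Cr) * (8 * Cv + T * Cr * Cb)) => [|disp Omega P F W X0 N M X Y PM hst hX hY k n
    nM].
  by rewrite mulr_ge0 ?expR_ge0 // addr_ge0 ?mulr_ge0 // ltW.
have [hF bW X0F X0m hN] := PM; have [h0 h1 hL] := step_small hst.
have M0 := M_gt0 hst.
set h := step T M in h0 h1 hL *.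
pose E n i w := stage_error T M X Y n i w.
pose G n i w := block_bound q T sigma Lhf Lf1 Lf2 W M X k n i w.
pose m n i w := block_martingale T f sigma W M X k n i w.
pose A n := fine_good T f sigma W M X k n.
have G0 j i w : 0 <= G j i w by exact (block_bound_ge0 sigma hf W X hst k j i w).
pose g j w := Num.sqrt (avg (fun i => G j i w ^+ 2)).
have g0 j w : 0 <= g j w by exact: sqrtr_ge0.
have mgE j i : (j < M)%N -> measurable_fun setT (G j i) /\ mean_le P (fun w => G j i w ^+ 3) Cb.
  by move=> jM; exact: hCb PM hst hX k j i jM.
have ltM j : (j <= M.-1)%N -> (j < M)%N by move=> jM; rewrite -(prednK M0) ltnS.
have FA j : (j <= M)%N -> F (grid T M j) (A j).
  by move=> jM; exact (fine_good_measurable hf PM hst hX k jM).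
have mA j : (j <= M)%N -> measurable (A j).
  by move=> jM; exact: (filtration_measurable hF (grid_ge0 hst j)) (FA j jM).
have dA j : A j.+1 `<=` A j by exact: fine_good_sub.
have vE j i : (j < M)%N -> vmeas_wrt (F (grid T M j)) (E j i).
  by move=> jM; exact (vmeas_wrt_stage_error hf PM hst hX hY i jM).
have sE j : (j < M)%N -> meas_wrt (F (grid T M j)) (fun w => snorm (fun i => E j i w)).
  by move=> jM; apply: meas_wrt_snorm => i; exact: vE.
have mE j : (j < M)%N -> measurable_fun setT (fun w => snorm (fun i => E j i w)).
  by move=> jM; exact (meas_wrt_filtration_meas hF (grid_ge0 hst j) (sE j jM)).
have sh0 : 0 <= Num.sqrt h by exact: sqrtr_ge0.
have shh : Num.sqrt h * Num.sqrt h = h by rewrite -expr2 sqr_sqrtr // ltW.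
have m_le j w : snorm (fun i => m j i w) <= Num.sqrt h * (h * g j w).
  rewrite mulrA [_ * h]mulrC; apply: snorm_scale => // [|i].
    by rewrite mulr_ge0 // ltW.
  exact (block_martingale_le sigma hf W X hst k j i w).
have nu_moment j : (j < M.-1)%N -> mean_le P (fun w => (h * g j w) ^+ 3) (h ^+ 3 * Cb).
  move=> jM; have jM' := ltM j (ltnW jM).
  have mg : measurable_fun setT (g j).
    apply: measurable_sqrtr; apply: measurable_funM => //; apply: measurable_sum => i.
    by apply: measurable_funX; exact: (mgE j i jM').1.
  apply: mean_le_le (mean_leZ (exprn_ge0 3 (ltW h0)) (mean_le_avg hN (fun i => (mgE j i jM').2)))
      => [|w|w].
  - by apply: measurable_funX; exact: measurable_funM.
  - by rewrite exprn_ge0 // mulr_ge0 // ltW.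
  - rewrite exprMn; apply: ler_wpM2l; first by rewrite exprn_ge0 // ltW.
    exact: rms_cube.
(* The 8 is the cube of 2, the bound for the inverse of [1 - h * Lp]. *)
have init : mean_le P (fun w => \1_(A 0%N) w * snorm (fun i => E 0%N i w) ^+ 3) (h ^+ 3 * (8 * Cv)).
  have z0 : 0 <= grid T M 0 <= T by rewrite (grid_ge0 hst) (grid_le_T hst).
  have hv i := hCv _ _ _ _ _ _ _ _ PM hX i _ z0.
  have tot := mean_leZ (exprn_ge0 3 (ltW h0)) (mean_leZ (ler0n R 8) (mean_le_avg hN (fun i => (hv
      i).2))).
  apply: mean_le_le_ae tot => [|w|].
  - apply: measurable_funM; first exact: measurable_indic (mA 0%N _).
    by apply: measurable_funX; exact: mE.
  - by rewrite mulr_ge0 // exprn_ge0 // snorm_ge0.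
  apply: filterS (stage_error0 hT hf hst hX hY) => w hw.
  apply: (@le_trans _ _ (snorm (fun i => E 0%N i w) ^+ 3)).
    by rewrite ler_piMl ?exprn_ge0 ?snorm_ge0 // indicE lern1 leq_b1.
  pose r i := frob (vfield f (fun j => X j (grid T M 0) w) (X i (grid T M 0) w)).
  have i1 := implicit_system hN hf (ltW h0) hw.
  have i2 : snorm (fun i => - (h *: vfield f (fun j => X j (grid T M 0) w) (X i (grid T M 0) w)))
      <= h * Num.sqrt (avg (fun i => r i ^+ 2)).
    apply: snorm_scale => // [|i|i]; [exact: ltW|exact: frob_ge0|].
    by rewrite frobN frobZ gtr0_norm.
  have i3 : snorm (fun i => E 0%N i w) <= h * (2 * Num.sqrt (avg (fun i => r i ^+ 2))).
    by move: (le_trans i1 i2) (snorm_ge0 (fun i => E 0%N i w)); rewrite -/Lp -/(E 0%N _ w); nra.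
  apply: (@le_trans _ _ ((h * (2 * Num.sqrt (avg (fun i => r i ^+ 2)))) ^+ 3)).
    by rewrite lerXn2r ?nnegrE ?snorm_ge0 ?mulr_ge0 ?sqrtr_ge0 // ltW.
  rewrite exprMn; apply: ler_wpM2l; first by rewrite exprn_ge0 // ltW.
  rewrite exprMn; have -> : 2 ^+ 3 = 8 :> R by rewrite !exprS expr0; ring.
  by apply: ler_wpM2l => //; apply: rms_cube => // i; exact: frob_ge0.
have hyp_step j w : (j < M.-1)%N -> A j.+1 w ->
    (1 - h * Lp) * snorm (fun i => E j.+1 i w) <=
    snorm (fun i => E j i w + m j i w) + h * (h * g j w).
  move=> jM Aw; have jM1 : (j.+1 < M)%N by rewrite -(prednK M0) ltnS.
  have := implicit_system hN hf (ltW h0) (fun i => stage_errorS hf X hY i w jM1).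
  move=> /le_trans; apply.
  pose Q i := X i (grid T M j.+1) w - X i (grid T M j) w
    - noise sigma W i (grid T M j) (grid T M j.+1) w
    - h *: vfield f (fun j' => X j' (grid T M j.+1) w) (X i (grid T M j.+1) w) - m j i w.
  have -> : (fun i => stage_error T M X Y j i w + (X i (grid T M j.+1) w - X i (grid T M j) w -
     noise sigma W i (grid T M j) (grid T M j.+1) w -
     h *: vfield f (fun j' => X j' (grid T M j.+1) w) (X i (grid T M j.+1) w))) =
     (fun i => (E j i w + m j i w) + Q i).
    apply/funext => i; rewrite /Q /E; move: (vfield _ _ _) (m j i w) (stage_error _ _ _ _ _ _ _)
        => a b c.
    by apply/rowP => s; rewrite !mxE; ring.
  apply: le_trans (snormD hN _ Q) _; rewrite lerD2l mulrA -expr2.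
  apply: snorm_scale => // [|i]; first exact: sqr_ge0.
  exact (block_step hf hst i (ltnW jM1) Aw).
have nM' : (n <= M.-1)%N by rewrite -ltnS prednK.
have be0 : 0 <= h ^+ 3 * Cb by rewrite mulr_ge0 // exprn_ge0 // ltW.
have nu0 j w : 0 <= h * g j w by rewrite mulr_ge0 // ltW.
have concl := hr _ _ P h (h ^+ 3 * Cb) (h ^+ 3 * (8 * Cv)) M.-1 A
  (fun j w => snorm (fun i => E j i w))
  (fun j w => snorm (fun i => E j i w + m j i w))
  (fun j w => avg (fun i => dotp (E j i w) (m j i w)))
  (fun j w => h * g j w) (fun j w => h * g j w) h0 h1 hL be0
  (fun j jM => mA j (ltnW (ltM j jM))) (fun j _ => dA j)
  (fun j jM => mE j (ltM j jM)) (fun j w => snorm_ge0 _) (fun j w => snorm_ge0 _)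
  nu0 nu0 _ _ hyp_step nu_moment nu_moment _ init n nM'.
apply: mean_le_trans (concl _ _ _).
- have hh : 0 <= n%:R * h by rewrite mulr_ge0 // ltW.
  have nhT : n%:R * h <= T by exact: (grid_le_T hst (ltnW nM)).
  have nCT : n%:R * h * Cr <= T * Cr by rewrite ler_wpM2r.
  have -> : n%:R * (Cr * h) = n%:R * h * Cr by ring.
  have -> : n%:R * (Cr * h * (h ^+ 3 * Cb)) = n%:R * h * Cr * Cb * h ^+ 3 by ring.
  rewrite -[leRHS]mulrA; apply: ler_pM; rewrite ?expR_ge0 ?ler_expR //.
    by rewrite addr_ge0 ?mulr_ge0 // ?exprn_ge0 // ltW.
  rewrite mulrC -mulrDl; apply: ler_wpM2r; first by rewrite exprn_ge0 // ltW.
  by rewrite lerD2l ler_wpM2r.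
- move=> j w; rewrite snormD_sqr lerD2l.
  have := m_le j w; have := snorm_ge0 (fun i => m j i w).
  move=> s0 s1; rewrite -[X in X * _ ^+ 2]shh -expr2 -exprMn.
  by rewrite lerXn2r ?nnegrE // (le_trans s0).
- by move=> j w; apply: le_trans (snormB_le hN _ _) _; exact: m_le.
- move=> j a jM hE; have jM' := ltM j (ltnW jM).
  have -> : (fun w => \1_(A j) w * (snorm (fun i => E j i w) ^+ 1 *
       avg (fun i => dotp (E j i w) (m j i w)))) =
     (fun w => N%:R^-1 * \sum_i dotp ((\1_(A j) w * snorm (fun i => E j i w)) *: E j i w) (m j i
         w)).
    apply/funext => w; under [in RHS]eq_bigr do rewrite dotpZl.
    by rewrite -mulr_sumr /avg expr1; ring.
  apply: mean0Z; apply: mean0_sum => i.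
  apply: (mean0_block_martingale hl hT hf PM hst hX (p := 1) k i
    (Z := fun w => \1_(A j) w * snorm (fun i => E j i w)) (K := N%:R) (a := a)) => //.
  + move=> c; under eq_fun do rewrite mxE.
    apply: measurable_funM; last exact: vE.
    by apply: measurable_funM; [exact (meas_wrt_indic (FA j (ltnW jM')))|exact: sE].
  + by move=> w; rewrite mulr_ge0 ?snorm_ge0.
  + move=> w; rewrite frobZ ger0_norm ?mulr_ge0 ?snorm_ge0 //.
    have fE := frob_le_snorm hN (fun i => E j i w) i.
    rewrite indicE; case: (_ \in _); rewrite ?mul1r ?mul0r ?expr0n ?mulr0 //=.
    by rewrite expr2 mulrCA; apply: ler_wpM2l => //; exact: snorm_ge0.
  + have -> : (fun w => (\1_(A j) w * snorm (fun i => E j i w)) ^+ 3) =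
        (fun w => \1_(A j) w * snorm (fun i => E j i w) ^+ 3) => //.
    by apply/funext => w; rewrite exprMn indicE; case: (_ \in _); rewrite ?expr1n ?expr0n.
Qed.

End errors.

(** * Error of a single particle *)

Section particle_error.
Context {R : realType} (d l q : nat) (hl : (0 < l)%N) (T : R) (hT : 0 < T)
  (f : 'rV[R]_d -> 'rV[R]_d) (sigma : 'M[R]_(d, l)) (Lf Lhf Lf1 Lf2 : R)
  (hf : granular_media q f Lf Lhf Lf1 Lf2) (m0 : R).
Let Lp := Num.max 0 Lf.

Definition interaction_point N (x y : 'I_N -> 'rV[R]_d) (i j : 'I_N) : R :=
  1 + frob (x i) + frob (x j) + frob (y j).

(** The quantity [B^i]: it bounds the effect on the drift at [x i] of replacing the empirical
    measure of [x] by that of [y]. The point [y i] enters it only as one of the particles of [y]. *)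
Definition interaction_error N (x y : 'I_N -> 'rV[R]_d) (i : 'I_N) : R :=
  avg (fun j => 3 * Lhf * interaction_point x y i j ^+ q * frob (x j - y j)).

Lemma interaction_point_ge1 N (x y : 'I_N -> 'rV[R]_d) i j : 1 <= interaction_point x y i j.
Proof. by rewrite /interaction_point -!addrA lerDl !addr_ge0 ?frob_ge0. Qed.

Let L3 : 0 <= 3 * Lhf. Proof. by rewrite mulr_ge0 // ltW // (gm_Lhf hf). Qed.

Let factor_ge0 N (x y : 'I_N -> 'rV[R]_d) i j : 0 <= 3 * Lhf * interaction_point x y i j ^+ q.
Proof. by rewrite mulr_ge0 // exprn_ge0 // (le_trans ler01) ?interaction_point_ge1. Qed.

Lemma interaction_error_ge0 N (x y : 'I_N -> 'rV[R]_d) i : 0 <= interaction_error x y i.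
Proof. by apply: avg_ge0 => j; exact: mulr_ge0 (factor_ge0 x y i j) (frob_ge0 _). Qed.

(* Splitting off the change of the measure keeps the one-sided Lipschitz
   estimate for the remaining difference [v(x_i, mu_y) - v(y_i, mu_y)]. *)
Lemma implicit_particle N h (x y : 'I_N -> 'rV[R]_d) i w : (0 < N)%N -> 0 <= h ->
  x i - y i - h *: (vfield f x (x i) - vfield f y (y i)) = w ->
  (1 - h * Lp) * frob (x i - y i) <= frob w + h * interaction_error x y i.
Proof.
move=> hN h0 hw.
have vB : frob (vfield f x (x i) - vfield f y (x i)) <= interaction_error x y i.
  rewrite /vfield -scalerBr -sumrB frobZ ger0_norm ?invr_ge0 //.
  apply: ler_wpM2l; first by rewrite invr_ge0.
  apply: le_trans (frob_sum _ _) _; apply: ler_sum => j _.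
  have le1 : frob (x i - x j) <= interaction_point x y i j.
    apply: le_trans (frobB _ _) _; rewrite /interaction_point.
    by have := frob_ge0 (y j); lra.
  have le2 : frob (x i - y j) <= interaction_point x y i j.
    apply: le_trans (frobB _ _) _; rewrite /interaction_point.
    by have := frob_ge0 (x j); lra.
  apply: le_trans (lip_growth hf (interaction_point_ge1 x y i j) le1 le2) _.
  apply: ler_wpM2l; first exact: factor_ge0.
  by rewrite opprB addrC addrA subrK frobBC.
have e : x i - y i - h *: (vfield f y (x i) - vfield f y (y i)) =
    w + h *: (vfield f x (x i) - vfield f y (x i)).
  rewrite -hw; move: (vfield f x _) (vfield f y (x i)) (vfield f y _) => a b c.
  by apply/rowP => k; rewrite !mxE; ring.
apply: le_trans (implicit_step h0 (onesided_vfield hf y (x i) (y i) hN) e) _.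
apply: le_trans (frobD _ _) _; rewrite lerD2l frobZ ger0_norm //.
exact: ler_wpM2l.
Qed.

(* By Cauchy-Schwarz the left side is at most [K * s ^ 2], [s] the system error;
   Young's inequality trades it for [h ^ 2 * (K ^ 3 + (s / h) ^ 3)], which is
   why the system error is estimated in the third moment: [K ^ 3] then only
   needs moments of order [6 * q]. *)
Lemma interaction_error_sqr N h (x y : 'I_N -> 'rV[R]_d) i : (0 < N)%N -> 0 < h ->
  interaction_error x y i ^+ 2 <=
  h ^+ 2 * ((3 * Lhf) ^+ 6 * avg (fun j => interaction_point x y i j ^+ (q * 6))
            + snorm (fun j => x j - y j) ^+ 3 / h ^+ 3).
Proof.
move=> hN h0; set K := avg (fun j => (3 * Lhf * interaction_point x y i j ^+ q) ^+ 2).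
have K0 : 0 <= K by apply: avg_ge0 => j; exact: sqr_ge0.
set s := snorm _; have s0 : 0 <= s by exact: snorm_ge0.
have K3 : K ^+ 3 <= (3 * Lhf) ^+ 6 * avg (fun j => interaction_point x y i j ^+ (q * 6)).
  apply: le_trans (avg_pow_le _ hN _) _ => [j|]; first exact: sqr_ge0.
  rewrite -avgZ; apply: avg_le => j.
  by rewrite -exprM exprMn -exprM.
have sh : 0 <= s / h by rewrite divr_ge0 // ltW.
apply: (@le_trans _ _ (h ^+ 2 * (K ^+ 3 + s ^+ 3 / h ^+ 3))); last first.
  by apply: ler_wpM2l; [exact: sqr_ge0|rewrite lerD2r].
apply: (@le_trans _ _ (K * s ^+ 2)).
  by rewrite snorm_sqr; exact: avg_cauchy_schwarz.
have := pow_mixed_le 1 2 K0 sh; rewrite expr1 -expr_div_n => /(ler_wpM2l (sqr_ge0 h)).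
apply: le_trans; have -> // : h ^+ 2 * (K * (s / h) ^+ 2) = K * s ^+ 2.
by field; rewrite gt_eqF.
Qed.

Lemma interaction_error_moment : exists2 C : R, 0 <= C &
  forall disp (Omega : measurableType disp) (P : probability Omega R)
    (F : R -> set (set Omega)) (W : nat -> R -> Omega -> 'rV[R]_l)
    (X0 : nat -> Omega -> 'rV[R]_d) (N M : nat) (X : 'I_N -> R -> Omega -> 'rV[R]_d)
    (Y : nat -> 'I_N -> Omega -> 'rV[R]_d),
  particle_model q m0 P F W X0 N -> 0 < step T M < Num.min 1 (zeta Lf)^-1 ->
  ips_solution f sigma T X0 W P F X -> ssm_implicit f sigma T X0 W M Y ->
  forall k n i, (n < M)%N ->
  mean_le P (fun w => \1_(fine_good T f sigma W M X k n) w *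
    interaction_error (fun j => X j (grid T M n) w) (fun j => Y n j w) i ^+ 2)
    (C * step T M ^+ 2).
Proof.
have [Cx Cx0 hCx] := X_moment hl hT sigma hf m0.
have [Cy Cy0 hCy] := Y_moment hl hT sigma hf m0.
have [Cs Cs0 hCs] := system_error hl hT sigma hf m0.
have D0 a b : 0 <= a -> 0 <= b -> 0 <= moment_sum (8 * q) a b :> R.
  by move=> a0 b0; rewrite /moment_sum mulr_ge0 ?exprn_ge0 ?addr_ge0.
pose Cu := moment_sum (8 * q) (moment_sum (8 * q) (moment_sum (8 * q) 1 Cx) Cx) Cy.
have Cu0 : 0 <= Cu by rewrite /Cu !D0.
have L6 : 0 <= (3 * Lhf) ^+ 6 by exact: exprn_ge0.
exists ((3 * Lhf) ^+ 6 * (1 + Cu) + Cs) => [|disp Omega P F W X0 N M X Y PM hst hX hY k n i nM].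
  by rewrite addr_ge0 // mulr_ge0 // addr_ge0.
have [hF bW X0F X0m hN] := PM; have [h0 h1 hL] := step_small hst.
set h := step T M in h0 h1 hL *.
have gn0 := grid_ge0 hst n; have gT : 0 <= grid T M n <= T.
  by rewrite gn0 (grid_le_T hst (ltnW nM)).
have pX j : moment_le P (8 * q) (fun w => frob (X j (grid T M n) w)) Cx.
  split => [|w|]; [|exact: frob_ge0|exact: hCx PM hX j _ gT].
  exact (meas_wrt_filtration_meas hF gn0 (meas_wrt_frob (vmeas_wrt_X hX j gT))).
have pY j : moment_le P (8 * q) (fun w => frob (Y n j w)) Cy.
  split => [|w|]; [|exact: frob_ge0|exact: hCy PM hst hY n j nM].
  exact (meas_wrt_filtration_meas hF gn0 (meas_wrt_frob (vmeas_wrt_stage hf PM hst hY j nM))).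
have pU j : moment_le P (8 * q) (fun w =>
    interaction_point (fun j => X j (grid T M n) w) (fun j => Y n j w) i j) Cu.
  exact (moment_leD (moment_leD (moment_leD (moment_le1 P (8 * q)) (pX i)) (pX j)) (pY j)).
have mA : measurable (fine_good T f sigma W M X k n).
  exact (filtration_measurable hF gn0 (fine_good_measurable hf PM hst hX k (ltnW nM))).
have q6 : (q * 6 <= 8 * q)%N by rewrite mulnC leq_mul2r orbT.
have tot : mean_le P (fun w => h ^+ 2 * ((3 * Lhf) ^+ 6 * avg (fun j =>
      interaction_point (fun j => X j (grid T M n) w) (fun j => Y n j w) i j ^+ (q * 6)) +
      (h ^+ 3)^-1 * (\1_(fine_good T f sigma W M X k n) w *
        snorm (fun i => stage_error T M X Y n i w) ^+ 3)))
   (h ^+ 2 * ((3 * Lhf) ^+ 6 * (1 + Cu) + (h ^+ 3)^-1 * (Cs * h ^+ 3))).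
  apply: mean_leZ; first exact: sqr_ge0.
  apply: mean_leD; last first.
    apply: mean_leZ; first by rewrite invr_ge0 exprn_ge0 // ltW.
    exact: hCs PM hst hX hY k n nM.
  apply: mean_leZ => //; apply: mean_le_avg => // j; have [mu u0 um] := pU j.
  exact: mean_le_pow_le q6 mu u0 um.
apply: (mean_le_trans (c := h ^+ 2 * ((3 * Lhf) ^+ 6 * (1 + Cu) + (h ^+ 3)^-1 * (Cs * h ^+ 3)))).
  by rewrite [_^-1 * _]mulrC mulfK ?expf_neq0 ?gt_eqF // mulrC.
apply: mean_le_le tot => [|w|w].
- apply: measurable_funM; first exact: measurable_indic.
  apply: measurable_funX; apply: measurable_funM => //; apply: measurable_sum => j.
  have [mu _ _] := pU j; apply: measurable_funM.
    by apply: measurable_funM => //; exact: measurable_funX.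
  have mE := vmeas_wrt_stage_error hf PM hst hX hY j nM.
  exact (meas_wrt_filtration_meas hF gn0 (meas_wrt_frob mE)).
- by rewrite mulr_ge0 ?sqr_ge0.
have i0 : 0 <= (h ^+ 3)^-1 by rewrite invr_ge0 exprn_ge0 // ltW.
rewrite !indicE; case: (_ \in _); rewrite ?mul1r ?mul0r ?mulr0 ?addr0; last first.
  rewrite mulr_ge0 ?sqr_ge0 // mulr_ge0 //; apply: avg_ge0 => j.
  by rewrite exprn_ge0 // (le_trans ler01) // interaction_point_ge1.
apply: le_trans (interaction_error_sqr _ _ i hN h0) _.
by rewrite [_ / h ^+ 3]mulrC.
Qed.

End particle_error.

Section particle_error.
Context {R : realType} (d l q : nat) (hl : (0 < l)%N) (T : R) (hT : 0 < T)
  (f : 'rV[R]_d -> 'rV[R]_d) (sigma : 'M[R]_(d, l)) (Lf Lhf Lf1 Lf2 : R)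
  (hf : granular_media q f Lf Lhf Lf1 Lf2) (m0 : R).
Let Lp := Num.max 0 Lf.
Let Lp0 : 0 <= Lp. Proof. by rewrite le_max lexx. Qed.

(** The recursion with [p = 0]. The interaction error is not of mean zero, but it is O(h) in mean
    square and carries a factor h, so it can be treated as part of the remaining drift [c]. *)
Lemma particle_error_good : exists2 C : R, 0 <= C &
  forall disp (Omega : measurableType disp) (P : probability Omega R)
    (F : R -> set (set Omega)) (W : nat -> R -> Omega -> 'rV[R]_l)
    (X0 : nat -> Omega -> 'rV[R]_d) (N M : nat) (X : 'I_N -> R -> Omega -> 'rV[R]_d)
    (Y : nat -> 'I_N -> Omega -> 'rV[R]_d),
  particle_model q m0 P F W X0 N -> 0 < step T M < Num.min 1 (zeta Lf)^-1 ->
  ips_solution f sigma T X0 W P F X -> ssm_implicit f sigma T X0 W M Y ->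
  forall k n i, (n < M)%N ->
  mean_le P (fun w => \1_(fine_good T f sigma W M X k n) w *
    frob (stage_error T M X Y n i w) ^+ 2) (C * step T M ^+ 2).
Proof.
have [Cr Cr0 hr] := moment_recursion 0 Lp0.
have [Cb Cb0 hCb] := block_bound_moment hl hT sigma hf m0.
have [Ci Ci0 hCi] := interaction_error_moment hl hT sigma hf m0.
have q2 : (q.+1 * 2 <= 8 * q)%N by have := gm_q hf; lia.
have [Cv Cv0 hCv] := initial_velocity_moment hl hT sigma hf m0 q2.
pose be := 4 * (1 + Cb + Ci).
exists (expR (T * Cr) * (16 * (Cv + Ci) + T * Cr * be)) => [|disp Omega P F W X0 N M X Y PM hst
    hX hY k n i nM].
  rewrite mulr_ge0 ?expR_ge0 // addr_ge0 ?mulr_ge0 //; [exact: addr_ge0|exact: ltW|].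
  by rewrite addr_ge0 // addr_ge0.
have [hF bW X0F X0m hN] := PM; have [h0 h1 hL] := step_small hst.
have M0 := M_gt0 hst.
set h := step T M in h0 h1 hL *.
have h2 : 0 <= h ^+ 2 by exact: sqr_ge0.
pose E n w := stage_error T M X Y n i w.
pose G n w := block_bound q T sigma Lhf Lf1 Lf2 W M X k n i w.
pose m n w := block_martingale T f sigma W M X k n i w.
pose A n := fine_good T f sigma W M X k n.
pose B n w := interaction_error q Lhf (fun j => X j (grid T M n) w) (fun j => Y n j w) i.
have G0 j w : 0 <= G j w by exact (block_bound_ge0 sigma hf W X hst k j i w).
have B0 j w : 0 <= B j w by exact (interaction_error_ge0 hf _ _ i).
have ltM j : (j <= M.-1)%N -> (j < M)%N by move=> jM; rewrite -(prednK M0) ltnS.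
have FA j : (j <= M)%N -> F (grid T M j) (A j).
  by move=> jM; exact (fine_good_measurable hf PM hst hX k jM).
have mA j : (j <= M)%N -> measurable (A j).
  by move=> jM; exact: (filtration_measurable hF (grid_ge0 hst j)) (FA j jM).
have dA j : A j.+1 `<=` A j by exact: fine_good_sub.
have vE j : (j < M)%N -> vmeas_wrt (F (grid T M j)) (E j).
  by move=> jM; exact (vmeas_wrt_stage_error hf PM hst hX hY i jM).
have mE j : (j < M)%N -> measurable_fun setT (fun w => frob (E j w)).
  by move=> jM; exact (meas_wrt_filtration_meas hF (grid_ge0 hst j) (meas_wrt_frob (vE j jM))).
have sh0 : 0 <= Num.sqrt h by exact: sqrtr_ge0.
have shh : Num.sqrt h * Num.sqrt h = h by rewrite -expr2 sqr_sqrtr // ltW.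
have m_le j w : frob (m j w) <= Num.sqrt h * (h * G j w).
  rewrite mulrA [_ * h]mulrC; exact (block_martingale_le sigma hf W X hst k j i w).
have G_moment j : (j < M)%N -> mean_le P (fun w => G j w ^+ 2) (1 + Cb).
  move=> jM; have [mG G3] := hCb _ _ _ _ _ _ _ _ _ PM hst hX k j i jM.
  exact: mean_le_pow_le (leqnSn 2) mG (G0 j) G3.
have B_moment j : (j < M)%N -> mean_le P (fun w => \1_(A j) w * B j w ^+ 2) (Ci * h ^+ 2).
  by move=> jM; exact: hCi PM hst hX hY k j i jM.
(* The step is implicit, so [B] is taken at the new time, where its moment is bounded on the good
   event only. The indicator is 1 wherever the recursion inequality is invoked. *)
pose c j w := h * G j w + \1_(A j.+1) w * B j.+1 w.
have c0 j w : 0 <= c j w by rewrite addr_ge0 // mulr_ge0 // ltW.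
have indic_sqr (S : set Omega) w (a : R) : (\1_S w * a) ^+ 2 = \1_S w * a ^+ 2.
  by rewrite exprMn indicE; case: (_ \in _); rewrite ?expr1n ?expr0n.
have be0 : 0 <= be by rewrite mulr_ge0 // addr_ge0 // addr_ge0.
have mG j : (j < M)%N -> measurable_fun setT (G j).
  by move=> jM; exact (hCb _ _ _ _ _ _ _ _ _ PM hst hX k j i jM).1.
have nu_moment j : (j < M.-1)%N -> mean_le P (fun w => (h * G j w) ^+ 2) (h ^+ 2 * be).
  move=> jM; under eq_fun do rewrite exprMn.
  apply: mean_le_trans (mean_leZ h2 (G_moment j (ltM j (ltnW jM)))).
  by apply: ler_wpM2l => //; rewrite /be; lra.
have c_moment j : (j < M.-1)%N -> mean_le P (fun w => c j w ^+ 2) (h ^+ 2 * be).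
  move=> jM; have jM1 : (j.+1 < M)%N by rewrite -(prednK M0) ltnS.
  have tot := mean_leZ (ler0n R 4) (mean_leD (mean_leZ h2 (G_moment j (ltnW jM1))) (B_moment j.+1
      jM1)).
  have e : 4 * (h ^+ 2 * (1 + Cb) + Ci * h ^+ 2) = h ^+ 2 * be by rewrite /be; ring.
  rewrite e in tot; apply: mean_le_le tot => [|w|w].
  - apply: measurable_funX; apply: measurable_funD.
      by apply: measurable_funM => //; exact: mG (ltnW jM1).
    have [mb _ _] := B_moment j.+1 jM1.
    have -> : (fun w => \1_(A j.+1) w * B j.+1 w) =
        (fun w => Num.sqrt (\1_(A j.+1) w * B j.+1 w ^+ 2)).
      by apply/funext => w; rewrite -indic_sqr sqrtr_sqr ger0_norm // mulr_ge0.
    exact: measurable_sqrtr.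
  - exact: sqr_ge0.
  - have a0 : 0 <= h * G j w by rewrite mulr_ge0 // ltW.
    have b0 : 0 <= \1_(A j.+1) w * B j.+1 w by rewrite mulr_ge0.
    have := pow_add_le 2 a0 b0; rewrite indic_sqr exprMn.
    by rewrite (_ : 2 ^+ 2 = 4) //; rewrite !exprS expr0; ring.
(* 16 is 4 times 4: the square of the bound 2 for the inverse of [1 - h * Lp], and the square of a
   sum of two terms. *)
have init : mean_le P (fun w => \1_(A 0%N) w * frob (E 0%N w) ^+ 2) (h ^+ 2 * (16 * (Cv + Ci))).
  have z0 : 0 <= grid T M 0 <= T by rewrite (grid_ge0 hst) (grid_le_T hst).
  have [_ hv] := hCv _ _ _ _ _ _ _ _ PM hX i _ z0.
  have BI : mean_le P (fun w => \1_(A 0%N) w * B 0%N w ^+ 2) Ci.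
    by apply: mean_le_trans (B_moment 0%N M0); rewrite ler_piMr // expr_le1 // ltW.
  have tot := mean_leZ h2 (mean_leZ (ler0n R 16) (mean_leD hv BI)).
  apply: mean_le_le_ae tot => [|w|].
  - apply: measurable_funM; first exact: measurable_indic (mA 0%N _).
    by apply: measurable_funX; exact: mE.
  - by rewrite mulr_ge0 ?sqr_ge0.
  apply: filterS (stage_error0 hT hf hst hX hY) => w hw.
  rewrite indicE; case: (_ \in _); last first.
    by rewrite !mul0r addr0 mulr_ge0 // mulr_ge0 // sqr_ge0.
  rewrite !mul1r; set r := vfield _ _ _.
  have := implicit_particle hf hN (ltW h0) (hw i); rewrite frobN frobZ gtr0_norm // -/r.
  rewrite -/(B 0%N w) -/(E 0%N w) => i1.
  have i3 : frob (E 0%N w) <= h * (2 * (frob r + B 0%N w)).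
    have E0 : 0 <= frob (E 0%N w) by exact: frob_ge0.
    have := mulr_ge0 _ E0 (x := 2^-1 - h * Lp); rewrite subr_ge0 => /(_ hL).
    move: i1; rewrite -/Lp -/h -[X i (grid T M 0) w - Y 0%N i w]/(E 0%N w).
    by move: (frob (E 0%N w)) (B 0%N w) (frob r) => a b c'; lra.
  have rB : 0 <= frob r + B 0%N w by rewrite addr_ge0 ?frob_ge0.
  apply: (@le_trans _ _ ((h * (2 * (frob r + B 0%N w))) ^+ 2)).
    by rewrite lerXn2r ?nnegrE ?frob_ge0 ?mulr_ge0 // ltW.
  rewrite exprMn; apply: ler_wpM2l => //.
  rewrite exprMn; have := pow_add_le 2 (frob_ge0 r) (B0 0%N w).
  have -> : 2 ^+ 2 = 4 :> R by rewrite !exprS expr0; ring.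
  by lra.
have hyp_step j w : (j < M.-1)%N -> A j.+1 w ->
    (1 - h * Lp) * frob (E j.+1 w) <= frob (E j w + m j w) + h * c j w.
  move=> jM Aw; have jM1 : (j.+1 < M)%N by rewrite -(prednK M0) ltnS.
  have := implicit_particle hf hN (ltW h0) (stage_errorS hf X hY i w jM1).
  move=> /le_trans; apply.
  pose Q := X i (grid T M j.+1) w - X i (grid T M j) w
    - noise sigma W i (grid T M j) (grid T M j.+1) w
    - h *: vfield f (fun j' => X j' (grid T M j.+1) w) (X i (grid T M j.+1) w) - m j w.
  have -> : stage_error T M X Y j i w + (X i (grid T M j.+1) w - X i (grid T M j) w -
     noise sigma W i (grid T M j) (grid T M j.+1) w -
     h *: vfield f (fun j' => X j' (grid T M j.+1) w) (X i (grid T M j.+1) w)) =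
     (E j w + m j w) + Q.
    rewrite /Q /E; move: (vfield _ _ _) (m j w) (stage_error _ _ _ _ _ _ _) => a b e.
    by apply/rowP => s; rewrite !mxE; ring.
  have hQ : frob Q <= h * (h * G j w).
    by rewrite mulrA -expr2; exact (block_step hf hst i (ltnW jM1) Aw).
  have -> : c j w = h * G j w + B j.+1 w by rewrite /c indicE mem_set // mul1r.
  have := frobD (E j w + m j w) Q; rewrite -/(B j.+1 w).
  by move: hQ; lra.
have nM' : (n <= M.-1)%N by rewrite -ltnS prednK.
have nu0 j w : 0 <= h * G j w by rewrite mulr_ge0 // ltW.
have concl := hr _ _ P h (h ^+ 2 * be) (h ^+ 2 * (16 * (Cv + Ci))) M.-1 A
  (fun j w => frob (E j w)) (fun j w => frob (E j w + m j w))
  (fun j w => dotp (E j w) (m j w)) (fun j w => h * G j w) c h0 h1 hL (mulr_ge0 h2 be0)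
  (fun j jM => mA j (ltnW (ltM j jM))) (fun j _ => dA j)
  (fun j jM => mE j (ltM j jM)) (fun j w => frob_ge0 _) (fun j w => frob_ge0 _)
  nu0 c0 _ _ hyp_step nu_moment c_moment _ init n nM'.
apply: mean_le_trans (concl _ _ _).
- have hh : 0 <= n%:R * h by rewrite mulr_ge0 // ltW.
  have nhT : n%:R * h <= T by exact: (grid_le_T hst (ltnW nM)).
  have nCT : n%:R * h * Cr <= T * Cr by rewrite ler_wpM2r.
  have -> : n%:R * (Cr * h) = n%:R * h * Cr by ring.
  have -> : n%:R * (Cr * h * (h ^+ 2 * be)) = n%:R * h * Cr * be * h ^+ 2 by ring.
  have CvCi : 0 <= 16 * (Cv + Ci) by rewrite mulr_ge0 // addr_ge0.
  rewrite -[leRHS]mulrA; apply: ler_pM; rewrite ?expR_ge0 ?ler_expR //.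
    by rewrite (addr_ge0 (mulr_ge0 h2 CvCi) (mulr_ge0 (mulr_ge0 (mulr_ge0 hh Cr0) be0) h2)).
  rewrite mulrC -mulrDl; apply: ler_wpM2r => //.
  by rewrite lerD2l ler_wpM2r.
- move=> j w; rewrite frobDsqr lerD2l.
  have := m_le j w; have := frob_ge0 (m j w).
  move=> s0 s1; rewrite -[X in X * _ ^+ 2]shh -expr2 -exprMn.
  by rewrite lerXn2r ?nnegrE // (le_trans s0).
- move=> j w; apply: le_trans (m_le j w); rewrite ler_norml.
  have := frobD (E j w) (m j w); have := frobB (E j w + m j w) (m j w).
  by rewrite addrK => a1 a2; apply/andP; split; lra.
- move=> j a jM hE; have jM' := ltM j (ltnW jM).
  have -> : (fun w => \1_(A j) w * (frob (E j w) ^+ 0 * dotp (E j w) (m j w))) =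
     (fun w => dotp (\1_(A j) w *: E j w) (m j w)).
    by apply/funext => w; rewrite dotpZl expr0 mul1r.
  apply: (mean0_block_martingale hl hT hf PM hst hX (p := 0) k i
    (Z := fun w => \1_(A j) w * frob (E j w)) (K := 1) (a := a)) => //.
  + move=> s; under eq_fun do rewrite mxE.
    apply: measurable_funM; last exact: vE.
    exact (meas_wrt_indic (FA j (ltnW jM'))).
  + by move=> w; rewrite mulr_ge0 ?frob_ge0.
  + by move=> w; rewrite frobZ ger0_norm // mul1r expr1.
  + by under eq_fun do rewrite indic_sqr.
Qed.

Lemma particle_error : exists2 C : R, 0 <= C &
  forall disp (Omega : measurableType disp) (P : probability Omega R)
    (F : R -> set (set Omega)) (W : nat -> R -> Omega -> 'rV[R]_l)
    (X0 : nat -> Omega -> 'rV[R]_d) (N M : nat) (X : 'I_N -> R -> Omega -> 'rV[R]_d)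
    (Y : nat -> 'I_N -> Omega -> 'rV[R]_d),
  particle_model q m0 P F W X0 N -> 0 < step T M < Num.min 1 (zeta Lf)^-1 ->
  ips_solution f sigma T X0 W P F X -> ssm_implicit f sigma T X0 W M Y ->
  forall n i, (n < M)%N ->
  mean_le P (fun w => frob (stage_error T M X Y n i w) ^+ 2) (C * step T M ^+ 2).
Proof.
have [C C0 hC] := particle_error_good.
exists C => // disp Omega P F W X0 N M X Y PM hst hX hY n i nM.
have gn0 := grid_ge0 hst n; have hF := pm_F PM.
apply: (mean_le_fatou (A := fun k => fine_good T f sigma W M X k n) (k0 := 0)).
- move=> k.
  exact (filtration_measurable hF gn0 (fine_good_measurable hf PM hst hX k (ltnW nM))).
- apply: measurable_funX.
  exact (meas_wrt_filtration_meas hF gn0 (meas_wrt_frob (vmeas_wrt_stage_error hf PM hst hX hY i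
      nM))).
- by move=> w; exact: sqr_ge0.
- exact (fine_good_eventually hT hf hst hX (ltnW nM)).
- by move=> k _; exact: hC PM hst hX hY k n i nM.
Qed.

End particle_error.

(** * Continuous extension *)

Lemma integrable_setU {R : realType} disp (S : measurableType disp)
    (mu : {measure set S -> \bar R}) (A B : set S) (g : S -> \bar R) :
  measurable A -> measurable B -> [disjoint A & B] ->
  mu.-integrable A g -> mu.-integrable B g -> mu.-integrable (A `|` B) g.
Proof.
move=> mA mB AB /integrableP[mgA gA] /integrableP[mgB gB].
have mg : measurable_fun (A `|` B) g by exact/measurable_funU.
apply/integrableP; split => //; rewrite ge0_integral_setU //; first exact: lte_add_pinfty.
exact: measurableT_comp.
Qed.

(** The interval is open on the right, since [t] may be the right end of its cell, where [g] is not
    prescribed; for the closed interval of [ssm_ext] the endpoint is a null set. *)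
Lemma integral_step {R : realType} (g : R -> R) (c : nat -> R) (h t : R) n : 0 < h ->
  (forall j s, (j <= n)%N -> j%:R * h <= s < j.+1%:R * h -> g s = c j) ->
  n%:R * h <= t <= n.+1%:R * h ->
  (@lebesgue_measure R).-integrable `[0, t[ (EFin \o g) /\
  \int[@lebesgue_measure R]_(s in `[0, t[) g s = \sum_(j < n) h * c j + (t - n%:R * h) * c n.
Proof.
move=> h0; have cell j a b : (forall s, a <= s < b -> g s = c j) -> a <= b ->
    (@lebesgue_measure R).-integrable `[a, b[ (EFin \o g) /\
    \int[@lebesgue_measure R]_(s in `[a, b[) g s = (b - a) * c j.
  move=> gc ab; have m : measurable (`[a, b[ : set (measurableTypeR R)) by exact: measurable_itv.
  have gE : {in `[a, b[%classic : set R, g =1 cst (c j)}.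
    by move=> s; rewrite inE /= in_itv /=; exact: gc.
  have mab : @lebesgue_measure R `[a, b[%classic = (b - a)%:E.
    rewrite lebesgue_measure_itv /= lte_fin; case: ltP => // ba.
    by rewrite (@le_anti _ _ a b) ?ab // subrr.
  split; last first.
    transitivity (\int[@lebesgue_measure R]_(s in `[a, b[) c j); first exact: eq_Rintegral.
    by rewrite Rintegral_cst // [LHS]mulrC; congr (_ * _); rewrite [X in fine X]mab.
  have sub : `[a, b[ `<=` `[a, b] by apply: subset_itvl; rewrite bnd_simp.
  have intc : (@lebesgue_measure R).-integrable `[a, b[ (EFin \o (fun=> c j)).
    apply: integrableS; [| |exact: sub|] => //.
    by apply: continuous_compact_integrable; [exact: segment_compact|move=> ?; exact: cvg_cst].
  by apply: (eq_integrable m _ _ _ intc) => s sab; rewrite /= gE.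
elim: n t => [|n ih] t gc /andP[nt tn].
  rewrite mul0r in nt; rewrite big_ord0 add0r mul0r subr0.
  have [] := cell 0%N 0 t _ nt; rewrite ?subr0 // => s /andP[s0 st].
  by apply: gc => //; rewrite mul0r s0 (lt_le_trans st).
have [||int1 val1] := ih (n.+1%:R * h).
- by move=> j s jn; apply: gc; exact: leqW.
- by rewrite lexx ler_wpM2r ?ler_nat // ltW.
have [||int2 val2] := cell n.+1 (n.+1%:R * h) t.
- by move=> s /andP[ns st]; apply: gc => //; rewrite ns (lt_le_trans st).
- exact: nt.
have z : (BLeft 0 <= BLeft (n.+1%:R * h))%O by rewrite bnd_simp mulr_ge0 // ltW.
have z' : (BLeft (n.+1%:R * h) <= BLeft t)%O by rewrite bnd_simp.
have disj : [disjoint `[0, n.+1%:R * h[%classic & `[n.+1%:R * h, t[%classic].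
  rewrite disj_set2E; apply/eqP; rewrite -subset0 => s [/=]; rewrite !in_itv /=.
  by move=> /andP[_ s1] /andP[s2 _]; move: (lt_le_trans s1 s2); rewrite ltxx.
have int : (@lebesgue_measure R).-integrable `[0, t[ (EFin \o g).
  rewrite (itv_bndbnd_setU z z'); apply: integrable_setU => //; exact: measurable_itv.
split => //; rewrite (itv_bndbnd_setU z z') Rintegral_setU //.
- rewrite val1 val2 big_ord_recr /=; congr (_ + _ + _).
  by rewrite -natr1; ring.
- by rewrite -(itv_bndbnd_setU z z').
Qed.

Section extension.
Context {R : realType} (d l q : nat) (T : R)
  (f : 'rV[R]_d -> 'rV[R]_d) (sigma : 'M[R]_(d, l)) (Lf Lhf Lf1 Lf2 : R)
  (hf : granular_media q f Lf Lhf Lf1 Lf2)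
  disp (Omega : measurableType disp) (W : nat -> R -> Omega -> 'rV[R]_l)
  (X0 : nat -> Omega -> 'rV[R]_d) (N M : nat) (Y : nat -> 'I_N -> Omega -> 'rV[R]_d).
Hypotheses (hst : 0 < step T M < Num.min 1 (zeta Lf)^-1)
  (hY : ssm_implicit f sigma T X0 W M Y).
Local Notation h := (step T M).
Local Notation grid := (grid T M).

Lemma kappa_grid n (s : R) : (n < M)%N -> grid n <= s < grid n.+1 -> kappa T M s = grid n.
Proof.
have [h0 _ _] := step_small hst; move=> nM /andP[ns sn]; apply/eqP; rewrite eq_le.
have mem : [set s' | exists n, [/\ (n < M)%N, s' = grid n & s' <= s]] (grid n) by exists n.
have ub : ubound [set s' | exists n, [/\ (n < M)%N, s' = grid n & s' <= s]] (grid n).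
  move=> _ [n' [_ -> n's]]; rewrite /Defs.grid ler_wpM2r ?(ltW h0) // ler_nat.
  have := le_lt_trans n's sn; rewrite /Defs.grid ltr_pM2r // ltr_nat.
  by rewrite ltnS.
apply/andP; split; first by apply: ge_sup => //; exists (grid n).
by apply: ub_le_sup => //; exists (grid n).
Qed.

Lemma stage_at_grid n (s : R) i w : (n < M)%N -> grid n <= s < grid n.+1 ->
  stage_at T M Y (kappa T M s) i w = Y n i w.
Proof.
have [h0 _ _] := step_small hst.
by move=> nM sn; rewrite /stage_at (kappa_grid nM sn) /Defs.grid mulfK ?gt_eqF // natrK.
Qed.

Lemma ssm_sum n i w : (n < M)%N -> ssm sigma T X0 W M Y n i w =
  X0 i w + \sum_(j < n) h *: vfield f (fun k => Y j k w) (Y j i w) + noise sigma W i 0 (grid n) w.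
Proof.
elim: n => [|n ih] nM; first by rewrite /= /Defs.grid mul0r noise_refl big_ord0 !addr0.
have := stage_equation hf hY i w (ltnW nM); rewrite (ih (ltnW nM)) big_ord_recr /=.
set v := vfield _ _ _; clearbody v; move=> /(canRL (subrK _)) ->; rewrite -(noiseD sigma W i 0
    (grid n) (grid n.+1)).
move: (\sum_(_ < _) _) (noise _ _ _ _ _ _) (noise _ _ _ 0 _ _) => a c e.
by apply/rowP => k; rewrite !mxE; ring.
Qed.

(** A stage contains the drift of its whole step from the outset, the extension only the part
    elapsed by time [t]; the difference is what the middle term subtracts. *)
Lemma ssm_ext_grid n (t : R) i w : (n < M)%N -> grid n <= t <= grid n.+1 ->
  ssm_ext f sigma T X0 W M Y i t w = Y n i w
   - (h - (t - grid n)) *: vfield f (fun j => Y n j w) (Y n i w) + noise sigma W i (grid n) t w.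
Proof.
have [h0 _ _] := step_small hst; move=> nM nt.
have [c cE] : exists c : nat -> 'rV[R]_d, forall j, c j = vfield f (fun k => Y j k w) (Y j i w).
  by exists (fun j => vfield f (fun k => Y j k w) (Y j i w)).
have val : rVintegral lebesgue_measure `[0, t] (fun s => drift f (stage_at T M Y (kappa T M s) i w)
    (empirical (fun j => stage_at T M Y (kappa T M s) j w))) =
    \sum_(j < n) h *: c j + (t - grid n) *: c n.
  apply/rowP => k; rewrite !mxE summxE.
  have [j s jn hs||int val] := @integral_step R (fun s => drift f (stage_at T M Y (kappa T M s) i w)
    (empirical (fun j => stage_at T M Y (kappa T M s) j w)) 0 k) (fun j => c j 0 k) h t n h0.
  - have jM : (j < M)%N by exact: leq_ltn_trans nM.
    rewrite (drift_empirical hf) cE (stage_at_grid i w jM hs).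
    by congr (vfield _ _ _ _ _); apply/funext => a; rewrite (stage_at_grid a w jM hs).
  - exact: nt.
  rewrite -Rintegral_itv_bndo_bndc // val; congr (_ + _).
  by apply: eq_bigr => j _; rewrite mxE.
have := ssm_sum i w nM; under eq_bigr do rewrite -cE.
have := stage_equation hf hY i w nM; rewrite -cE => <- e.
rewrite /ssm_ext val -(noiseD sigma W i 0 (grid n) t).
have -> : Y n i w = X0 i w + \sum_(j < n) h *: c j + noise sigma W i 0 (grid n) w + h *: c n.
  by rewrite -e subrK.
move: (\sum_(_ < _) _) (c n) (noise _ _ _ _ _ _) (noise _ _ _ 0 _ _) => a b b' e'.
by apply/rowP => k; rewrite !mxE; ring.
Qed.

Lemma grid_cell (t : R) : 0 <= t <= T -> exists2 n, (n < M)%N & grid n <= t <= grid n.+1.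
Proof.
have [h0 _ _] := step_small hst; move=> /andP[t0 tT].
have M0 := M_gt0 hst; have th0 : 0 <= t / h by rewrite divr_ge0 // ltW.
have /andP[lo hi] := truncn_itv th0.
have [tM|Mt] := ltnP (Num.truncn (t / h)) M.
  exists (Num.truncn (t / h)) => //.
  by rewrite /Defs.grid -ler_pdivlMr // lo /= -ler_pdivrMr // ltW.
(* This is [t = T], which belongs to the last cell because [kappa] stops at index [M - 1]. *)
exists M.-1; first by rewrite prednK.
rewrite prednK // (gridM hst) tT andbT.
apply: (@le_trans _ _ (grid M)); first by rewrite /Defs.grid ler_wpM2r ?ler_nat ?leq_pred // ltW.
by rewrite /Defs.grid -ler_pdivlMr // (le_trans _ lo) // ler_nat.
Qed.

End extension.

(** The velocity is sampled at finitely many fine times, where its moments are known, instead of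
    being integrated in time. On the good event the defects amount to at most [t - s]; Fatou's lemma
    removes the event. *)
Lemma drift_increment_moment {R : realType} (d l q : nat) (hl : (0 < l)%N) (T : R) (hT : 0 < T)
    (f : 'rV[R]_d -> 'rV[R]_d) (sigma : 'M[R]_(d, l)) (Lf Lhf Lf1 Lf2 : R)
    (hf : granular_media q f Lf Lhf Lf1 Lf2) (m0 : R) : exists2 C : R, 0 <= C &
  forall disp (Omega : measurableType disp) (P : probability Omega R)
    (F : R -> set (set Omega)) (W : nat -> R -> Omega -> 'rV[R]_l)
    (X0 : nat -> Omega -> 'rV[R]_d) (N : nat) (X : 'I_N -> R -> Omega -> 'rV[R]_d),
  particle_model q m0 P F W X0 N -> ips_solution f sigma T X0 W P F X ->
  forall i (s t : R), 0 <= s -> s <= t -> t <= T ->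
  mean_le P (fun w => frob (X i t w - X i s w - noise sigma W i s t w) ^+ 2) (C * (t - s) ^+ 2).
Proof.
have q2 : (q.+1 * 2 <= 8 * q)%N by have := gm_q hf; lia.
have [Cv Cv0 hCv] := initial_velocity_moment hl hT sigma hf m0 q2.
exists (4 * (1 + Cv)) => [|disp Omega P F W X0 N X PM hX i s t s0 st tT].
  by rewrite mulr_ge0 // addr_ge0.
have [hF bW X0F X0m hN] := PM; have t0 := le_trans s0 st.
have ts0 : 0 <= t - s by rewrite subr_ge0.
pose dk (k : nat) : R := (t - s) / k.+1%:R; pose tm k (j : nat) : R := s + j%:R * dk k.
have dk0 k : 0 <= dk k by rewrite divr_ge0.
have tmS k j : tm k j.+1 = tm k j + dk k by rewrite /tm -natr1 mulrDl mul1r addrA.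
have tmE k : tm k k.+1 = t by rewrite /tm /dk mulrC divfK ?pnatr_eq0 // addrC subrK.
have tm_ge0 k j : 0 <= tm k j by rewrite addr_ge0 // mulr_ge0.
have tm_le k j : (j <= k.+1)%N -> tm k j <= t.
  by move=> jk; rewrite -(tmE k) lerD2l ler_wpM2r // ler_nat.
have tmT k j : (j <= k.+1)%N -> 0 <= tm k j <= T.
  by move=> jk; rewrite tm_ge0 (le_trans (tm_le k j jk)).
pose A k := good f sigma W X (tm k) (dk k) k.+1.
have mI : vmeas_wrt (F t) (fun w => X i t w - X i s w - noise sigma W i s t w).
  apply: vswrtB; last exact (vmeas_wrt_noise sigma hF bW i s0 st).
  apply: vswrtB; first by apply: (vmeas_wrt_X hX); rewrite t0.
  apply: vmeas_wrt_sub (filtration_mono hF s0 st) _; apply: (vmeas_wrt_X hX).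
  by rewrite s0 (le_trans st).
have mZ : measurable_fun setT (fun w => frob (X i t w - X i s w - noise sigma W i s t w) ^+ 2).
  by apply: measurable_funX; exact (meas_wrt_filtration_meas hF t0 (meas_wrt_frob mI)).
have mA k : measurable (A k).
  apply: (filtration_measurable hF (tm_ge0 k k.+1)); apply: (good_measurable hf hF bW hX) => j jk.
    exact: tmT.
  by rewrite tmS lerDl.
apply: (mean_le_fatou (A := A) (k0 := 0)) => // [w||k _]; first exact: sqr_ge0.
  apply: filterS (defect_small hT hf hX) => w /(_ 1 ltr01)[r r0 hr].
  exists (Num.truncn ((t - s) / r)) => k kk j /= jk i' _ /=.
  have dE : tm k j.+1 - tm k j = dk k by rewrite tmS addrC addKr.
  rewrite -dE -[leRHS]mul1r; apply: hr => //.
  - by rewrite tmS lerDl.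
  - by have /andP[] := tmT k j.+1 jk.
  rewrite dE /dk ltr_pdivrMr // mulrC -ltr_pdivrMr //.
  by apply: lt_le_trans (truncnS_gt _) _; rewrite ler_nat ltnS.
have hv (j : 'I_k.+1) := hCv _ _ _ _ _ _ _ _ PM hX i _ (tmT k j.+1 (ltn_ord j)).
have tot := mean_leZ (sqr_ge0 (t - s)) (mean_leZ (ler0n R 4)
  (mean_leD (mean_le_cst P ler01) (mean_le_avg (ltn0Sn k) (fun j => (hv j).2)))).
rewrite mulrC; apply: mean_le_le tot => [|w|w].
- by apply: measurable_funM => //; exact: measurable_indic.
- by rewrite mulr_ge0 ?sqr_ge0.
have a0 : 0 <= avg (fun j : 'I_k.+1 => frob (velocity f X i (tm k j.+1) w)).
  by apply: avg_ge0 => j; exact: frob_ge0.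
have a2 := avg_pow_le 2 (ltn0Sn k) (fun j : 'I_k.+1 => frob_ge0 (velocity f X i (tm k j.+1) w)).
rewrite indicE; case: (boolP (w \in A k)) => [|_]; last first.
  rewrite mul0r mulr_ge0 ?sqr_ge0 // mulr_ge0 // addr_ge0 //.
  by apply: avg_ge0 => j; exact: sqr_ge0.
rewrite inE mul1r => Aw.
have telescope n : X i (tm k n) w - X i s w - noise sigma W i s (tm k n) w =
    \sum_(j < n) (defect f sigma W X i (tm k j) (tm k j.+1) w + dk k *: velocity f X i (tm k
        j.+1) w).
  elim: n => [|n ih]; first by rewrite big_ord0 /tm mul0r addr0 noise_refl !subrr.
  rewrite big_ord_recr /= -ih /defect -(noiseD sigma W i s (tm k n)).
  have -> : tm k n.+1 - tm k n = dk k by rewrite tmS addrC addKr.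
  move: (velocity _ _ _ _ _) => v.
  by apply/rowP => c; rewrite !mxE; ring.
have le1 : frob (X i t w - X i s w - noise sigma W i s t w) <=
    (t - s) * (1 + avg (fun j : 'I_k.+1 => frob (velocity f X i (tm k j.+1) w))).
  have := telescope k.+1; rewrite tmE => ->; apply: le_trans (frob_sum _ _) _.
  apply: (@le_trans _ _ (\sum_(j < k.+1) (dk k * (1 + frob (velocity f X i (tm k j.+1) w))))).
    apply: ler_sum => j _; apply: le_trans (frobD _ _) _; rewrite mulrDr mulr1.
    apply: lerD; first exact: (Aw j (ltn_ord j) i Logic.I).
    by rewrite frobZ ger0_norm.
  by rewrite -mulr_sumr big_split /= sumr_const card_ord /dk /avg -mulrA mulrDr mulVf ?pnatr_eq0.
apply: (@le_trans _ _ (((t - s) *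
    (1 + avg (fun j : 'I_k.+1 => frob (velocity f X i (tm k j.+1) w)))) ^+ 2)).
  rewrite lerXn2r ?nnegrE ?frob_ge0 //.
  by apply: mulr_ge0 => //; exact: addr_ge0.
rewrite exprMn; apply: ler_wpM2l; first exact: sqr_ge0.
have := pow_add_le 2 ler01 a0; rewrite expr1n (_ : 2 ^+ 2 = 4); last by rewrite !exprS expr0; ring.
by move=> /le_trans; apply; apply: ler_wpM2l => //; rewrite lerD2l.
Qed.

(** * Initial moments and conclusion *)

Lemma measurable_frob_borel {R : realType} d :
  measurable_fun setT (fun x : borelRV R d => frob x).
Proof.
have mc k : measurable_fun setT (fun x : borelRV R d => x 0 k).
  by move=> _ B mB; rewrite setTI; exact: measurable_coordinate.
have -> : (fun x : borelRV R d => frob x) = (fun x => Num.sqrt (dotp x x)).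
  by apply/funext => x; rewrite dotpp sqrtr_sqr ger0_norm ?frob_ge0.
apply: measurable_sqrtr; apply: measurable_sum => k.
exact: measurable_funM.
Qed.

(** The bound is an integral against the common law, hence the same for every probability space. The
    real exponent [m] controls the natural exponent [p] through x^p <= 1 + x^m. *)
Lemma initial_law_moment {R : realType} d p disp (Omega : measurableType disp)
    (P : probability Omega R) (F : R -> set (set Omega)) (m : R)
    (mu0 : probability (borelRV R d) R) (X0 : nat -> Omega -> 'rV[R]_d) :
  complete_filtration P F -> iid_initial P F m mu0 X0 -> p%:R <= m -> forall i,
  mean_le P (fun w => frob (X0 i w) ^+ p) (fine (\int[mu0]_x (frob x ^+ p)%:E)%E).
Proof.
move=> hF [X0F X0m X0law _] pm i.
have mX : measurable_fun setT (X0 i : Omega -> borelRV R d).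
  move=> _ B mB; apply: (filtration_measurable hF (lexx 0)); apply: X0F.
  by exists B.
have mf : measurable_fun setT (fun x : borelRV R d => (frob x ^+ p)%:E).
  by apply/measurable_EFinP; apply: measurable_funX; exact: measurable_frob_borel.
have e : (\int[mu0]_x (frob x ^+ p)%:E = \int[P]_w (frob (X0 i w) ^+ p)%:E)%E.
  transitivity (\int[pushforward P (X0 i : Omega -> borelRV R d)]_x (frob x ^+ p)%:E)%E.
    by apply: eq_measure_integral => B mB _; exact: (esym (X0law i B mB)).
  by rewrite ge0_integral_pushforward // => x _; rewrite lee_fin exprn_ge0 ?frob_ge0.
have mfX : measurable_fun setT (fun w => frob (X0 i w)).
  exact: (measurableT_comp (@measurable_frob_borel R d) mX).
have fin : (\int[P]_w (frob (X0 i w) ^+ p)%:E < +oo)%E.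
  have X0m' : (\int[P]_w (frob (X0 i w) `^ m)%:E < +oo)%E by have := X0m i; rewrite unlock.
  apply: (@le_lt_trans _ _ (\int[P]_w ((1 + frob (X0 i w) `^ m)%:E))%E).
    apply: ge0_le_integral => //.
    - by move=> w _; rewrite lee_fin exprn_ge0 ?frob_ge0.
    - by apply/measurable_EFinP; exact: measurable_funX.
    - by apply/measurable_EFinP; apply: measurable_funD => //; exact: measurableT_comp
        (measurable_powR m) mfX.
    - move=> w _; rewrite lee_fin -powR_mulrn ?frob_ge0 //.
      have [x1|x1] := leP 1 (frob (X0 i w)).
        by apply: ler_wpDl => //; exact: ler_powR.
      apply: ler_wpDr; first exact: powR_ge0.
      by rewrite powR_mulrn ?frob_ge0 // exprn_ile1 ?frob_ge0 // ltW.
  under eq_integral do rewrite EFinD.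
  rewrite ge0_integralD //; last 2 first.
  - by move=> w _; rewrite lee_fin powR_ge0.
  - by apply/measurable_EFinP; exact: measurableT_comp (measurable_powR m) mfX.
  apply: lte_add_pinfty => //.
  by rewrite integral_cst // [X in (_ * X)%E]probability_setT mule1 ltry.
split; first exact: measurable_funX.
- by move=> w; rewrite exprn_ge0 ?frob_ge0.
- rewrite e fineK // ge0_fin_numE //.
  by apply: integral_ge0 => w _; rewrite lee_fin exprn_ge0 ?frob_ge0.
Qed.

Lemma sqr_add3_le {R : realType} (a b c : R) :
  (a + b + c) ^+ 2 <= 3 * (a ^+ 2 + b ^+ 2 + c ^+ 2).
Proof.
rewrite -subr_ge0; have -> : 3 * (a ^+ 2 + b ^+ 2 + c ^+ 2) - (a + b + c) ^+ 2 =
  (a - b) ^+ 2 + (b - c) ^+ 2 + (a - c) ^+ 2 by ring.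
by rewrite !addr_ge0 ?sqr_ge0.
Qed.

Theorem theorem2p13 (R : realType) (d l : nat) (hd : (1 <= d)%N)
  (hl : (1 <= l)%N) (T : R) (hT : 0 < T)
  (q : nat) (f : 'rV[R]_d -> 'rV[R]_d) (sigma : 'M[R]_(d, l))
  (Lf Lhf Lf1 Lf2 : R) (hf : granular_media q f Lf Lhf Lf1 Lf2)
  (m : R) (hm : Num.max (8 * q)%:R (4 * q + 4)%:R <= m)
  (mu0 : probability (borelRV R d) R) :
  exists C : R, 0 < C /\
  forall (disp : measure_display) (Omega : measurableType disp)
    (P : probability Omega R) (F : R -> set (set Omega))
    (W : nat -> R -> Omega -> 'rV[R]_l) (X0 : nat -> Omega -> 'rV[R]_d),
  complete_filtration P F ->
  independent_brownians P F W ->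
  iid_initial P F m mu0 X0 ->
  forall N M : nat, (1 <= N)%N -> (1 <= M)%N ->
  0 < step T M < Num.min 1 (zeta Lf)^-1 ->
  forall (X : 'I_N -> R -> Omega -> 'rV[R]_d)
    (Y : nat -> 'I_N -> Omega -> 'rV[R]_d),
  ips_solution f sigma T X0 W P F X ->
  ssm_implicit f sigma T X0 W M Y ->
  (ereal_sup [set ereal_sup
     [set 'E_P[fun w =>
              (frob (X i t w - ssm_ext f sigma T X0 W M Y i t w) ^+ 2)%R]
       | t in `[0%R, T]] | i in [set: 'I_N]]
   <= (C * step T M ^+ 2)%:E)%E.
Proof.
pose m0 := fine (\int[mu0]_x (frob x ^+ (8 * q))%:E)%E.
have [Ce Ce0 hCe] := particle_error hl hT sigma hf m0.
have [Ci Ci0 hCi] := drift_increment_moment hl hT sigma hf m0.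
have [Cy Cy0 hCy] := Y_moment hl hT sigma hf m0.
have q2 : (q.+1 * 2 <= 8 * q)%N by have := gm_q hf; lia.
have [Cv Cv0 hCv] := vfield_moment hf Cy0 q2.
(* The 3 comes from [sqr_add3_le]; the 1 makes the constant positive. *)
exists (3 * (Ci + Ce + Cv) + 1); split.
  by rewrite ltr_wpDl // mulr_ge0 // !addr_ge0.
move=> disp Omega P F W X0 hF [bW _] hX0 N M hN _ hst X Y hX hY.
have [h0 h1 _] := step_small hst; set h := step T M in h0 h1 *.
have h2 : 0 <= h ^+ 2 by exact: sqr_ge0.
have PM : particle_model q m0 P F W X0 N.
  split => //; first by case: hX0.
  by apply: initial_law_moment hX0 _ => //; apply: le_trans hm; rewrite le_max lexx.
apply: ge_ereal_sup => _ [i _ <-]; apply: ge_ereal_sup => _ [t /= tT <-].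
rewrite in_itv /= in tT; rewrite unlock.
suff [_ _ /le_trans] : mean_le P (fun w => frob (X i t w - ssm_ext f sigma T X0 W M Y i t w) ^+ 2)
    (3 * (Ci + Ce + Cv) * h ^+ 2).
  by apply; rewrite lee_fin ler_wpM2r // lerDl.
have [n nM nt] := grid_cell hst tT; have /andP[nt1 nt2] := nt; have /andP[t0 tT'] := tT.
have gn0 := grid_ge0 hst n; have gT : 0 <= grid T M n <= T.
  by rewrite gn0 (grid_le_T hst (ltnW nM)).
have hcell : 0 <= h - (t - grid T M n) <= h.
  by have := gridS T M n; rewrite -/h; lra.
pose v w := vfield f (fun j => Y n j w) (Y n i w).
have vv : vmeas_wrt (F (grid T M n)) v.
  by apply: (vmeas_wrt_vfield hf) => [j|]; exact (vmeas_wrt_stage hf PM hst hY _ nM).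
have v_moment : mean_le P (fun w => frob (v w) ^+ 2) Cv.
  apply: (hCv _ _ P N (fun j => Y n j) hN) => // [j|].
    split => [|w|]; [|exact: frob_ge0|exact: hCy PM hst hY n j nM].
    exact (meas_wrt_filtration_meas hF gn0 (meas_wrt_frob (vmeas_wrt_stage hf PM hst hY j nM))).
  exact (meas_wrt_filtration_meas hF gn0 (meas_wrt_frob vv)).
pose I w := X i t w - X i (grid T M n) w - noise sigma W i (grid T M n) t w.
(* Both processes carry the same noise since the last grid point, so it cancels. What remains is the
   drift of the solution over the cell, the stage error, and the part of the stage drift not yet
   elapsed, each of order h in mean square. *)
have errE w : X i t w - ssm_ext f sigma T X0 W M Y i t w =
    I w + stage_error T M X Y n i w + (h - (t - grid T M n)) *: v w.
  rewrite (ssm_ext_grid hf hst hY i w nM nt) -/h -/(v w) /I /stage_error.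
  move: (v w) => z; by apply/rowP => c; rewrite !mxE; ring.
under eq_fun do rewrite errE.
have I_moment := hCi _ _ _ _ _ _ _ _ PM hX i _ _ gn0 nt1 tT'.
have e_moment := hCe _ _ _ _ _ _ _ _ _ _ PM hst hX hY n i nM.
have tot := mean_leZ (ler0n R 3) (mean_leD (mean_leD I_moment e_moment) (mean_leZ h2 v_moment)).
apply: (mean_le_trans (c := 3 * (Ci * (t - grid T M n) ^+ 2 + Ce * h ^+ 2 + h ^+ 2 * Cv))).
  rewrite -mulrA; apply: ler_wpM2l => //; rewrite !mulrDl [h ^+ 2 * Cv]mulrC !lerD2r.
  by apply: ler_wpM2l => //; rewrite lerXn2r ?nnegrE ?subr_ge0 ?(ltW h0) //; lra.
apply: mean_le_le tot => [|w|w]; last 1 first.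
- apply: (@le_trans _ _ ((frob (I w) + frob (stage_error T M X Y n i w) + h * frob (v w)) ^+ 2)).
    have b0 := addr_ge0 (addr_ge0 (frob_ge0 (I w)) (frob_ge0 (stage_error T M X Y n i w)))
      (mulr_ge0 (ltW h0) (frob_ge0 (v w))).
    rewrite lerXn2r ?nnegrE ?frob_ge0 //.
    apply: le_trans (frobD _ _) _; apply: lerD; first exact: frobD.
    have /andP[c0 ch] := hcell; rewrite frobZ ger0_norm //.
    by rewrite ler_wpM2r ?frob_ge0.
  by apply: le_trans (sqr_add3_le _ _ _) _; rewrite [(h * _) ^+ 2]exprMn.
- apply: measurable_funX.
  have sub := filtration_mono hF gn0 nt1.
  have mI : vmeas_wrt (F t) I.
    apply: vswrtB; last exact (vmeas_wrt_noise sigma hF bW i gn0 nt1).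
    apply: vswrtB; first exact (vmeas_wrt_X hX i tT).
    exact (vmeas_wrt_sub sub (vmeas_wrt_X hX i gT)).
  apply: (meas_wrt_filtration_meas hF t0); apply: meas_wrt_frob.
  apply: vswrtD; last exact (vmeas_wrt_sub sub (vswrtZ _ vv)).
  by apply: vswrtD => //; exact (vmeas_wrt_sub sub (vmeas_wrt_stage_error hf PM hst hX hY i nM)).
- exact: sqr_ge0.
Qed.
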